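(* Let $h(t)=\sum_{i\in\mathbb{Z}}h_it^i$ be a polynomial, of degree $c$, and put $r_i=\binom{p-1+i}{p-1}$. Then $h(t)$ is a (positive) rational multiple of the $h$-vector of a level $R$-module of codimension $p$, generated in degree zero, whose Betti diagram is a non-negative linear combination of pure diagrams, if and only if $$\left|\begin{matrix} h_{i-1} & h_{i} & h_{i+1}\\ r_{i-1} & r_i & r_{i+1}\\ r_{c-i+1} & r_{c-i} & r_{c-i-1}\end{matrix}\right|\ \ge\ 0\qquad\text{for all integers } i.$$
   Context: $k$ is a field, $R=k[x_1,\dots,x_n]$ is standard graded (with enough variables for modules of codimension $p$ to exist), and all $R$-modules are finitely generated and graded. The polynomial $h(t)$ has rational coefficients, with $h_i=0$ for $i<0$ and $i>c$. The number $r_i$ is the dimension of the degree $i$ component of the polynomial ring in $p$ variables, so $r_i=0$ for $i<0$. $\beta_{i,j}(M)=\dim_k\operatorname{Tor}^R_i(M,k)_j$ are the graded Betti numbers, and $\beta(M)=(\beta_{i,j}(M))_{i,j}$ is the Betti diagram. For a Cohen-Macaulay module $M$ of codimension $p=\dim R-\dim M$, the $h$-vector is $h_M(t)=\big(\sum_{i,j}(-1)^i\beta_{i,j}(M)t^j\big)/(1-t)^p\in\mathbb{Z}[t,t^{-1}]$. A module $M$ of codimension $p$ is level if it is Cohen-Macaulay and its artinian reduction has generators and socle concentrated in single degrees; equivalently, it is Cohen-Macaulay, $\beta_{0,j}(M)\neq0$ for exactly one $j$, and $\beta_{p,j}(M)\ne 0$ for exactly one $j$. A diagram of codimension $p$ is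 a matrix $D=(D_{i,j})_{i,j\in\mathbb{Z}}$ of rational numbers with finitely many nonzero entries, with $D_{i,j}=0$ unless $0\le i\le p$, such that $\sum_{i,j}(-1)^iD_{i,j}t^j$ is divisible by $(1-t)^p$ in $\mathbb{Q}[t,t^{-1}]$. For a strictly increasing sequence of integers $d=(d_0,\dots,d_p)$, $\pi(d)$ denotes the unique diagram of codimension $p$ with $\pi(d)_{i,j}=0$ whenever $j\ne d_i$ and $\pi(d)_{0,d_0}=1$; it is the pure diagram of type $d$. A non-negative linear combination of pure diagrams is a finite sum $\sum_d a_d\pi(d)$ with $a_d\in\mathbb{Q}_{\ge0}$.
   Formalization: The codimension p is assumed to be at least 2; for p = 1 the claim fails, e.g. with c = 1 the polynomial h(t) = -1-t satisfies all the determinant inequalities but is not a positive multiple of an h-vector (it also fails for p = 0). *)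

(* Defs.v *)
From HB Require Import structures.
From mathcomp Require Import all_boot all_order all_algebra.
From mathcomp Require Import mpoly ring_quotient.

Set Implicit Arguments.
Unset Strict Implicit.
Unset Printing Implicit Defensive.

Import Order.TTheory GRing.Theory Num.Theory.
Local Open Scope ring_scope.

(* Finitely generated graded modules over R = k[x_1, ..., x_n]; gm_piece j is
   the degree j component. *)
Record gradedModule (k : fieldType) (n : nat) := GradedModule {
  gm_sort :> lmodType {mpoly k[n]};
  gm_piece : int -> gm_sort -> Prop;
  gm_piece0 : forall j, gm_piece j 0;
  gm_pieceB : forall j x y,
    gm_piece j x -> gm_piece j y -> gm_piece j (x - y);
  gm_pieceZ : forall (d : nat) j (f : {mpoly k[n]}) x,
    f \is d.-homog -> gm_piece j x -> gm_piece (d%:Z + j) (f *: x);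
  gm_decomp : forall x, exists (s : seq int) (y : int -> gm_sort),
    [/\ uniq s, forall j, gm_piece j (y j) & x = \sum_(j <- s) y j];
  gm_direct : forall (s : seq int) (y : int -> gm_sort),
    uniq s -> (forall j, gm_piece j (y j)) -> \sum_(j <- s) y j = 0 ->
    forall j, j \in s -> y j = 0;
  gm_fingen : exists (m : nat) (g : 'I_m -> gm_sort),
    forall x, exists f : 'I_m -> {mpoly k[n]}, x = \sum_(a < m) f a *: g a
}.

Definition generated_in_degree (k : fieldType) (n : nat)
    (M : gradedModule k n) (j : int) : Prop :=
  forall x : M, exists (m : nat) (g : 'I_m -> M) (f : 'I_m -> {mpoly k[n]}),
    (forall a, gm_piece j (g a)) /\ x = \sum_(a < m) f a *: g a.

Definition annihilator (k : fieldType) (n : nat) (M : gradedModule k n)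
    (f : {mpoly k[n]}) : Prop := forall x : M, f *: x = 0.

(* P 0 < P 1 < ... < P e is a strict chain of prime ideals containing I;
   [idealr_closed] already requires the ideal to be proper. *)
Definition prime_chain (R : comNzRingType) (I : R -> Prop) (e : nat)
    (P : nat -> {pred R}) : Prop :=
  (forall a, (a <= e)%N ->
     [/\ idealr_closed (P a), prime_idealr_closed (P a)
       & forall f, I f -> f \in P a]) /\
  (forall a, (a < e)%N ->
     {subset P a <= P a.+1} /\ exists2 f, f \in P a.+1 & f \notin P a).

(* The Krull dimension of R / I is d; there is no such d when I = R. *)
Definition krull_dim (R : comNzRingType) (I : R -> Prop) (d : nat) : Prop :=
  (exists P, prime_chain I d P) /\
  (forall e P, prime_chain I e P -> (e <= d)%N).

Definition has_codim (k : fieldType) (n : nat) (M : gradedModule k n)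
    (p : nat) : Prop :=
  exists dR dM : nat,
    [/\ krull_dim (fun f : {mpoly k[n]} => f = 0) dR,
        krull_dim (annihilator M) dM
      & dR = (dM + p)%N].

Definition in_span (k : fieldType) (n : nat) (M : gradedModule k n)
    (s : seq {mpoly k[n]}) (x : M) : Prop :=
  exists y : 'I_(size s) -> M, x = \sum_(a < size s) s`_a *: y a.

(* s is an M-regular sequence in the irrelevant ideal (x_1, ..., x_n). *)
Definition regular_seq (k : fieldType) (n : nat) (M : gradedModule k n)
    (s : seq {mpoly k[n]}) : Prop :=
  [/\ all (fun f => f@_0%MM == 0) s,
      forall (a : nat) (x : M), (a < size s)%N ->
        in_span (take a s) (s`_a *: x) -> in_span (take a s) x
    & exists x : M, ~ in_span s x].

Definition has_depth (k : fieldType) (n : nat) (M : gradedModule k n)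
    (d : nat) : Prop :=
  (exists2 s, size s = d & regular_seq M s) /\
  (forall s, regular_seq M s -> (size s <= d)%N).

Definition cohen_macaulay (k : fieldType) (n : nat)
    (M : gradedModule k n) : Prop :=
  exists2 d, krull_dim (annihilator M) d & has_depth M d.

Definition homog_int (k : fieldType) (n : nat) (e : int)
    (f : {mpoly k[n]}) : Prop :=
  f = 0 \/ exists2 d : nat, e = d%:Z & f \is d.-homog.

(* A graded free resolution
     ... -> F_2 -> F_1 -> F_0 -> M -> 0,  F_i = \bigoplus_s R(- fr_deg i s),
   not necessarily minimal. Elements of F_i are row vectors, and maps act by
   right multiplication. *)
Record free_resolution (k : fieldType) (n : nat) (M : gradedModule k n) :=
FreeResolution {
  fr_rank : nat -> nat;
  fr_deg : forall i, 'I_(fr_rank i) -> int;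
  fr_aug : 'I_(fr_rank 0) -> M;
  fr_diff : forall i, 'M[{mpoly k[n]}]_(fr_rank i.+1, fr_rank i);
  fr_aug_homog : forall s, gm_piece (fr_deg s) (fr_aug s);
  fr_diff_homog : forall i r s,
    homog_int (fr_deg r - fr_deg s) (fr_diff i r s);
  fr_aug_surj : forall x : M, exists v : 'rV[{mpoly k[n]}]_(fr_rank 0),
    x = \sum_s v 0 s *: fr_aug s;
  fr_exact0 : forall v : 'rV[{mpoly k[n]}]_(fr_rank 0),
    \sum_s v 0 s *: fr_aug s = 0 <-> exists w, v = w *m fr_diff 0;
  fr_exact : forall i (v : 'rV[{mpoly k[n]}]_(fr_rank i.+1)),
    v *m fr_diff i = 0 <-> exists w, v = w *m fr_diff i.+1
}.

(* The degree j strand of F_{i+1} (x) k -> F_i (x) k: reduction modulo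
   (x_1, ..., x_n) keeps the constant terms, and basis elements of degree
   other than j are replaced by 0, which does not change the rank. *)
Definition tor_diff (k : fieldType) (n : nat) (M : gradedModule k n)
    (F : free_resolution M) (i : nat) (j : int) :
    'M[k]_(fr_rank F i.+1, fr_rank F i) :=
  \matrix_(r, s)
    (if (fr_deg r == j) && (fr_deg s == j) then (fr_diff F i r s)@_0%MM else 0).

(* dim_k Tor_i(M, k)_j = dim (F_i (x) k)_j - rank(outgoing) - rank(incoming);
   the truncated subtraction is harmless since F (x) k is a complex. *)
Definition tor_dim (k : fieldType) (n : nat) (M : gradedModule k n)
    (F : free_resolution M) (i : nat) (j : int) : nat :=
  (#|[set s : 'I_(fr_rank F i) | fr_deg s == j]|
   - (if i is i'.+1 then \rank (tor_diff F i' j) else 0)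
   - \rank (tor_diff F i j))%N.

(* Tor does not depend on the resolution, so b is determined by M. *)
Definition is_betti (k : fieldType) (n : nat) (M : gradedModule k n)
    (b : nat -> int -> nat) : Prop :=
  exists F : free_resolution M, forall i j, b i j = tor_dim F i j.

Definition level (k : fieldType) (n : nat) (M : gradedModule k n)
    (p : nat) : Prop :=
  [/\ has_codim M p, cohen_macaulay M
    & exists2 b, is_betti M b &
        (exists! j, b 0%N j <> 0%N) /\ (exists! j, b p j <> 0%N)].

(* A Laurent polynomial is a finitely supported function int -> A. *)
Definition fin_supp (A : nmodType) (f : int -> A) : Prop :=
  exists s : seq int, forall j, j \notin s -> f j = 0.

Definition mul_1subt (A : zmodType) (f : int -> A) : int -> A :=
  fun j => f j - f (j - 1).

(* The coefficient of t^j in \sum_(i <= m) \sum_j (-1)^i D_{i,j} t^j. *)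
Definition alt_sum (A : pzRingType) (m : nat) (D : nat -> int -> A)
    (j : int) : A := \sum_(i < m.+1) (-1) ^+ i * D i j.

(* By Hilbert's syzygy theorem b_{i,j} = 0 for i > n, so the sum over i <= n
   is the full one. *)
Definition is_hvector (n p : nat) (b : nat -> int -> nat)
    (g : int -> int) : Prop :=
  fin_supp g /\
  forall j, iter p (@mul_1subt int) g j = alt_sum n (fun i l => (b i l)%:Z) j.

Definition is_diagram (p : nat) (D : nat -> int -> rat) : Prop :=
  [/\ exists s : seq int, forall i j, j \notin s -> D i j = 0,
      forall i j, (p < i)%N -> D i j = 0
    & exists2 g : int -> rat, fin_supp g &
        forall j, iter p (@mul_1subt rat) g j = alt_sum p D j].

Definition is_pure_diagram (p : nat) (d : (p.+1).-tuple int)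
    (D : nat -> int -> rat) : Prop :=
  [/\ is_diagram p D,
      forall i j, j != d`_i -> D i j = 0
    & D 0%N d`_0 = 1].

Definition pure_combination (p : nat) (D : nat -> int -> rat) : Prop :=
  exists (m : nat) (a : 'I_m -> rat) (d : 'I_m -> (p.+1).-tuple int)
         (E : 'I_m -> nat -> int -> rat),
    [/\ forall l, 0 <= a l,
        forall l, sorted <%R (d l),
        forall l, is_pure_diagram (d l) (E l)
      & forall i j, D i j = \sum_(l < m) a l * E l i j].

Definition hcoef (h : {poly rat}) (i : int) : rat :=
  if i is Posz m then h`_m else 0.

(* r_i for p variables; only used with p > 0. *)
Definition rcoef (p : nat) (i : int) : rat :=
  if i is Posz m then 'C(p.-1 + m, p.-1)%:R else 0.

Definition hmatrix (p c : nat) (h : {poly rat}) (i : int) : 'M[rat]_3 :=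
  \matrix_(a < 3, b < 3)
    nth 0 (nth [::]
      [:: [:: hcoef h (i - 1); hcoef h i; hcoef h (i + 1)];
          [:: rcoef p (i - 1); rcoef p i; rcoef p (i + 1)];
          [:: rcoef p (c%:Z - i + 1); rcoef p (c%:Z - i);
              rcoef p (c%:Z - i - 1)]] a) b.

(* Main.v *)
(* Idea. For a level module generated in degree 0, all pure diagrams entering its
   Betti diagram have d_0 = 0 and d_p = c + p. Up to sign and a positive factor,
   the h-vector of such a pure diagram is the divided difference of x -> r(j - x)
   at the nodes d_i, and exchanging nodes one at a time reduces the inequalities
   to the types (0, m+1, ..., m+p-1, c+p). The h-vector of such a type is
   proportional to hat_m(j) = r_{c-m} r_j for j <= m and r_m r_{c-j} for j >= m,
   whose determinants vanish for i <> m and are positive for i = m. Hence,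
   conversely, a polynomial satisfying the inequalities is a non-negative
   combination of the hat_m.
   A module with h-vector a multiple of hat_m is obtained by gluing copies of the
   polynomial ring in degrees <= m to copies of its graded dual in degrees >= m
   through an isomorphism in degree m whose coefficients are values of Vandermonde
   matrices at a matrix C for which all differences of the relevant powers are
   invertible; this works over every field. The direct sum of such modules is
   extended to R by letting the remaining n - p variables act freely, its
   resolution is the Koszul complex on x_l - X_l, and the vanishing of the Tor
   groups off the pure type is regularity of the x_l in degrees < m and
   coregularity in degrees > m. *)

(* Over a small field there are too few scalars with distinct powers, hence values at a matrix [C];
   each piece is then replaced by several copies of itself, which only scales its h-vector. Rational
   coefficients are treated alike, by clearing denominators and taking direct sums. For necessity,
   no cancellation can occur: pure diagrams are nonnegative in columns 0 and p, so generation in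
   degree 0 and levelness pass to every diagram with nonzero coefficient. That their common last
   degree is c + p is read off from the degree of h. Since Tor is defined through a chosen
   resolution, levelness has to be carried from one resolution to another, but only as vanishing of
   Tor. Krull dimension and depth are bounded above by one count: a regular chain f_0, ..., f_q
   would give s^(q+1) independent products in a space of dimension of order s^q. The Koszul complex
   on x_l - X_l resolves because X_l strictly raises the degree of basis vectors, so that to lowest
   order only x_l is seen. The assumption p > 1 makes r strictly increasing from index -1 on, whence
   the strict signs of the minors. *)
From HB Require Import structures.
Require Import Defs.
From mathcomp Require Import all_boot all_order all_algebra.
From mathcomp Require Import ssrcomplements mpoly ring_quotient ring lra zify.

Set Implicit Arguments.
Unset Strict Implicit.
Unset Printing Implicit Defensive.

Import Order.TTheory GRing.Theory Num.Theory.
Local Open Scope ring_scope.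

(** * The Koszul complex of commuting operators *)

(* The complex on p + 1 operators is the mapping cone of the last operator on
   the complex on the first p. Hence krank N p i is N * 'C(p, i), in a form for
   which the block matrices below are well typed. *)
Fixpoint krank1 (N p i : nat) : nat :=
  if p is p'.+1
  then (krank1 N p' i + (if i is i'.+1 then krank1 N p' i' else N))%N else 0%N.

Definition krank (N p i : nat) : nat := if i is i'.+1 then krank1 N p i' else N.

Lemma krankSS N p i :
  krank N p.+1 i.+1 = (krank N p i.+1 + krank N p i)%N.
Proof. by []. Qed.

Lemma krank_gt (N p i : nat) : (p < i)%N -> krank N p i = 0%N.
Proof.
elim: p i => [|p IH] [|i] // lt_pi.
by rewrite krankSS (IH i.+1) ?(IH i) // ltnW.
Qed.

(** Each term of the complex is a sum of copies of the underlying space, indexed by an exterior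
    basis; this forgets the exterior part of an index. *)
Fixpoint kbase1 (N p i : nat) : 'I_(krank1 N p i) -> 'I_N :=
  match p return 'I_(krank1 N p i) -> 'I_N with
  | 0 => fun s => False_rect _ (notF (ltn_ord s))
  | p'.+1 => fun s => match split s with
      | inl s' => kbase1 s'
      | inr s' =>
        (match i return 'I_(if i is i'.+1 then krank1 N p' i' else N) -> 'I_N with
         | 0 => id | i'.+1 => @kbase1 N p' i' end) s'
      end
  end.

Definition kbase (N p i : nat) : 'I_(krank N p i) -> 'I_N :=
  match i with 0 => id | i'.+1 => @kbase1 N p i' end.

Lemma kbase_lshift N p i (s : 'I_(krank N p i.+1)) :
  @kbase N p.+1 i.+1 (lshift _ s) = kbase s.
Proof. by rewrite /= (unsplitK (inl s)). Qed.

Lemma kbase_rshift N p i (s : 'I_(krank N p i)) :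
  @kbase N p.+1 i.+1 (rshift _ s) = kbase s.
Proof. by rewrite /= (unsplitK (inr s)); case: i s. Qed.

Lemma ksplit N p i (P : 'I_(krank N p.+1 i.+1) -> Prop) :
  (forall s : 'I_(krank N p i.+1), P (lshift (krank N p i) s)) ->
  (forall s : 'I_(krank N p i), P (rshift (krank N p i.+1) s)) ->
  forall s, P s.
Proof.
move=> Pl Pr s; rewrite -[s](@splitK (krank N p i.+1) (krank N p i)).
by case: (split _) => s'; [apply: Pl | apply: Pr].
Qed.

Section Koszul.
Variables (A : comNzRingType) (N : nat).
Implicit Types (eta : 'M[A]_N) (theta : nat -> 'M[A]_N) (Q : pred 'I_N).

(** This is [eta] tensored with the identity of an exterior power: the chain map whose cone is taken
    in [kdiff]. *)
Fixpoint kscal1 eta (p i : nat) : 'M[A]_(krank1 N p i) :=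
  match p return 'M[A]_(krank1 N p i) with
  | 0 => 0
  | p'.+1 => block_mx (kscal1 eta p' i) 0 0
      (match i return 'M[A]_(if i is i'.+1 then krank1 N p' i' else N) with
       | 0 => eta | i'.+1 => kscal1 eta p' i' end)
  end.

Definition kscal eta (p i : nat) : 'M[A]_(krank N p i) :=
  match i with 0 => eta | i'.+1 => kscal1 eta p i' end.

Lemma kscalSS eta p i :
  kscal eta p.+1 i.+1 = block_mx (kscal eta p i.+1) 0 0 (kscal eta p i).
Proof. by case: i. Qed.

(** Above the lowest term, a pair of rows (v, w) goes to (v d + w theta, - w d); the sign makes the
    mixed terms cancel in [kdiff_kdiff]. *)
Fixpoint kdiff theta (p i : nat) : 'M[A]_(krank N p i.+1, krank N p i) :=
  match p return 'M[A]_(krank N p i.+1, krank N p i) with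
  | 0 => 0
  | p'.+1 =>
    match i return 'M[A]_(krank N p' i.+1 + krank N p' i, krank N p'.+1 i) with
    | 0 => col_mx (kdiff theta p' 0) (theta p')
    | i'.+1 => block_mx (kdiff theta p' i'.+1) 0
                        (kscal (theta p') p' i'.+1) (- kdiff theta p' i')
    end
  end.

Lemma kdiffS0 theta p : kdiff theta p.+1 0 = col_mx (kdiff theta p 0) (theta p).
Proof. by []. Qed.

Lemma kdiffSS theta p i :
  kdiff theta p.+1 i.+1 = block_mx (kdiff theta p i.+1) 0
                        (kscal (theta p) p i.+1) (- kdiff theta p i).
Proof. by []. Qed.

Lemma kscalM eta1 eta2 p i :
  kscal (eta1 *m eta2) p i = kscal eta1 p i *m kscal eta2 p i.
Proof.
elim: p i => [|p IH] [|i] //; first by apply/matrixP=> - [].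
by rewrite !kscalSS mulmx_block !(mulmx0, mul0mx, addr0, add0r) !IH.
Qed.

Lemma kscal_comm eta1 eta2 p i : eta1 *m eta2 = eta2 *m eta1 ->
  kscal eta1 p i *m kscal eta2 p i = kscal eta2 p i *m kscal eta1 p i.
Proof. by move=> comm; rewrite -!kscalM comm. Qed.

Lemma kscal_kdiff eta theta p i :
  (forall l, (l < p)%N -> eta *m theta l = theta l *m eta) ->
  kscal eta p i.+1 *m kdiff theta p i = kdiff theta p i *m kscal eta p i.
Proof.
elim: p i => [|p IH] i comm; first by rewrite mulmx0 mul0mx.
have commp l : (l < p)%N -> eta *m theta l = theta l *m eta.
  by move=> lt_lp; apply: comm; apply: ltnW.
rewrite kscalSS; case: i => [|i].
  rewrite kdiffS0 mul_block_col mul_col_mx !mul0mx addr0 add0r IH //.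
  by rewrite comm.
rewrite kdiffSS kscalSS !mulmx_block !(mulmx0, mul0mx, addr0, add0r).
rewrite mulmxN mulNmx !IH //.
by rewrite [X in block_mx _ _ X _](kscal_comm p i.+1 (comm p (ltnSn p))).
Qed.

Lemma kdiff_kdiff theta p i :
  (forall l l', (l < p)%N -> (l' < p)%N -> theta l *m theta l' = theta l' *m theta l) ->
  kdiff theta p i.+1 *m kdiff theta p i = 0.
Proof.
elim: p i => [|p IH] i comm; first by rewrite mulmx0.
have commp l l' : (l < p)%N -> (l' < p)%N -> theta l *m theta l' = theta l' *m theta l.
  by move=> lt_lp lt_lp'; apply: comm; apply: ltnW.
have commT l : (l < p)%N -> theta p *m theta l = theta l *m theta p.
  by move=> lt_lp; apply: comm => //; apply: ltnW.
rewrite kdiffSS; case: i => [|i].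
  rewrite kdiffS0 mul_block_col mul0mx addr0 IH // kscal_kdiff //.
  by rewrite mulNmx subrr col_mx0.
rewrite kdiffSS !mulmx_block !(mulmx0, mul0mx, addr0, add0r).
rewrite !(mulmxN, mulNmx, opprK) !IH // kscal_kdiff // subrr.
by rewrite -[RHS]block_mx0.
Qed.

(* The part of the complex of internal degree e is cut out by a predicate on
   the index of the underlying basis vector, since the shift by the exterior
   degree is the same for all basis vectors of one term. *)
Definition ksupp (Q : pred 'I_N) p i (v : 'rV[A]_(krank N p i)) : Prop :=
  forall s, v 0 s != 0 -> Q (kbase s).

Lemma ksupp0 Q p i : @ksupp Q p i 0.
Proof. by move=> s; rewrite mxE eqxx. Qed.

Lemma ksuppD Q p i (u v : 'rV[A]_(krank N p i)) :
  ksupp Q u -> ksupp Q v -> ksupp Q (u + v).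
Proof.
move=> Qu Qv s; rewrite mxE; have [->|nz_u _] := eqVneq (u 0 s) 0.
  by rewrite add0r => /Qv.
exact: Qu.
Qed.

Lemma ksuppN Q p i (v : 'rV[A]_(krank N p i)) : ksupp Q v -> ksupp Q (- v).
Proof. by move=> Qv s; rewrite mxE oppr_eq0; apply: Qv. Qed.

Lemma ksupp_row Q p i (u : 'rV[A]_(krank N p i.+1)) (v : 'rV[A]_(krank N p i)) :
  @ksupp Q p.+1 i.+1 (row_mx u v) <-> ksupp Q u /\ ksupp Q v.
Proof.
split=> [Quv|[Qu Qv]].
  split=> s nz.
    by rewrite -(kbase_lshift s); apply: Quv; rewrite row_mxEl.
  by rewrite -(kbase_rshift s); apply: Quv; rewrite row_mxEr.
elim/ksplit=> s; first by rewrite row_mxEl kbase_lshift; apply: Qu.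
by rewrite row_mxEr kbase_rshift; apply: Qv.
Qed.

Lemma krow_split p i (v : 'rV[A]_(krank N p.+1 i.+1)) :
  exists (u : 'rV[A]_(krank N p i.+1)) (w : 'rV[A]_(krank N p i)), v = row_mx u w.
Proof.
by exists (@lsubmx A 1 (krank N p i.+1) _ v), (@rsubmx A 1 (krank N p i.+1) _ v);
  rewrite hsubmxK.
Qed.

Definition raises (Q Q' : pred 'I_N) eta : Prop :=
  forall s t, eta s t != 0 -> Q s -> Q' t.

Lemma ksupp_mul Q Q' p i p' i' (B : 'M[A]_(krank N p i, krank N p' i'))
    (v : 'rV[A]_(krank N p i)) :
  (forall s t, B s t != 0 -> Q (kbase s) -> Q' (kbase t)) ->
  ksupp Q v -> ksupp Q' (v *m B).
Proof.
move=> QB Qv t; apply: contraNT => nQt; rewrite mxE big1 // => s _.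
have [-> |nzv] := eqVneq (v 0 s) 0; first by rewrite mul0r.
have [-> |nzB] := eqVneq (B s t) 0; first by rewrite mulr0.
by rewrite (QB _ _ nzB (Qv _ nzv)) in nQt.
Qed.

Lemma kscal_entry (P : 'I_N -> 'I_N -> A -> Prop) eta p i :
  (forall s t, P s t 0) -> (forall s t, P s t (eta s t)) ->
  forall s t, P (kbase s) (kbase t) (kscal eta p i s t).
Proof.
move=> P0 Peta; elim: p i => [|p IH] [|i] //; first by case.
rewrite kscalSS.
elim/ksplit=> s; elim/ksplit=> t; rewrite ?kbase_lshift ?kbase_rshift.
- by rewrite block_mxEul; apply: (IH i.+1).
- by rewrite block_mxEur mxE.
- by rewrite block_mxEdl mxE.
by rewrite block_mxEdr; apply: (IH i).
Qed.

(** Every entry of the differential is zero or, up to sign, an entry of some [theta l] between the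
    underlying basis vectors. Grading and label properties of the operators thus pass to the whole
    complex. *)
Lemma kdiff_entry (P : 'I_N -> 'I_N -> A -> Prop) theta p i :
  (forall s t, P s t 0) -> (forall s t a, P s t a -> P s t (- a)) ->
  (forall l s t, (l < p)%N -> P s t (theta l s t)) ->
  forall s t, P (kbase s) (kbase t) (kdiff theta p i s t).
Proof.
move=> P0 PN; elim: p i => [|p IH] i Ptheta; first by move=> s t; rewrite mxE.
have Pp l s t : (l < p)%N -> P s t (theta l s t).
  by move=> lt_lp; apply: Ptheta; apply: ltnW.
case: i => [|i].
  elim/ksplit=> s t; rewrite ?kbase_lshift ?kbase_rshift.
    by rewrite (col_mxEu (kdiff theta p 0)); apply: (IH 0 Pp).
  by rewrite (col_mxEd (kdiff theta p 0)); apply: Ptheta.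
rewrite kdiffSS.
elim/ksplit=> s; elim/ksplit=> t; rewrite ?kbase_lshift ?kbase_rshift.
- by rewrite block_mxEul; apply: (IH _ Pp).
- by rewrite block_mxEur mxE.
- rewrite block_mxEdl; apply: (@kscal_entry P _ p i.+1) => // s' t'.
  exact: Ptheta.
by rewrite block_mxEdr mxE; apply/PN/(IH _ Pp).
Qed.

Lemma kdiff_raises Q Q' theta p i :
  (forall l, (l < p)%N -> raises Q Q' (theta l)) ->
  forall s t, kdiff theta p i s t != 0 -> Q (kbase s) -> Q' (kbase t).
Proof.
move=> raise; apply: (@kdiff_entry (fun s t a => a != 0 -> Q s -> Q' t)).
- by move=> s t; rewrite eqxx.
- by move=> s t a; rewrite oppr_eq0.
by move=> l s t lt_lp; apply: raise.
Qed.

Lemma ksupp_kscal Q Q' eta p i (v : 'rV[A]_(krank N p i)) :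
  raises Q Q' eta -> ksupp Q v -> ksupp Q' (v *m kscal eta p i).
Proof.
move=> raise; apply: ksupp_mul; apply: (@kscal_entry (fun s t a => a != 0 -> Q s -> Q' t)) => //.
by move=> s t; rewrite eqxx.
Qed.

Lemma eq_kdiff theta1 theta2 p i : theta1 =1 theta2 ->
  kdiff theta1 p i = kdiff theta2 p i.
Proof.
move=> eq_th; elim: p i => // p IH [|i]; first by rewrite !kdiffS0 eq_th IH.
by rewrite !kdiffSS eq_th !IH.
Qed.

Lemma kdiff0_im_supp Q theta p (v : 'rV[A]_N) :
  (exists2 w : 'rV[A]_(krank N p 1), ksupp Q w & v = w *m kdiff theta p 0) <->
  exists2 u : nat -> 'rV[A]_N, forall l, @ksupp Q p 0 (u l) &
    v = \sum_(l < p) u l *m theta l.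
Proof.
elim: p v => [|p IH] v.
  split=> [[w _ ->]|[u _ ->]].
    exists (fun=> 0); last by rewrite big_ord0 mulmx0.
    by move=> l; apply: (@ksupp0 Q 0 0).
  by exists 0; [apply: ksupp0 | rewrite big_ord0 mul0mx].
split=> [[w + ->]|[u Qu ->]].
  have [w1 [w2 ->]] := krow_split w => /ksupp_row[Qw1 Qw2].
  have [u Qu def_u] := (IH (w1 *m kdiff theta p 0)).1 (ex_intro2 _ _ w1 Qw1 erefl).
  exists (fun l => if l == p then w2 else u l).
    by move=> l; case: ifP => _; [apply: Qw2 | apply: Qu].
  rewrite kdiffS0 mul_row_col def_u big_ord_recr /= eqxx; congr (_ + _).
  by apply: eq_bigr => l _; rewrite ltn_eqF.
rewrite big_ord_recr /=.
have [w Qw ->] := (IH (\sum_(l < p) u l *m theta l)).2 (ex_intro2 _ _ u Qu erefl).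
exists (row_mx w (u p)); last by rewrite mul_row_col.
by apply/ksupp_row; split; last exact: Qu.
Qed.

Lemma kdiff0_im theta p (v : 'rV[A]_N) :
  (exists w : 'rV[A]_(krank N p 1), v = w *m kdiff theta p 0) <->
  exists u : nat -> 'rV[A]_N, v = \sum_(l < p) u l *m theta l.
Proof.
have [im im'] := kdiff0_im_supp predT theta p v.
split=> [[w def_v]|[u def_v]].
  by have [u _ def_u] := im (ex_intro2 _ _ w (fun _ _ => isT) def_v); exists u.
by have [w _ def_w] := im' (ex_intro2 _ _ u (fun _ _ _ => isT) def_v); exists w.
Qed.

Section Exactness.
Variables (theta : nat -> 'M[A]_N) (Qm Q0 : pred 'I_N).

(** Regularity of [theta l] modulo the images of the earlier operators, confined to one degree: [Q0]
    selects the degree of the element, [Qm] that of its coefficients, one lower in the graded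
    case. *)
Definition kregular (l : nat) : Prop :=
  forall v : 'rV[A]_(krank N l 0), ksupp Q0 v ->
    (exists w, v *m theta l = w *m kdiff theta l 0) ->
    exists2 w, @ksupp Qm l 1 w & v = w *m kdiff theta l 0.

(** The dual notion: [theta l] maps the joint kernel of the earlier operators onto itself, again
    between two given degrees. *)
Definition kcoregular (l : nat) : Prop :=
  forall y : 'rV[A]_(krank N l 0), ksupp Q0 y ->
    (forall l', (l' < l)%N -> y *m theta l' = 0) ->
    exists y', [/\ @ksupp Qm l 0 y', forall l', (l' < l)%N -> y' *m theta l' = 0
      & y = y' *m theta l].

Definition kclosed p i : 'rV[A]_(krank N p i) -> Prop :=
  if i is i'.+1 then fun v => v *m kdiff theta p i' = 0 else fun _ => True.

(** Induction along the cone. The second component of a cycle bounds, say w = u d; then v + u theta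
    is a cycle of the smaller complex, say z d, and (z, -u) bounds (v, w). *)
Lemma kregular_exact p i (v : 'rV[A]_(krank N p i.+1)) :
  (forall l l', (l < p)%N -> (l' < p)%N -> theta l *m theta l' = theta l' *m theta l) ->
  (forall l, (l < p)%N -> raises Qm Q0 (theta l)) ->
  (forall l, (l < p)%N -> kregular l) ->
  ksupp Q0 v -> v *m kdiff theta p i = 0 ->
  exists2 u : 'rV[A]_(krank N p i.+2), ksupp Qm u & v = u *m kdiff theta p i.+1.
Proof.
elim: p i v => [|p IH] i v comm raise reg Qv.
  by exists 0; [apply: ksupp0 | apply/rowP=> - []].
have commp l l' : (l < p)%N -> (l' < p)%N ->
    theta l *m theta l' = theta l' *m theta l.
  by move=> lt_lp lt_lp'; apply: comm; apply: ltnW.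
have raisep l : (l < p)%N -> raises Qm Q0 (theta l).
  by move=> lt_lp; apply: raise; apply: ltnW.
have regp l : (l < p)%N -> kregular l by move=> lt_lp; apply: reg; apply: ltnW.
have commT l : (l < p)%N -> theta p *m theta l = theta l *m theta p.
  by move=> lt_lp; apply: comm => //; apply: ltnW.
have raiseT := raise p (ltnSn p).
move: Qv; have [{}v [w ->]] := krow_split v => /ksupp_row[Qv Qw] cl.
have [u Qu def_w] : exists2 u : 'rV_(krank N p i.+1), ksupp Qm u & w = u *m kdiff theta p i.
  (* In the lowest term there is no cycle condition on w alone; closedness says that w theta is a
     boundary of the smaller complex, which is the premise of regularity. *)
  case: i v w Qv Qw cl => [|i] v w Qv Qw cl.
    apply: (reg p) => //; exists (- v).
    by move/eqP: cl; rewrite kdiffS0 mul_row_col addrC addr_eq0 mulNmx => /eqP.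
  apply: (IH i w) => //; move/eqP: cl.
  rewrite kdiffSS mul_row_block mulmx0 add0r mulmxN -[0]row_mx0 => /eqP/eq_row_mx[_].
  by move/eqP; rewrite oppr_eq0 => /eqP.
have [z Qz def_z] : exists2 z : 'rV_(krank N p i.+2), ksupp Qm z &
    v + u *m kscal (theta p) p i.+1 = z *m kdiff theta p i.+1.
  apply: IH => //; first by apply: ksuppD => //; apply: ksupp_kscal Qu.
  rewrite mulmxDl -mulmxA kscal_kdiff // mulmxA -def_w.
  case: i v w Qv Qw cl u Qu def_w => [|i] v w Qv Qw cl u Qu def_w.
    by move: cl; rewrite kdiffS0 mul_row_col.
  move/eqP: cl; rewrite kdiffSS mul_row_block mulmx0 add0r -[0]row_mx0.
  by case/eqP/eq_row_mx.
exists (row_mx z (- u) : 'rV_(krank N p.+1 i.+2)).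
  by apply/ksupp_row; split=> //; apply: ksuppN.
rewrite kdiffSS (mul_row_block z (- u)) mulmx0 add0r.
by rewrite !(mulmxN, mulNmx) opprK -def_w -def_z addrK.
Qed.

(* krank N p p is equal to N, but not convertible to it. *)
Fixpoint ktop p (y : 'rV[A]_N) : 'rV[A]_(krank N p p) :=
  match p return 'rV[A]_(krank N p p) with
  | 0 => y
  | p'.+1 => row_mx (0 : 'rV[A]_(krank N p' p'.+1)) (ktop p' y)
  end.

Lemma ktop0 p : ktop p 0 = 0.
Proof. by elim: p => //= p ->; rewrite row_mx0. Qed.

Lemma ktop_inj p : injective (ktop p).
Proof. by elim: p => //= p IH x y /eq_row_mx[_ /IH]. Qed.

Lemma ktop_kscal eta p y : ktop p y *m kscal eta p p = ktop p (y *m eta).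
Proof.
elim: p => // p IH; rewrite kscalSS (mul_row_block 0 (ktop p y)).
by rewrite !(mulmx0, mul0mx) addr0 add0r IH.
Qed.

Lemma ksupp_ktop Q p y : ksupp Q (ktop p y) <-> @ksupp Q p 0 y.
Proof.
elim: p => // p IH; split.
  by move=> /ksupp_row[_ /IH].
by move=> /IH Qy; apply/ksupp_row; split=> //; apply: ksupp0.
Qed.

Lemma kclosed_ktop p y :
  kclosed (ktop p y) <-> forall l, (l < p)%N -> y *m theta l = 0.
Proof.
elim: p => [|p IH]; first by [].
have clE : kclosed (ktop p.+1 y) <-> ktop p (y *m theta p) = 0 /\ kclosed (ktop p y).
  rewrite -ktop_kscal; case: p {IH} => [|p].
    by rewrite /= mul_row_col mul0mx add0r; split=> [|[]].
  rewrite /kclosed kdiffSS (mul_row_block 0 (ktop p.+1 y)).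
  rewrite !(mul0mx, mulmx0) !add0r mulmxN -row_mx0.
  split=> [/eq_row_mx[-> /eqP]|[-> ->]]; last by rewrite oppr0.
  by rewrite oppr_eq0 => /eqP->.
split=> [/clE[y0 /IH yl] l|yl].
  rewrite ltnS leq_eqVlt => /orP[/eqP->|/yl //].
  by apply: (@ktop_inj p); rewrite y0 ktop0.
apply/clE; split; first by rewrite yl ?ktop0.
by apply/IH=> l lt_lp; rewrite yl // ltnS ltnW.
Qed.

Lemma ktop_surj p (x : 'rV[A]_(krank N p p)) : exists y, x = ktop p y.
Proof.
elim: p x => [|p IH] x; first by exists x.
have [u [w ->]] := krow_split x; have [y ->] := IH w; exists y.
congr (row_mx _ _); apply/rowP=> s; have := ltn_ord s.
by rewrite [X in (_ < X)%N](krank_gt N (ltnSn p)).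
Qed.

(** Dual to [kregular_exact]: regularity starts the induction at the lowest term, coregularity
    enters at the top one, where cycles are joint kernels. *)
Lemma kcoregular_exact p i (v : 'rV[A]_(krank N p i)) :
  (forall l l', (l < p)%N -> (l' < p)%N -> theta l *m theta l' = theta l' *m theta l) ->
  (forall l, (l < p)%N -> raises Qm Q0 (theta l)) ->
  (forall l, (l < p)%N -> kcoregular l) ->
  (i < p)%N -> ksupp Q0 v -> kclosed v ->
  exists2 u : 'rV[A]_(krank N p i.+1), ksupp Qm u & v = u *m kdiff theta p i.
Proof.
elim: p i v => [|p IH] i v comm raise coreg; first by [].
rewrite ltnS => le_ip Qv cl.
have commp l l' : (l < p)%N -> (l' < p)%N ->
    theta l *m theta l' = theta l' *m theta l.
  by move=> lt_lp lt_lp'; apply: comm; apply: ltnW.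
have raisep l : (l < p)%N -> raises Qm Q0 (theta l).
  by move=> lt_lp; apply: raise; apply: ltnW.
have coregp l : (l < p)%N -> kcoregular l by move=> lt_lp; apply: coreg; apply: ltnW.
have commT l : (l < p)%N -> theta p *m theta l = theta l *m theta p.
  by move=> lt_lp; apply: comm => //; apply: ltnW.
have raiseT := raise p (ltnSn p).
(* A cycle of the smaller complex is a boundary up to the image of cycles under [theta p]: below the
   top term by induction with y = 0, in the top term by coregularity. *)
have split_closed j (x : 'rV[A]_(krank N p j)) : (j <= p)%N -> ksupp Q0 x -> kclosed x ->
    exists (z : 'rV[A]_(krank N p j.+1)) (y : 'rV[A]_(krank N p j)),
    [/\ ksupp Qm z, ksupp Qm y, kclosed y & x = z *m kdiff theta p j + y *m kscal (theta p) p j].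
  rewrite leq_eqVlt => /orP[/eqP eq_jp|lt_jp] Qx clx.
    subst j; have [y0 def_x] := ktop_surj x.
    have Qy0 : @ksupp Q0 p 0 y0 by apply/ksupp_ktop; rewrite -def_x.
    have cly0 : forall l, (l < p)%N -> y0 *m theta l = 0.
      by apply/kclosed_ktop; rewrite -def_x.
    have [y [Qy cly def_y0]] := coreg p (ltnSn p) _ Qy0 cly0.
    exists 0, (ktop p y); split; first exact: ksupp0.
    - by apply/ksupp_ktop.
    - by apply/kclosed_ktop.
    by rewrite mul0mx add0r ktop_kscal -def_y0.
  have [z Qz def_x] := IH j x commp raisep coregp lt_jp Qx clx.
  exists z, 0; split=> //; [exact: ksupp0| |by rewrite mul0mx addr0].
  by case: (j) => //= j'; rewrite mul0mx.
case: i v le_ip Qv cl => [|i] v le_ip Qv cl.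
  have [z [y [Qz Qy _ ->]]] := split_closed 0%N v le_ip Qv cl.
  exists (row_mx z y : 'rV_(krank N p.+1 1)); first by apply/ksupp_row.
  by rewrite kdiffS0 mul_row_col.
move: Qv cl; have [{}v [w ->]] := krow_split v => /ksupp_row[Qv Qw].
rewrite /kclosed => cl.
have clw : kclosed w.
  case: (i) w v {Qw Qv} cl => // i' w v /eqP.
  rewrite kdiffSS mul_row_block mulmx0 add0r mulmxN -[0]row_mx0 => /eqP/eq_row_mx[_].
  by move/eqP; rewrite oppr_eq0 => /eqP.
have [u Qu def_w] := IH i w commp raisep coregp le_ip Qw clw.
have Qx : ksupp Q0 (v + u *m kscal (theta p) p i.+1).
  by apply: ksuppD => //; apply: ksupp_kscal Qu.
have clx : @kclosed p i.+1 (v + u *m kscal (theta p) p i.+1).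
  rewrite /kclosed mulmxDl -mulmxA kscal_kdiff // mulmxA -def_w.
  case: (i) v w {le_ip Qv Qw clw u Qu def_w Qx} cl => [|i'] v w cl.
    by move: cl; rewrite kdiffS0 mul_row_col.
  move/eqP: cl; rewrite kdiffSS mul_row_block mulmx0 add0r -[0]row_mx0.
  by case/eqP/eq_row_mx.
have [z [y [Qz Qy cly def_x]]] := split_closed i.+1 _ le_ip Qx clx.
exists (row_mx z (y - u) : 'rV_(krank N p.+1 i.+2)).
  by apply/ksupp_row; split=> //; apply: ksuppD => //; apply: ksuppN.
rewrite kdiffSS (mul_row_block z (y - u)) mulmx0 add0r mulmxN !mulmxBl -def_w.
by rewrite cly sub0r opprK addrA -def_x addrK.
Qed.

(** Cycles of the top term form the joint kernel of the operators, that is, the socle. *)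
Lemma kclosed_top_eq0 p (v : 'rV[A]_(krank N p p)) :
  (forall y : 'rV[A]_(krank N p 0), ksupp Q0 y ->
    (forall l, (l < p)%N -> y *m theta l = 0) -> y = 0) ->
  ksupp Q0 v -> kclosed v -> v = 0.
Proof.
move=> socle; have [y ->] := ktop_surj v => /ksupp_ktop Qy /kclosed_ktop cly.
by rewrite (socle y) // ktop0.
Qed.

End Exactness.

Lemma kscalB eta1 eta2 p i :
  kscal (eta1 - eta2) p i = kscal eta1 p i - kscal eta2 p i.
Proof.
elim: p i => [|p IH] [|i] //; first by apply/matrixP=> - [].
by rewrite !kscalSS opp_block_mx add_block_mx !IH !oppr0 !addr0.
Qed.

Lemma kdiffB theta1 theta2 p i :
  kdiff (fun l => theta1 l - theta2 l) p i = kdiff theta1 p i - kdiff theta2 p i.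
Proof.
elim: p i => [|p IH] i; first by rewrite /= subr0.
case: i => [|i]; first by rewrite !kdiffS0 opp_col_mx add_col_mx IH.
rewrite !kdiffSS opp_block_mx add_block_mx !IH kscalB oppr0 addr0.
by rewrite !opprD.
Qed.

Section Perturbation.
Variables (theta theta0 : nat -> 'M[A]_N) (wt : 'I_N -> nat) (W p : nat).
Hypothesis wt_lt : forall s, (wt s < W)%N.
Hypothesis theta0_wt : forall l s t, theta0 l s t != 0 -> wt t = wt s.
Hypothesis theta_wt : forall l s t, (theta l - theta0 l) s t != 0 -> (wt s < wt t)%N.

Definition kcomp i (w : nat) (v : 'rV[A]_(krank N p i)) : 'rV[A]_(krank N p i) :=
  \row_s (if wt (kbase s) == w then v 0 s else 0).

Lemma kdiff0_wt i s t : kdiff theta0 p i s t != 0 -> wt (kbase t) = wt (kbase s).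
Proof.
move=> nz; apply/eqP; apply: (@kdiff_raises (fun x => wt x == wt (kbase s))
  (fun x => wt x == wt (kbase s)) _ _ _ _ _ _ nz) => //.
by move=> l _ a b /theta0_wt ->.
Qed.

Lemma kdiffB_wt i s t : (kdiff theta p i - kdiff theta0 p i) s t != 0 ->
  (wt (kbase s) < wt (kbase t))%N.
Proof.
rewrite -kdiffB => nz; apply: (@kdiff_raises (fun x => (wt (kbase s) <= wt x)%N)
  (fun x => (wt (kbase s) < wt x)%N) _ _ _ _ _ _ nz) => //.
by move=> l _ a b /theta_wt lt_ab le_sa; apply: leq_ltn_trans lt_ab.
Qed.

Lemma kcomp_mul i w (u : 'rV[A]_(krank N p i.+1)) :
  kcomp w (u *m kdiff theta0 p i) = kcomp w u *m kdiff theta0 p i.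
Proof.
apply/rowP=> t; rewrite !mxE; case: ifP => wt_t.
  apply: eq_bigr => s _; rewrite mxE; case: ifP => // wt_s.
  have [->|nz] := eqVneq (kdiff theta0 p i s t) 0; first by rewrite !mulr0.
  by rewrite -(kdiff0_wt nz) wt_t in wt_s.
apply/esym/big1 => s _; rewrite mxE; case: ifP => wt_s; last by rewrite mul0r.
have [->|nz] := eqVneq (kdiff theta0 p i s t) 0; first by rewrite !mulr0.
by rewrite (kdiff0_wt nz) wt_s in wt_t.
Qed.

(* The part of lowest weight of a cycle of the perturbed complex is a cycle of
   the unperturbed one; correcting it raises the lowest weight. *)
Lemma kperturb i (Z : 'rV[A]_(krank N p i) -> Prop) :
  (forall u v, Z u -> Z v -> Z (u - v)) ->
  (forall u, Z (u *m kdiff theta p i)) ->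
  (forall w v, Z v -> ksupp (fun s => w <= wt s)%N v ->
     exists u, kcomp w v = u *m kdiff theta0 p i) ->
  forall v, Z v -> exists u, v = u *m kdiff theta p i.
Proof.
move=> ZB Zd Z0 v Zv.
have {Zv}: exists2 w, Z v & ksupp (fun s => w <= wt s)%N v by exists 0%N.
case=> w; have [k] := ubnP (W - w); elim: k w v => // k IH w v.
rewrite ltnS => le_k Zv Qv.
have [le_Ww|lt_wW] := leqP W w.
  exists 0; rewrite mul0mx; apply/rowP=> s; rewrite mxE.
  have [//|/Qv le_w] := eqVneq (v 0 s) 0.
  by have := leq_ltn_trans (leq_trans le_Ww le_w) (wt_lt _); rewrite ltnn.
have [u0 def_v] := Z0 w v Zv Qv.
pose u := kcomp w u0.
have def_vw : kcomp w v = u *m kdiff theta0 p i.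
  rewrite -kcomp_mul -def_v; apply/rowP=> s; rewrite !mxE.
  by case: ifP.
have [|||u' def_u'] := IH w.+1 (v - u *m kdiff theta p i).
- by rewrite subnS; case: (W - w)%N (subn_gt0 w W) le_k => [|//]; rewrite lt_wW.
- exact: ZB.
- move=> s; apply: contraNT; rewrite -leqNgt => le_sw.
  rewrite -(subrK (kdiff theta0 p i) (kdiff theta p i)) mulmxDr -def_vw.
  rewrite !mxE big1 ?add0r => [|t _]; last first.
    rewrite mxE; case: ifP => [/eqP wt_t|]; last by rewrite mul0r.
    have [->|nz] := eqVneq ((kdiff theta p i - kdiff theta0 p i) t s) 0.
      by rewrite mulr0.
    by have := kdiffB_wt nz; rewrite wt_t ltnNge le_sw.
  case: ifP => [_|/eqP/eqP ne_w]; first by rewrite subrr.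
  rewrite subr0; apply/eqP; apply: contraTeq le_sw => /Qv le_w.
  by rewrite -ltnNge ltn_neqAle le_w eq_sym ne_w.
by exists (u' + u); rewrite mulmxDl -def_u' subrK.
Qed.

Lemma kperturb_exact i (v : 'rV[A]_(krank N p i.+1)) :
  (forall l l', (l < p)%N -> (l' < p)%N -> theta l *m theta l' = theta l' *m theta l) ->
  (forall v : 'rV[A]_(krank N p i.+1), v *m kdiff theta0 p i = 0 ->
     exists u, v = u *m kdiff theta0 p i.+1) ->
  v *m kdiff theta p i = 0 -> exists u, v = u *m kdiff theta p i.+1.
Proof.
move=> comm exact0.
apply: (kperturb (Z := fun v => v *m kdiff theta p i = 0)) => [a b Za Zb|u|w {}v Zv Qv].
- by rewrite mulmxBl Za Zb subrr.
- by rewrite -mulmxA kdiff_kdiff // mulmx0.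
apply: exact0; apply/rowP=> t; rewrite -kcomp_mul !mxE; case: ifP => // /eqP wt_t.
have := congr1 (fun x : 'rV_(krank N p i) => x 0 t) Zv; rewrite !mxE => {2}<-.
apply: eq_bigr => s _.
rewrite -[kdiff theta p i](subrK (kdiff theta0 p i)) mxE mulrDr.
have [->|nz] := eqVneq ((kdiff theta p i - kdiff theta0 p i) s t) 0.
  by rewrite mulr0 add0r.
have [->|/Qv le_ws] := eqVneq (v 0 s) 0; first by rewrite !mul0r addr0.
by have := leq_ltn_trans le_ws (kdiffB_wt nz); rewrite wt_t ltnn.
Qed.

End Perturbation.

End Koszul.

Lemma map_kscal (A B : comNzRingType) (f : {rmorphism A -> B}) N (eta : 'M[A]_N) p i :
  map_mx f (kscal eta p i) = kscal (map_mx f eta) p i.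
Proof.
elim: p i => [|p IH] [|i] //; first by apply/matrixP=> - [].
by rewrite !kscalSS map_block_mx !map_mx0 (IH i.+1) IH.
Qed.

Lemma map_kdiff (A B : comNzRingType) (f : {rmorphism A -> B}) N
    (theta : nat -> 'M[A]_N) p i :
  map_mx f (kdiff theta p i) = kdiff (fun l => map_mx f (theta l)) p i.
Proof.
elim: p i => [|p IH] i; first by rewrite map_mx0.
case: i => [|i]; first by rewrite !kdiffS0 map_col_mx IH.
by rewrite !kdiffSS map_block_mx map_mx0 map_mxN (IH i.+1) IH (map_kscal f (theta p) p i.+1).
Qed.

(** * Dimension bounds by counting monomials *)

Section Independence.
Variables (k : fieldType) (n : nat) (V : lmodType {mpoly k[n]}).
Implicit Types (N : nat -> V -> Prop) (f : nat -> {mpoly k[n]}) (x : V).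

Definition submodule (N : V -> Prop) : Prop :=
  [/\ N 0, forall x y, N x -> N y -> N (x + y) & forall (r : {mpoly k[n]}) x, N x -> N (r *: x)].

Lemma submoduleB (N : V -> Prop) x y : submodule N -> N x -> N y -> N (x - y).
Proof. by case=> _ ND NZ Nx Ny; apply: ND; rewrite // -scaleN1r; apply: NZ. Qed.

Lemma submodule_sum (N : V -> Prop) (I : Type) (r : seq I) (P : pred I) (F : I -> V) :
  submodule N -> (forall i, P i -> N (F i)) -> N (\sum_(i <- r | P i) F i).
Proof. by case=> N0 ND _ NF; elim/big_rec: _ => // i y /NF; apply: ND. Qed.

(* N 0, ..., N e play the role of the submodules (f_0, ..., f_(a-1))V for a
   regular sequence, or of a chain of primes. *)
Definition regular_chain e N f : Prop :=
  [/\ forall a, (a <= e)%N -> submodule (N a),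
      forall a y, (a < e)%N -> N a y -> N a.+1 y,
      forall a y, (a < e)%N -> N a (f a *: y) -> N a y
    & forall a y, (a < e)%N -> N a.+1 (f a *: y)].

(** A polynomial in f_0, ..., f_(e-1) with exponents below s, applied to x; [msumE] gives the flat
    form. Nesting allows independence to be proved one f at a time. *)
Fixpoint msum e f (s : nat) (c : seq nat -> k) x : V :=
  if e is e'.+1
  then \sum_(i < s) f 0%N ^+ i *: msum e' (fun a => f a.+1) s (fun mu => c (val i :: mu)) x
  else (c [::])%:MP *: x.

Lemma msum_eq0 e f s c x :
  (forall mu, size mu = e -> all (fun i => i < s)%N mu -> c mu = 0) ->
  msum e f s c x = 0.
Proof.
elim: e f c => [|e IH] f c c0 /=; first by rewrite c0 // mpolyC0 scale0r.
rewrite big1 // => i _; rewrite IH ?scaler0 // => mu sz all_mu.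
by apply: c0; rewrite /= ?sz ?ltn_ord.
Qed.

(** Modulo [N1], which absorbs [f0], only the constant term is seen, and the hypothesis on [G] makes
    it zero; then [f0] can be cancelled modulo [N0]. *)
Lemma power_sum_indep (N0 N1 : V -> Prop) (f0 : {mpoly k[n]}) s (G : nat -> V) :
  submodule N0 -> submodule N1 -> (forall y, N0 y -> N1 y) ->
  (forall y, N0 (f0 *: y) -> N0 y) -> (forall y, N1 (f0 *: y)) ->
  (forall i, N1 (G i) -> G i = 0) ->
  N0 (\sum_(i < s) f0 ^+ i *: G i) -> forall i, (i < s)%N -> G i = 0.
Proof.
move=> sub0 sub1 N01 reg N1f; elim: s G => // s IH G G0.
rewrite big_ord_recl expr0 scale1r => NG.
have eq_tail : \sum_(i < s) f0 ^+ bump 0 i *: G (bump 0 i)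
    = f0 *: \sum_(i < s) f0 ^+ i *: G i.+1.
  by rewrite scaler_sumr; apply: eq_bigr => i _; rewrite scalerA -exprS.
rewrite eq_tail in NG.
have G00 : G 0%N = 0.
  apply: G0; rewrite -(addrK (f0 *: \sum_(i < s) f0 ^+ i *: G i.+1) (G 0%N)).
  by apply: submoduleB => //; apply: N01.
rewrite G00 add0r in NG; case=> // i; rewrite ltnS => lt_is.
by apply: (IH (fun i => G i.+1)) => [j| |//]; [apply: G0 | apply: reg].
Qed.

(** Monomials in a regular chain, applied to an element outside [N e], are linearly independent over
    k modulo [N 0]. The first f is removed by [power_sum_indep], the others by induction on the
    chain shifted by one. *)
Lemma msum_indep e N f s c x : regular_chain e N f -> ~ N e x ->
  N 0%N (msum e f s c x) ->
  forall mu, size mu = e -> all (fun i => i < s)%N mu -> c mu = 0.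
Proof.
elim: e N f c => [|e IH] N f c [sub inc reg absorb] Nx /=.
  move=> Nc mu /size0nil -> _; apply/eqP/negPn/negP => nz_c; apply: Nx.
  have [_ _ NZ] := sub 0%N (leqnn _).
  by have := NZ ((c [::])^-1)%:MP _ Nc; rewrite scalerA -mpolyCM mulVf // scale1r.
have chain1 : regular_chain e (fun a => N a.+1) (fun a => f a.+1).
  by split=> [a|a y|a y|a y] lt_a; [apply: sub|apply: inc|apply: reg|apply: absorb].
pose G i := msum e (fun a => f a.+1) s (fun mu => c (i :: mu)) x.
move=> NG; case=> [|i mu] // [sz] /= /andP[lt_is all_mu].
have IHi j : N 1%N (G j) -> forall mu, size mu = e ->
    all (fun i => i < s)%N mu -> c (j :: mu) = 0.
  exact: (IH _ _ (fun mu => c (j :: mu)) chain1).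
apply: (IHi i) => //.
suff -> : G i = 0 by case: (sub 1%N (ltn0Sn e)).
apply: (@power_sum_indep (N 0%N) (N 1%N) (f 0%N) s G) => //.
- exact: sub.
- exact: sub.
- by move=> y; apply: inc.
- by move=> y; apply: reg.
- by move=> y; apply: absorb.
by move=> j NGj; apply: msum_eq0; apply: IHi.
Qed.

Lemma msumE e f s c x : msum e f s c x =
  \sum_(t : e.-tuple 'I_s)
     (c (map val t))%:MP *: ((\prod_(a < e) f a ^+ tnth t a) *: x).
Proof.
elim: e f c => [|e IH] f c /=.
  rewrite (bigD1 [tuple]) //= big_ord0 scale1r big1 ?addr0 // => t.
  by case/eqP; apply: val_inj; case: t => - [].
rewrite (reindex (fun u : 'I_s * e.-tuple 'I_s => cons_tuple u.1 u.2)) /=; last first.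
  exists (fun t => (thead t, behead_tuple t)) => [[i t] _|t _] /=.
    by rewrite theadE; congr (_, _); apply: val_inj.
  by rewrite [in RHS](tuple_eta t).
rewrite -(pair_bigA _ (fun i (t : e.-tuple 'I_s) => (c (val i :: map val t))%:MP *:
   (\prod_(a < e.+1) f a ^+ tnth (cons_tuple i t) a *: x))) /=.
apply: eq_bigr => i _; rewrite IH scaler_sumr; apply: eq_bigr => t _.
rewrite big_ord_recl !scalerA; congr (_ *: _).
rewrite mulrCA -mulrA; congr (_ ^+ _ * (_ * _)).
by apply: eq_bigr => a _; rewrite [in RHS](tnth_nth i) (tnth_nth i).
Qed.

End Independence.

Lemma row_free_dep (k : fieldType) (I J : finType) (B : I -> J -> k) :
  (#|J| < #|I|)%N ->
  exists2 c : I -> k, exists i, c i != 0 & forall j, \sum_i c i * B i j = 0.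
Proof.
move=> lt_JI; pose A := \matrix_(i < #|I|, j < #|J|) B (enum_val i) (enum_val j).
have nz_ker : kermx A != 0.
  by rewrite kermx_eq0 /row_free neq_ltn (leq_ltn_trans (rank_leq_col A)).
have [i0 nz_row] : exists i, row i (kermx A) != 0.
  apply/existsP; apply: contraNT nz_ker; rewrite negb_exists => /forallP rowz.
  by apply/eqP/row_matrixP => i; rewrite row0; apply/eqP; have := rowz i; rewrite negbK.
exists (fun i => kermx A i0 (enum_rank i)).
  have [/existsP[j nz_j]|] := boolP [exists j, kermx A i0 j != 0].
    by exists (enum_val j); rewrite enum_valK.
  rewrite negb_exists => /forallP rowz; case/negP: nz_row; apply/eqP/rowP=> j.
  by rewrite [LHS]mxE [RHS]mxE; apply/eqP/negPn; apply: rowz.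
move=> j; have := congr1 (fun M : 'M_(_, _) => M i0 (enum_rank j)) (mulmx_ker A).
rewrite !mxE => {2}<-; rewrite (reindex _ (onW_bij _ (@enum_val_bij I))) /=.
by apply: eq_bigr => i _; rewrite !mxE !enum_rankK enum_valK.
Qed.

Section Degree.
Variables (k : fieldType) (n : nat).
Implicit Types f g : {mpoly k[n]}.

Definition deg_le (D : nat) f : Prop := forall m, m \in msupp f -> (mdeg m <= D)%N.

Lemma deg_leM D E f g : deg_le D f -> deg_le E g -> deg_le (D + E) (f * g).
Proof.
move=> fD gE m /msuppM_le /allpairsP[[m1 m2] /= [/fD le1 /gE le2 ->]].
by rewrite mdegD leq_add.
Qed.

Lemma deg_le1 : deg_le 0 1.
Proof. by move=> m; rewrite msupp1 inE => /eqP->; rewrite mdeg0. Qed.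

Lemma deg_leW D E f : (D <= E)%N -> deg_le D f -> deg_le E f.
Proof. by move=> le_DE fD m /fD le_m; apply: leq_trans le_DE. Qed.

Lemma deg_leX D i f : deg_le D f -> deg_le (i * D) (f ^+ i).
Proof.
move=> fD; elim: i => [|i IH]; first exact: deg_le1.
by rewrite exprS mulSn; apply: deg_leM.
Qed.

Lemma deg_le_prod D (I : Type) (r : seq I) (F : I -> {mpoly k[n]}) :
  (forall i, deg_le D (F i)) -> deg_le (size r * D) (\prod_(i <- r) F i).
Proof.
move=> FD; elim: r => [|i r IH]; first by rewrite big_nil; apply: deg_le1.
by rewrite big_cons mulSn; apply: deg_leM.
Qed.

Lemma deg_le_msize f : deg_le (msize f) f.
Proof. by move=> m /msize_mdeg_lt /ltnW. Qed.

Lemma deg_le_bound (I : finType) (F : I -> {mpoly k[n]}) :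
  exists D, forall i, deg_le D (F i).
Proof.
exists (\max_i msize (F i))%N => i; apply: deg_leW _ (@deg_le_msize _).
exact: leq_bigmax.
Qed.
End Degree.

Section Growth.
Variables (k : fieldType) (p q : nat) (V : lmodType {mpoly k[p + q]}).
Variables (m : nat) (g : 'I_m -> V) (K : nat).

Definition box_mnm (T : nat) (b : {ffun 'I_p -> 'I_K} * {ffun 'I_q -> 'I_T}) :
    'X_{1..p + q} :=
  [multinom (match split i with inl l => b.1 l : nat | inr y => b.2 y : nat end)
    | i < p + q].

Lemma box_mnm_inj T : injective (@box_mnm T).
Proof.
move=> [b1 b2] [b1' b2'] /mnmP eq_b; congr (_, _); apply/ffunP=> i; apply: val_inj.
  by have := eq_b (lshift q i); rewrite !mnmE (unsplitK (inl i)).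
by have := eq_b (rshift p i); rewrite !mnmE (unsplitK (inr i)).
Qed.

Lemma box_mnmP T (a : 'X_{1..p + q}) :
  (forall l, a (lshift q l) < K)%N -> (mdeg a < T)%N -> exists b, a = @box_mnm T b.
Proof.
move=> lt_K lt_T.
have lt_aT i : (a i < T)%N.
  by apply: leq_ltn_trans lt_T; rewrite mdegE (bigD1 i) //= leq_addr.
exists ([ffun l => Ordinal (lt_K l)], [ffun y => Ordinal (lt_aT (rshift p y))]).
apply/mnmP=> i; rewrite mnmE; case: splitP => j def_i; rewrite ffunE /=;
  by congr (a _); apply: val_inj.
Qed.

(* Modulo N the coefficients outside a box vanish, and the box has dimension
   q, up to a bounded factor. *)
Lemma growth_span (N : V -> Prop) T (F : {mpoly k[p + q]}) j :
  submodule N -> (forall l y, N ('X_(lshift q l) ^+ K *: y)) ->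
  (forall a, a \in msupp F -> mdeg a < T)%N ->
  N (F *: g j - \sum_b (F@_(@box_mnm T b))%:MP *: ('X_[box_mnm b] *: g j)).
Proof.
move=> subN NK FT.
have -> : F *: g j = \sum_(a <- msupp F) (F@_a)%:MP *: ('X_[a] *: g j).
  rewrite {1}[F]mpolyE scaler_suml; apply: eq_bigr => a _.
  by rewrite scalerA mul_mpolyC.
rewrite (bigID (fun a : 'X_{1..p + q} => [exists b, a == @box_mnm T b])) /=.
set S1 := \sum_(a <- _ | _) _; set S2 := \sum_(a <- _ | _) _; set S3 := \sum_b _.
have -> : S1 = S3.
  rewrite /S3 (bigID (fun b => box_mnm b \in msupp F)) /= [X in _ + X]big1 ?addr0.
    rewrite -(big_map (@box_mnm T) (fun a => a \in msupp F)
       (fun a => (F@_a)%:MP *: ('X_[a] *: g j))).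
    rewrite -[LHS]big_filter -[RHS]big_filter; apply/esym/perm_big/uniq_perm.
    - rewrite filter_uniq // map_inj_uniq ?index_enum_uniq //; exact: box_mnm_inj.
    - by rewrite filter_uniq ?msupp_uniq.
    move=> a; rewrite !mem_filter andbC; case: (a \in msupp F); rewrite ?andbF ?andbT //.
    apply/mapP/existsP => [[b _ ->]|[b /eqP->]]; first by exists b.
    by exists b; rewrite ?mem_index_enum.
  by move=> b /memN_msupp_eq0 ->; rewrite mpolyC0 scale0r.
rewrite addrAC subrr add0r /S2 big_seq_cond.
have [_ _ NZ] := subN.
apply: submodule_sum => // a /andP[/FT lt_T /existsPn nbox]; apply: (NZ (F@_a)%:MP).
have [/forallP lt_K|/forallPn[l]] := boolP [forall l, a (lshift q l) < K]%N.
  by have [b def_a] := box_mnmP lt_K lt_T; have := nbox b; rewrite def_a eqxx.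
rewrite -leqNgt => le_K.
have -> : 'X_[a] = 'X_[a - U_(lshift q l) *+ K] * 'X_(lshift q l) ^+ K :> {mpoly k[p + q]}.
  rewrite mpolyXn -mpolyXD submK //; apply/mnm_lepP=> i.
  by rewrite mulmnE mnm1E; case: eqP => [<-|//]; rewrite mul1n.
by rewrite -scalerA; apply: NZ.
Qed.

Hypothesis g_gen : forall x : V, exists f : 'I_m -> {mpoly k[p + q]},
  x = \sum_a f a *: g a.

(** With q + 1 elements, the s^(q+1) monomials of [msum_indep] would be independent modulo [N 0],
    although by [growth_span] they lie in the span of at most m K^p T^q vectors with T linear in
    s. *)
Lemma regular_chain_leq (N : nat -> V -> Prop) (f : nat -> {mpoly k[p + q]}) e x :
  (forall l y, N 0%N ('X_(lshift q l) ^+ K *: y)) ->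
  regular_chain e N f -> ~ N e x -> (e <= q)%N.
Proof.
move=> NK chain Nx; rewrite leqNgt; apply/negP => lt_qe.
have [sub inc reg absorb] := chain.
have {}chain : regular_chain q.+1 N f.
  by split=> [a|a y|a y|a y] le_a; [apply: sub|apply: inc|apply: reg|apply: absorb];
     apply: leq_trans lt_qe.
have {}Nx : ~ N q.+1 x.
  move=> Nq; apply: Nx; rewrite -(subnKC lt_qe).
  have : (q.+1 + (e - q.+1) <= e)%N by rewrite subnKC.
  elim: (e - q.+1)%N => [|i IH]; rewrite ?addn0 // addnS => lt_e.
  by apply: inc => //; apply: IH; apply: ltnW.
have sub0 := sub 0%N (leq0n e).
have [h def_x] := g_gen x.
have [D1 fD] := deg_le_bound (fun a : 'I_q.+1 => f a).
have [D2 hD] := deg_le_bound h.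
(* Each product of f's with exponents below s, times an h, has degree below T = s E, and m K^p T^q =
   (m K^p E^q) s^q is smaller than s^(q+1) for this s. *)
pose E := (q.+1 * D1 + D2 + 1)%N; pose s := (m * (K ^ p * E ^ q) + 1)%N.
pose T := (s * E)%N.
pose F (t : q.+1.-tuple 'I_s) j := (\prod_(a < q.+1) f a ^+ tnth t a) * h j.
have FT t j a : a \in msupp (F t j) -> (mdeg a < T)%N.
  suff : deg_le (q.+1 * (s * D1) + D2) (F t j).
    move=> FD /FD le_a; apply: leq_ltn_trans le_a _.
    by rewrite /T /E /s; nia.
  apply: deg_leM (hD j); rewrite -[X in (X * _)%N](card_ord q.+1) cardT enumT.
  apply: deg_le_prod => i; apply: deg_leW _ (@deg_leX _ _ D1 _ _ (fD i)).
  by rewrite leq_mul2r ltnW ?orbT.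
have lt_card : (#|{: 'I_m * ({ffun 'I_p -> 'I_K} * {ffun 'I_q -> 'I_T})}|
    < #|{: q.+1.-tuple 'I_s}|)%N.
  rewrite card_tuple card_ord !card_prod !card_ffun !card_ord expnS expnMn.
  by rewrite (mulnCA (K ^ p)%N) mulnCA mulnC ltn_pmul2r ?expn_gt0 /s ?addn1 ?ltnSn.
have [c [t0 nz_c] c_dep] :=
  row_free_dep (fun t jb => (F t jb.1)@_(box_mnm jb.2)) lt_card.
pose c' (mu : seq nat) : k :=
  \sum_(t : q.+1.-tuple 'I_s | map val t == mu) c t.
have c'E (t : q.+1.-tuple 'I_s) : c' (map val t) = c t.
  rewrite /c' (big_pred1 t) // => u; apply/eqP/eqP=> [eq_ut|-> //].
  by apply/val_inj/(inj_map val_inj).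
have Nc : N 0%N (msum q.+1 f s c' x).
  rewrite msumE.
  have -> : \sum_(t : q.+1.-tuple 'I_s) (c' (map val t))%:MP *:
      ((\prod_(a < q.+1) f a ^+ tnth t a) *: x)
    = \sum_(t : q.+1.-tuple 'I_s) \sum_j (c t)%:MP *:
       (F t j *: g j - \sum_b ((F t j)@_(@box_mnm T b))%:MP *: ('X_[box_mnm b] *: g j)).
    apply/eqP; rewrite -subr_eq0 -sumrB; apply/eqP.
    transitivity (\sum_(t : q.+1.-tuple 'I_s) \sum_j \sum_b
       (c t * (F t j)@_(@box_mnm T b))%:MP *: ('X_[box_mnm b] *: g j)).
      apply: eq_bigr => t _; rewrite c'E def_x !scaler_sumr -sumrB.
      apply: eq_bigr => j _; rewrite scalerBr [_ *: (h j *: _)]scalerA subKr scaler_sumr.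
      by apply: eq_bigr => b _; rewrite [LHS]scalerA mpolyCM.
    rewrite exchange_big big1 //= => j _; rewrite exchange_big big1 //= => b _.
    by rewrite -scaler_suml -rmorph_sum (c_dep (j, b)) raddf0 scale0r.
  apply: submodule_sum => // t _; apply: submodule_sum => // j _.
  have [_ _ NZ] := sub0; apply: NZ; apply: growth_span => //; exact: FT.
have := msum_indep chain Nx Nc (mu := map val t0).
rewrite c'E size_map size_tuple => /(_ (erefl _)) c0.
case/eqP: nz_c; apply: c0.
by apply/allP=> i /mapP[j _ ->]; apply: ltn_ord.
Qed.

End Growth.

Section KillVars.
Variables (k : fieldType) (n : nat).

(** Reduction modulo the first [b] variables, kept as an endomorphism so that the kernels for
    growing [b] form a chain of primes in one ring. *)
Definition kill_vars (b : nat) : {mpoly k[n]} -> {mpoly k[n]} :=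
  mmap (@mpolyC n k) (fun i => if (i < b)%N then 0 else 'X_i).

HB.instance Definition _ b := GRing.RMorphism.on (kill_vars b).

Lemma kill_varsC b c : kill_vars b c%:MP = c%:MP.
Proof. exact: mmapC. Qed.

Lemma kill_varsX b i : kill_vars b 'X_i = if (i < b)%N then 0 else 'X_i.
Proof. by rewrite /kill_vars mmapX mmap1U. Qed.

Lemma kill_vars_comp b b' f : (b <= b')%N ->
  kill_vars b' (kill_vars b f) = kill_vars b' f.
Proof.
move=> le_b; elim/mpolyind: f => [|c m f _ _ IH]; first by rewrite !rmorph0.
rewrite !rmorphD /= IH; congr (_ + _).
rewrite -mul_mpolyC !rmorphM; congr (_ * _); first by rewrite /= !kill_varsC.
rewrite mpolyXE_id !rmorph_prod; apply: eq_bigr => i _.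
rewrite !rmorphXn; congr (_ ^+ _); rewrite /= kill_varsX; case: ifP => // lt_ib.
by rewrite rmorph0 kill_varsX (leq_trans lt_ib le_b).
Qed.

(** Indexed by all natural numbers, with value 0 past the last variable, to fit the families of
    operators of the Koszul complex. *)
Definition xvar (l : nat) : {mpoly k[n]} :=
  if insub l is Some i then 'X_(i : 'I_n) else 0.

Lemma xvarE (i : 'I_n) : xvar i = 'X_i.
Proof. by rewrite /xvar valK. Qed.

Lemma kill_vars_xvar b l : kill_vars b (xvar l) = if (l < b)%N then 0 else xvar l.
Proof.
rewrite /xvar; case: insubP => [i _ <-|_]; first exact: kill_varsX.
by rewrite rmorph0 if_same.
Qed.

Lemma mcoeff_kill_vars b f m :
  (kill_vars b f)@_m = if [forall i : 'I_n, (i < b)%N ==> (m i == 0%N)] then f@_m else 0.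
Proof.
elim/mpolyind: f => [|c m' f _ _ IH]; first by rewrite rmorph0 mcoeff0 if_same.
rewrite rmorphD !mcoeffD IH.
suff -> : (kill_vars b (c *: 'X_[m']))@_m =
    if [forall i : 'I_n, (i < b)%N ==> (m i == 0%N)] then (c *: 'X_[m'])@_m else 0.
  by case: ifP; rewrite ?addr0.
rewrite -mul_mpolyC rmorphM /= kill_varsC !mcoeffCM.
have -> : kill_vars b 'X_[m'] =
    if [forall i : 'I_n, (i < b)%N ==> (m' i == 0%N)] then 'X_[m'] else 0.
  rewrite /kill_vars mmapX /mmap1; case: ifPn => [/forallP m'0|/forallPn[i]].
    rewrite mpolyXE_id; apply: eq_bigr => i _; have := m'0 i.
    by case: ifP => //= _ /eqP->; rewrite !expr0.
  by rewrite negb_imply => /andP[lt_ib nz_i]; rewrite (bigD1 i) //= lt_ib expr0n (negPf nz_i) mul0r.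
have [->|ne_m] := eqVneq m' m; first by case: ifP; rewrite ?mcoeff0 ?mulr0.
by case: ifP; case: ifP; rewrite ?mcoeff0 ?mcoeffX ?(negPf ne_m) ?mulr0.
Qed.

Lemma kill_vars_eq0 b f : kill_vars b f = 0 <->
  exists g : nat -> {mpoly k[n]}, f = \sum_(l < b) xvar l * g l.
Proof.
split=> [f0|[g ->]]; last first.
  rewrite rmorph_sum big1 // => l _.
  by rewrite rmorphM /= kill_vars_xvar ltn_ord mul0r.
rewrite [f]mpolyE big_seq; elim/big_rec: _ => [|m h].
  by exists (fun=> 0); rewrite big1 // => l _; rewrite mulr0.
rewrite mcoeff_msupp => nz_m [g ->].
have [i lt_ib nz_i] : exists2 i : 'I_n, (i < b)%N & m i != 0%N.
  have : (kill_vars b f)@_m = 0 by rewrite f0 mcoeff0.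
  rewrite mcoeff_kill_vars; case: ifPn => [_ m0|/forallPn[i]].
    by rewrite m0 eqxx in nz_m.
  by rewrite negb_imply => /andP[]; exists i.
exists (fun l => g l + (if l == i then f@_m *: 'X_[m - U_(i)] else 0)).
rewrite addrC; under [RHS]eq_bigr do rewrite mulrDr.
rewrite big_split /=; congr (_ + _); rewrite (bigD1 (Ordinal lt_ib)) //= eqxx.
rewrite big1 ?addr0 => [|l ne_l]; last first.
  by rewrite (_ : (val l == val i) = false) ?mulr0 //; apply: negbTE.
by rewrite xvarE -scalerAr -mpolyXD addmC submK // lep1mP.
Qed.
End KillVars.

Section KrullDimension.
Variables (k : fieldType) (p q : nat).
Local Notation R := {mpoly k[p + q]}.

(** A chain of primes is a regular chain for the ring over itself: an element of P (a+1) outside P a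
    is a nonzerodivisor modulo P a. Primality puts the first p variables themselves into P 0, so the
    box exponent is 1. *)
Lemma prime_chain_leq (I : R -> Prop) e (P : nat -> {pred R}) :
  (forall l, exists K, I ('X_(lshift q l) ^+ K)) -> prime_chain I e P -> (e <= q)%N.
Proof.
move=> Inil [ideal inc].
have Pnil l : 'X_(lshift q l) \in P 0%N.
  have [K /(let: And3 _ _ IP := ideal 0%N (leq0n e) in IP)] := Inil l.
  have [[_ nP1 _] prim _] := ideal 0%N (leq0n e).
  elim: K => [|K IH]; first by rewrite expr0 (negPf nP1).
  by rewrite exprS => /prim /orP[|/IH].
have [f fP] : exists f : 'I_e -> R, forall a, (f a \in P a.+1) && (f a \notin P a).
  apply: (@fin_all_exists _ _ (fun (a : 'I_e) f => (f \in P a.+1) && (f \notin P a))) => a.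
  by have [_ [f fP nfP]] := inc a (ltn_ord a); exists f; rewrite fP.
pose f' a : R := if insub a is Some i then f i else 0.
have f'P a : (a < e)%N -> f' a \in P a.+1 /\ f' a \notin P a.
  by move=> lt_a; rewrite /f' insubT; apply/andP/(fP (Ordinal lt_a)).
have sub a : (a <= e)%N -> submodule (V := R^o) (fun y => y \in P a).
  case/ideal=> [[P0 _ PD] _ _]; split=> // [x y Px Py|r x Px].
    by have := PD 1 _ _ Px Py; rewrite mul1r.
  by rewrite -[r *: x]addr0; apply: PD.
apply: (@regular_chain_leq k p q R^o 1 (fun _ => 1) 1 _ (fun a y => y \in P a) f' e 1).
- move=> x; exists (fun _ => x).
  by rewrite big_ord1 /GRing.scale /= mulr1.
- by move=> l y; rewrite expr1 /GRing.scale /= mulrC; case: (sub 0%N) => // _ _; apply.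
- split=> // [a y lt_a|a y lt_a|a y lt_a].
  + by have [Pinc _] := inc a lt_a; apply: Pinc.
  + have [_ prim _] := ideal a (ltnW lt_a); have [_ nf] := f'P a lt_a.
    by move/prim; rewrite (negPf nf).
  have [fa _] := f'P a lt_a.
  by rewrite /GRing.scale /= mulrC; case: (sub a.+1 lt_a) => _ _; apply.
by have [[_ nP1 _] _ _] := ideal e (leqnn e); apply/negP.
Qed.

(** The lower bound comes from the ideals generated by the first p + a variables, for a = 0, ..., q,
    as kernels of [kill_vars]. *)
Lemma krull_dimP (I : R -> Prop) :
  (forall f, I f -> kill_vars p f = 0) ->
  (forall l, exists K, I ('X_(lshift q l) ^+ K)) -> krull_dim I q.
Proof.
move=> Ikill Inil; split; last by move=> e P; apply: prime_chain_leq.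
exists (fun a f => kill_vars (p + a) f == 0); split=> a le_a.
  split; first split.
  - by rewrite unfold_in rmorph0.
  - by rewrite unfold_in rmorph1 oner_eq0.
  - move=> r x y; rewrite !unfold_in rmorphD rmorphM /= => /eqP-> /eqP->.
    by rewrite mulr0 addr0.
  - by move=> x y; rewrite !unfold_in rmorphM mulf_eq0.
  by move=> f /Ikill f0; rewrite unfold_in -(@kill_vars_comp _ _ p) ?leq_addr // f0 rmorph0.
split=> [f|].
  rewrite !unfold_in => /eqP f0.
  by rewrite -(@kill_vars_comp _ _ (p + a)) ?addnS // f0 rmorph0.
exists 'X_(rshift p (Ordinal le_a)); rewrite !unfold_in kill_varsX /=.
  by rewrite addnS ltnSn.
by rewrite ltnn -msupp_eq0 msuppX.
Qed.

(** The same count as for primes, applied to the submodules generated by initial segments of the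
    sequence. *)
Lemma regular_seq_leq (M : gradedModule k (p + q)) K s :
  (forall l (x : M), 'X_(lshift q l) ^+ K *: x = 0) -> regular_seq M s ->
  (size s <= q)%N.
Proof.
move=> nil [_ reg [x Nx]]; have [m [g g_gen]] := gm_fingen M.
have sub a : submodule (in_span (M := M) (take a s)).
  split.
  - by exists (fun _ => 0); rewrite big1 // => i _; rewrite scaler0.
  - move=> _ _ [y ->] [z ->]; exists (fun i => y i + z i).
    by rewrite -big_split; apply: eq_bigr => i _; rewrite scalerDr.
  move=> r _ [y ->]; exists (fun i => r *: y i).
  by rewrite scaler_sumr; apply: eq_bigr => i _; rewrite !scalerA mulrC.
have span_nth a i y : (i < a)%N -> (i < size s)%N -> in_span (M := M) (take a s) (s`_i *: y).
  move=> lt_ia lt_is.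
  have lt_i : (i < size (take a s))%N by rewrite size_take_min leq_min lt_ia.
  exists (fun j => if j == Ordinal lt_i then y else 0).
  rewrite (bigD1 (Ordinal lt_i)) //= eqxx nth_take // big1 ?addr0 // => j /negPf->.
  by rewrite scaler0.
apply: (@regular_chain_leq k p q M m g K g_gen
  (fun a => in_span (M := M) (take a s)) (fun a => s`_a) _ x).
- by move=> l y; rewrite nil; case: (sub 0%N).
- split=> // [a y lt_a [z ->]|a y lt_a].
  + apply: submodule_sum => // i _.
    have lt_ia : (i < a)%N by apply: leq_trans (ltn_ord i) _; rewrite size_take_min geq_minl.
    by rewrite nth_take //; apply: span_nth; apply: ltn_trans lt_ia _.
  exact: span_nth.
by rewrite take_size.
Qed.

End KrullDimension.

(** * Homogeneous components *)

Section HomogeneousParts.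
Variables (k : fieldType) (n : nat).
Implicit Types (f g : {mpoly k[n]}) (e : int) (m : 'X_{1..n}).

Definition hpart e f : {mpoly k[n]} :=
  if e is Posz d then pihomog mdeg d f else 0.

Lemma hpart_is_zmod e : zmod_morphism (hpart e).
Proof. by case: e => d f g /=; rewrite ?raddfB ?subr0. Qed.

HB.instance Definition _ e :=
  GRing.isZmodMorphism.Build {mpoly k[n]} {mpoly k[n]} (hpart e) (hpart_is_zmod e).

Lemma mcoeff_hpart e f m : (hpart e f)@_m = if (mdeg m)%:Z == e then f@_m else 0.
Proof.
case: e => d /=; last by rewrite mcoeff0.
rewrite pihomogE (raddf_sum (mcoeff m)) eqz_nat.
transitivity (\sum_(i <- msupp f | mdeg i == d) f@_i * (i == m)%:R).
  by apply: eq_bigr => i _; rewrite /= mcoeffZ mcoeffX.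
have [supp_m|nsupp_m] := boolP (m \in msupp f).
  rewrite big_mkcond (bigD1_seq m) ?msupp_uniq //= eqxx mulr1 big1 ?addr0 // => i.
  by move=> /negPf->; rewrite mulr0; case: ifP.
rewrite big_seq_cond big1 => [|i /andP[supp_i _]].
  by rewrite (memN_msupp_eq0 nsupp_m); case: ifP.
by have [eq_im|_] := eqVneq i m; rewrite ?mulr0 //; move: supp_i; rewrite eq_im (negPf nsupp_m).
Qed.

Lemma homog_intP e f :
  homog_int e f <-> (forall m, f@_m != 0 -> (mdeg m)%:Z = e).
Proof.
split=> [[-> m|[d -> /dhomogP hf] m]|hf].
- by rewrite mcoeff0 eqxx.
- by rewrite -mcoeff_msupp => /hf->.
have [->|nz_f] := eqVneq f 0; [by left | right].
have [m supp_m] : exists m, m \in msupp f.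
  case def_s : (msupp f) => [|m s]; last by exists m; rewrite inE eqxx.
  by case/eqP: nz_f; apply: msuppnil0.
exists (mdeg m); first by rewrite hf // -mcoeff_msupp.
apply/dhomogP=> m'; rewrite mcoeff_msupp => /hf eq_m'.
by move: supp_m; rewrite mcoeff_msupp => /hf eq_m; apply/eqP; rewrite -eqz_nat eq_m eq_m'.
Qed.

Lemma homog_hpart e f : homog_int e (hpart e f).
Proof. by apply/homog_intP=> m; rewrite mcoeff_hpart; case: ifP => [/eqP //|_]; rewrite eqxx. Qed.

Lemma hpart_id e f : homog_int e f -> hpart e f = f.
Proof.
move/homog_intP=> hf; apply/mpolyP=> m; rewrite mcoeff_hpart.
by case: eqP => // ne_e; apply/esym/eqP; apply: contra_notT ne_e => /hf.
Qed.

Lemma hpart_neq e e' f : homog_int e f -> e != e' -> hpart e' f = 0.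
Proof.
move/homog_intP=> hf ne_e; apply/mpolyP=> m; rewrite mcoeff_hpart mcoeff0.
case: eqP => // def_m; apply/eqP; apply: contraNT ne_e => /hf <-.
by rewrite def_m.
Qed.

Lemma homog_intB e f g : homog_int e f -> homog_int e g -> homog_int e (f - g).
Proof.
move=> /homog_intP hf /homog_intP hg; apply/homog_intP=> m; rewrite mcoeffB.
have [->|/hf //] := eqVneq f@_m 0; rewrite sub0r oppr_eq0; exact: hg.
Qed.

Lemma homog_intM e e' f g : homog_int e f -> homog_int e' g -> homog_int (e + e') (f * g).
Proof.
case=> [->|[d -> hf]]; first by rewrite mul0r; left.
case=> [->|[d' -> hg]]; first by rewrite mulr0; left.
by right; exists (d + d')%N => //; apply: dhomogM.
Qed.

Lemma homog_int_sum e (I : Type) (r : seq I) (P : pred I) (F : I -> {mpoly k[n]}) :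
  (forall i, P i -> homog_int e (F i)) -> homog_int e (\sum_(i <- r | P i) F i).
Proof.
move=> hF; elim/big_rec: _ => [|i f /hF hi hf]; first by left.
by rewrite -[f]opprK; apply: homog_intB => //; rewrite -sub0r; apply: homog_intB => //; left.
Qed.

Lemma hpartMr e e' f g : homog_int e' g -> hpart (e + e') (f * g) = hpart e f * g.
Proof.
move/homog_intP=> hg; apply/mpolyP=> m; rewrite mcoeff_hpart !mcoeffM.
case: eqP => [def_m|ne_m].
  apply: eq_bigr => -[m1 m2] /= /eqP def_m12; rewrite mcoeff_hpart.
  have [->|/hg def_m2] := eqVneq g@_m2 0; first by rewrite !mulr0.
  have := congr1 (@mdeg n) def_m12; rewrite mdegD => deg_m12.
  by case: eqP => // -[]; move: def_m deg_m12 def_m2; lia.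
apply/esym/big1 => -[m1 m2] /= /eqP def_m12; rewrite mcoeff_hpart.
have [->|/hg def_m2] := eqVneq g@_m2 0; first by rewrite mulr0.
case: eqP => [def_m1|]; last by rewrite mul0r.
have := congr1 (@mdeg n) def_m12; rewrite mdegD => deg_m12.
by case: ne_m; lia.
Qed.

Lemma mcoeff0_homog e f : homog_int e f -> e != 0 -> f@_0%MM = 0.
Proof.
move/homog_intP=> hf; apply: contraNeq => /hf <-.
by rewrite mdeg0.
Qed.

Section Rows.
Variables (r : nat) (degs : 'I_r -> int).
Implicit Types (v : 'rV[{mpoly k[n]}]_r).

Definition hrow e v : Prop := forall s, homog_int (e - degs s) (v 0 s).

Definition hcomp e v : 'rV[{mpoly k[n]}]_r := \row_s hpart (e - degs s) (v 0 s).

Lemma hrow_hcomp e v : hrow e (hcomp e v).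
Proof. by move=> s; rewrite mxE; apply: homog_hpart. Qed.

Lemma hcomp_id e v : hrow e v -> hcomp e v = v.
Proof. by move=> hv; apply/rowP=> s; rewrite mxE hpart_id. Qed.

Lemma hcomp_neq e e' v : hrow e v -> e != e' -> hcomp e' v = 0.
Proof.
move=> hv ne_e; apply/rowP=> s; rewrite !mxE; apply: hpart_neq (hv s) _.
by apply: contraNneq ne_e => /addIr->.
Qed.

Lemma hrowB e u v : hrow e u -> hrow e v -> hrow e (u - v).
Proof. by move=> hu hv s; rewrite !mxE; apply: homog_intB. Qed.

Lemma hcomp_sum v (S : seq int) : uniq S -> (forall e, e \notin S -> hcomp e v = 0) ->
  v = \sum_(e <- S) hcomp e v.
Proof.
move=> uniqS v0; apply/rowP=> s; rewrite summxE; apply/mpolyP=> m.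
rewrite (raddf_sum (mcoeff m)).
have vE e : (hcomp e v 0 s)@_m = if (mdeg m)%:Z + degs s == e then (v 0 s)@_m else 0.
  by rewrite mxE mcoeff_hpart eq_sym subr_eq eq_sym.
under eq_bigr do rewrite /= vE.
have [memS|nmemS] := boolP ((mdeg m)%:Z + degs s \in S).
  rewrite (bigD1_seq _ memS uniqS) /= eqxx big1 ?addr0 // => e /negPf.
  by rewrite eq_sym => ->.
rewrite big_seq big1 => [|e Se]; first by have := vE ((mdeg m)%:Z + degs s);
  rewrite eqxx v0 // !mxE mcoeff0.
by case: eqP => // eq_e; rewrite eq_e Se in nmemS.
Qed.

Lemma hcomp_finite v : exists S : seq int, uniq S /\ forall e, e \notin S -> hcomp e v = 0.
Proof.
exists (undup (flatten [seq [seq (mdeg m)%:Z + degs s | m <- msupp (v 0 s)] | s : 'I_r])).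
split; first exact: undup_uniq.
move=> e; rewrite mem_undup => ne; apply/rowP=> s; rewrite !mxE.
apply/mpolyP=> m; rewrite mcoeff_hpart mcoeff0; case: eqP => // def_m.
apply: memN_msupp_eq0; apply: contra ne => supp_m; apply/flattenP.
exists [seq (mdeg m)%:Z + degs s | m <- msupp (v 0 s)].
  by apply/mapP; exists s => //; rewrite mem_enum.
by apply/mapP; exists m => //; rewrite def_m subrK.
Qed.
End Rows.

Lemma hcomp_mul r r' (degr : 'I_r -> int) (degs : 'I_r' -> int) e v
    (B : 'M[{mpoly k[n]}]_(r, r')) :
  (forall i j, homog_int (degr i - degs j) (B i j)) ->
  hcomp degs e (v *m B) = hcomp degr e v *m B.
Proof.
move=> hB; apply/rowP=> j; rewrite !mxE raddf_sum; apply: eq_bigr => i _.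
by rewrite mxE /= -(hpartMr _ _ (hB i j)); congr (hpart _ _); lia.
Qed.

Lemma hrow_mul r r' (degr : 'I_r -> int) (degs : 'I_r' -> int) e v
    (B : 'M[{mpoly k[n]}]_(r, r')) :
  (forall i j, homog_int (degr i - degs j) (B i j)) ->
  hrow degr e v -> hrow degs e (v *m B).
Proof.
move=> hB hv j; rewrite mxE; apply: homog_int_sum => i _.
by have := homog_intM (hv i) (hB i j); rewrite addrA subrK.
Qed.

End HomogeneousParts.

Section Extension.
Variables (k : fieldType) (n : nat) (W : zmodType) (G : 'X_{1..n} -> {additive k -> W}).

Definition mext (f : {mpoly k[n]}) : W := \sum_(m <- msupp f) G m f@_m.

Lemma mextE i f : (msize f <= i)%N -> mext f = \sum_(m : 'X_{1..n < i}) G m f@_m.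
Proof.
move=> le_fi; rewrite /mext (big_mksub 'X_{1..n < i}) ?msupp_uniq //=; last first.
  by move=> x /msize_mdeg_lt /leq_trans; apply.
by rewrite big_rmcond //= => j /memN_msupp_eq0 ->; rewrite raddf0.
Qed.

Lemma mext_is_zmod : zmod_morphism mext.
Proof.
move=> f g; pose i := maxn (msize (f - g)) (maxn (msize f) (msize g)).
rewrite !(@mextE i) ?leq_max ?leqnn ?orbT // -sumrB.
by apply: eq_bigr => m _; rewrite mcoeffB raddfB.
Qed.

HB.instance Definition _ := GRing.isZmodMorphism.Build {mpoly k[n]} W mext mext_is_zmod.

Lemma mextX c m : mext (c *: 'X_[m]) = G m c.
Proof.
have [->|nz_c] := eqVneq c 0; first by rewrite scale0r !raddf0.
rewrite /mext (perm_big _ (msuppZ _ nz_c)) msuppX big_seq1.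
by rewrite mcoeffZ mcoeffX eqxx mulr1.
Qed.
End Extension.

(** * Ranks of matrices cut out by coordinate masks *)

Section Masks.
Variables (k : fieldType).

Definition maskmx n (P : pred 'I_n) : 'M[k]_n := diag_mx (\row_s (P s)%:R).

Lemma maskmxE n (P : pred 'I_n) s t : maskmx P s t = (P s && (s == t))%:R.
Proof. by rewrite !mxE; case: eqP => [->|]; rewrite ?andbT ?andbF ?mulr0n ?mulr1n. Qed.

Lemma mul_maskmx m n (P : pred 'I_m) (A : 'M[k]_(m, n)) s t :
  (maskmx P *m A) s t = if P s then A s t else 0.
Proof. by rewrite mul_diag_mx !mxE; case: (P s); rewrite ?mul1r ?mul0r. Qed.

Lemma mul_mx_mask m n (P : pred 'I_n) (A : 'M[k]_(m, n)) s t :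
  (A *m maskmx P) s t = if P t then A s t else 0.
Proof. by rewrite mul_mx_diag !mxE; case: (P t); rewrite ?mulr1 ?mulr0. Qed.

Lemma rank_maskmx n (P : pred 'I_n) : \rank (maskmx P) = #|P|.
Proof.
pose E : 'M[k]_(#|P|, n) := \matrix_(i, t) (enum_val i == t)%:R.
have EE : E *m E^T = 1%:M.
  apply/matrixP=> i j; rewrite !mxE (bigD1 (enum_val i)) //= !mxE eqxx mul1r.
  rewrite big1 ?addr0 => [|t /negPf ne_t]; first by rewrite (inj_eq enum_val_inj) eq_sym.
  by rewrite !mxE eq_sym ne_t mul0r.
have maskE : maskmx P = E^T *m E.
  apply/matrixP=> s t; rewrite maskmxE mxE; have [Ps|nPs] := boolP (P s).
    have [i0 def_i0] : exists i : 'I_#|P|, enum_val i = s.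
      have Ps' : s \in P by [].
      by exists (enum_rank_in Ps' s); rewrite enum_rankK_in.
    rewrite (bigD1 i0) //= !mxE def_i0 eqxx mul1r.
    rewrite big1 ?addr0 // => i ne_i; rewrite !mxE; case: eqP => [def_i|]; last by rewrite mul0r.
    by case/eqP: ne_i; apply: enum_val_inj; rewrite def_i0.
  rewrite big1 // => i _; rewrite !mxE; case: eqP => [def_s|]; last by rewrite mul0r.
  by case/negP: nPs; rewrite -def_s; apply: (enum_valP i).
apply/eqP; rewrite eqn_leq {1}maskE (leq_trans (mxrankM_maxr _ _)) ?rank_leq_row //=.
rewrite -{1}(mxrank1 k #|P|) -[1%:M]mulmx1 -{1}EE -EE mulmxA -(mulmxA E) -maskE.
by apply: leq_trans (mxrankM_maxl _ _) (mxrankM_maxr _ _).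
Qed.

(** The number #|P| - \rank B is the dimension of the kernel of B inside the masked coordinates,
    which contains the row space of A. So the truncated subtraction is a true one and computes the
    homology. *)
Lemma homology_dim m n r (P : pred 'I_n) (A : 'M[k]_(m, n)) (B : 'M[k]_(n, r)) :
  A *m maskmx P = A -> maskmx P *m B = B -> A *m B = 0 ->
  (\rank B + \rank A <= #|P|)%N /\
  ((#|P| - \rank B - \rank A = 0)%N <->
   forall v : 'rV[k]_n, v *m maskmx P = v -> v *m B = 0 -> exists u, v = u *m A).
Proof.
move=> AP PB AB0.
have rkP : (\rank B + \rank (maskmx P :&: kermx B)%MS)%N = #|P|.
  by rewrite -{1}PB mxrank_mul_ker rank_maskmx.
have le_A : (A <= maskmx P :&: kermx B)%MS.
  by rewrite sub_capmx -{1}AP submxMl; apply/sub_kermxP.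
have rkA := mxrankS le_A.
split; first by rewrite -rkP leq_add2l.
split=> [eq0 v vP vB|exact].
  have /eqmxP eqA : (A == maskmx P :&: kermx B)%MS.
    by rewrite -(geq_leqif (mxrank_leqif_eq le_A)); move: eq0 rkP rkA; lia.
  apply/submxP; rewrite eqA sub_capmx -{1}vP submxMl; exact/sub_kermxP.
have : (maskmx P :&: kermx B <= A)%MS.
  apply/row_subP=> i; set v := row i _.
  have := row_sub i (maskmx P :&: kermx B)%MS; rewrite -/v sub_capmx.
  move=> /andP[/submxP[w def_v] /sub_kermxP vB].
  apply/submxP; apply: exact => //.
  rewrite def_v -mulmxA; congr (_ *m _); apply/matrixP=> s t.
  by rewrite mul_maskmx maskmxE; case: (P s).
by move/mxrankS; move: rkP rkA; lia.
Qed.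

(** A matrix that respects labels is block diagonal up to reordering, and ranks of blocks add up. *)
Lemma rank_label (T : finType) m n (rl : 'I_m -> T) (cl : 'I_n -> T) (A : 'M[k]_(m, n)) :
  (forall s t, A s t != 0 -> rl s = cl t) ->
  \rank A = (\sum_a \rank (maskmx (fun s => rl s == a) *m A))%N.
Proof.
move=> labA; pose B a := maskmx (fun s => rl s == a) *m A.
have BC a b : B a *m maskmx (fun t => cl t == b) = if a == b then B a else 0.
  apply/matrixP=> s t; rewrite mul_mx_mask mul_maskmx.
  have [Az|/labA eq_l] := eqVneq (A s t) 0.
    by rewrite Az !if_same; case: ifP => _; rewrite ?mul_maskmx ?Az ?if_same ?mxE.
  rewrite -eq_l; have [<-|ne_a] := eqVneq (rl s) a; last first.
    by rewrite if_same; case: ifP => _; rewrite ?mul_maskmx ?mxE ?(negPf ne_a).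
  by case: ifP => _; rewrite ?mul_maskmx ?mxE ?eqxx.
have sumB : A = \sum_a B a.
  apply/matrixP=> s t; rewrite summxE (bigD1 (rl s)) //= mul_maskmx eqxx.
  by rewrite big1 ?addr0 // => a /negPf ne_a; rewrite mul_maskmx eq_sym ne_a.
have dirB : mxdirect (\sum_a <<B a>>)%MS.
  apply/mxdirect_sumsP=> a _; apply/eqP; rewrite -submx0; apply/row_subP=> i.
  set v := row i _; have := row_sub i (<<B a>> :&: \sum_(b | b != a) <<B b>>)%MS.
  rewrite -/v sub_capmx genmxE => /andP[/submxP[w def_v] le_v].
  have -> : v = v *m maskmx (fun t => cl t == a) by rewrite def_v -mulmxA BC eqxx.
  apply: submx_trans (submxMr _ le_v) _; rewrite sumsmxMr; apply/sumsmx_subP=> b ne_ba.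
  by rewrite (eqmxMr _ (genmxE _)) BC (negPf ne_ba) sub0mx.
transitivity (\rank (\sum_a <<B a>>)%MS); last first.
  by rewrite (mxdirectP dirB) /=; apply: eq_bigr => a _; rewrite mxrank_gen.
apply/eqP; rewrite eqn_leq; apply/andP; split; apply: mxrankS.
  rewrite {1}sumB; apply: summx_sub => a _.
  by apply: (sumsmx_sup a) => //; rewrite genmxE.
by apply/sumsmx_subP=> a _; rewrite genmxE; apply: submxMl.
Qed.

End Masks.

(** * Extending a finite-dimensional module by free variables *)

(* A finite-dimensional graded module over k[x_0, x_1, ...]: go_X l is the
   action of x_l on row vectors, in a homogeneous basis. *)
Record graded_ops (k : fieldType) := GradedOps {
  go_dim : nat;
  go_X : nat -> 'M[k]_go_dim;
  go_deg : 'I_go_dim -> nat;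
  go_bound : nat;
  go_degW : forall s, (go_deg s < go_bound)%N;
  go_comm : forall l l', go_X l *m go_X l' = go_X l' *m go_X l;
  go_graded : forall l s t, go_X l s t != 0 -> go_deg t = (go_deg s).+1
}.

(* The number p of variables acting through go_X does not occur in the
   carrier, but it determines the scalars. *)
Definition ext_module (k : fieldType) (p q : nat) (D : graded_ops k) : Type :=
  'rV[{mpoly k[q]}]_(go_dim D).

Section ExtendedModule.
Variables (k : fieldType) (p q : nat) (D : graded_ops k).
Local Notation R := {mpoly k[p + q]}.
Local Notation S := {mpoly k[q]}.
Local Notation N := (go_dim D).
Local Notation X := (go_X D).
Local Notation deg := (@go_deg k D).

Definition xpow (m : 'X_{1..p + q}) : 'M[k]_N := \prod_(l < p) X l ^+ m (lshift q l).

Definition ymon (m : 'X_{1..p + q}) : 'X_{1..q} := [multinom m (rshift p y) | y < q].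

Definition xdeg (m : 'X_{1..p + q}) : nat := \sum_(l < p) m (lshift q l).

Lemma mdeg_split m : mdeg m = (xdeg m + mdeg (ymon m))%N.
Proof.
rewrite !mdegE big_split_ord; congr (_ + _)%N.
by apply: eq_bigr => y _; rewrite mnmE.
Qed.

Lemma ymonD m m' : ymon (m + m') = (ymon m + ymon m')%MM.
Proof. by apply/mnmP=> y; rewrite !mnmE. Qed.

Lemma comm_prod (A : pzRingType) (I : Type) (r : seq I) (F : I -> A) a :
  (forall i, GRing.comm a (F i)) -> GRing.comm a (\prod_(i <- r) F i).
Proof. by move=> comm_a; elim/big_rec: _ => [|i b _]; [apply: commr1 | apply: commrM]. Qed.

Lemma xpowD m m' : xpow (m + m') = xpow m * xpow m'.
Proof.
have commX l l' a b : GRing.comm (X l ^+ a) (X l' ^+ b).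
  by apply/commrX/commr_sym/commrX; apply: go_comm.
rewrite /xpow; elim: (index_enum _) => [|l r IH]; first by rewrite !big_nil mulr1.
rewrite !big_cons IH mnmDE exprD -!mulrA; congr (_ * _).
rewrite !mulrA; congr (_ * _).
by apply: comm_prod => i; apply: commX.
Qed.

Lemma xpow0 : xpow 0 = 1.
Proof. by rewrite /xpow big1 // => l _; rewrite mnm0E expr0. Qed.

Definition raises_by (e : nat) (B : 'M[k]_N) := forall s t, B s t != 0 -> deg t = (deg s + e)%N.

Lemma raises_byM e e' B B' : raises_by e B -> raises_by e' B' -> raises_by (e + e') (B *m B').
Proof.
move=> rB rB' s t; rewrite mxE => nz.
have [u nz_u] : exists u, B s u * B' u t != 0.
  apply/existsP; apply: contraNT nz; rewrite negb_exists => /forallP z.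
  by rewrite big1 // => u _; apply/eqP; have := z u; rewrite negbK.
move: nz_u; rewrite mulf_eq0 negb_or => /andP[/rB def_u /rB' ->].
by rewrite def_u addnA.
Qed.

Lemma raises_by1 : raises_by 0 1%:M.
Proof. by move=> s t; rewrite mxE; case: (eqVneq s t) => [->|_]; rewrite ?addn0 ?eqxx. Qed.

Lemma raises_byX l i : raises_by i (X l ^+ i).
Proof.
elim: i => [|i IH]; first exact: raises_by1.
rewrite exprS -add1n; apply: raises_byM => // s t /go_graded->.
by rewrite addn1.
Qed.

Lemma raises_by_xpow m : raises_by (xdeg m) (xpow m).
Proof.
rewrite /xdeg /xpow; elim: (index_enum _) => [|l r IH].
  by rewrite !big_nil; apply: raises_by1.
by rewrite !big_cons; apply: raises_byM IH; apply: raises_byX.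
Qed.

Lemma raises_by_eq0 e B : raises_by e B -> (go_bound D <= e)%N -> B = 0.
Proof.
move=> rB le_e; apply/matrixP=> s t; rewrite [RHS]mxE; apply/eqP.
apply/negPn/negP => /rB def_t; have := go_degW t.
by rewrite def_t ltnNge (leq_trans le_e) ?leq_addl.
Qed.

Definition act_mon (m : 'X_{1..p + q}) (c : k) : 'M[S]_N :=
  (c *: 'X_[ymon m]) *: map_mx (@mpolyC q k) (xpow m).

Lemma act_mon_is_zmod m : zmod_morphism (act_mon m).
Proof. by move=> a b; rewrite /act_mon !scalerBl. Qed.

HB.instance Definition _ m :=
  GRing.isZmodMorphism.Build k 'M[S]_N (act_mon m) (act_mon_is_zmod m).

Definition actmx : R -> 'M[S]_N := mext act_mon.

HB.instance Definition _ := GRing.Additive.on actmx.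

Lemma actmxX c m : actmx (c *: 'X_[m]) = act_mon m c.
Proof. exact: mextX. Qed.

Lemma act_monM m m' c c' : act_mon (m + m') (c * c') = act_mon m c *m act_mon m' c'.
Proof.
rewrite /act_mon xpowD map_mxM ymonD mpolyXD -scalemxAl -scalemxAr scalerA.
by rewrite -scalerAl -scalerAr scalerA.
Qed.

Lemma actmx_is_monoid : monoid_morphism actmx.
Proof.
split=> [|f g].
  rewrite -[1]scale1r -[X in _ *: X]mpolyX0 actmxX /act_mon xpow0 map_mx1 scale1r.
  rewrite [ymon _](_ : _ = 0%MM) ?mpolyX0 ?scale1r //.
  by apply/mnmP=> y; rewrite mnmE !mnm0E.
elim/mpolyind: f => [|c m f _ _ IHf]; first by rewrite mul0r !raddf0 mul0r.
rewrite mulrDl !raddfD /= mulrDl IHf; congr (_ + _).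
elim/mpolyind: g {IHf} => [|c' m' g _ _ IHg]; first by rewrite mulr0 !raddf0 mulr0.
rewrite mulrDr !raddfD /= mulrDr IHg; congr (_ + _).
rewrite -scalerAl -scalerAr scalerA -mpolyXD !actmxX; exact: act_monM.
Qed.

HB.instance Definition _ := GRing.isMonoidMorphism.Build R 'M[S]_N actmx actmx_is_monoid.

Lemma actmx_lshift l : actmx 'X_(lshift q l) = map_mx (@mpolyC q k) (X l).
Proof.
rewrite -[X in actmx X]scale1r actmxX /act_mon.
have -> : ymon U_(lshift q l) = 0%MM.
  apply/mnmP=> y; rewrite mnmE mnm0E mnm1E; case: eqP => // /(congr1 val) /=.
  by have := ltn_ord l; lia.
rewrite mpolyX0 !scale1r; congr map_mx.
transitivity (\prod_(i < p | i == l) X i); last by rewrite big_pred1_eq.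
rewrite big_mkcond; apply: eq_bigr => i _; rewrite mnm1E (inj_eq (@lshift_inj p q)) eq_sym.
by case: eqP.
Qed.

Definition ylift : S -> R := mmap (@mpolyC (p + q) k) (fun y => 'X_(rshift p y)).

HB.instance Definition _ := GRing.RMorphism.on ylift.

Lemma actmxC c : actmx c%:MP = (c%:MP)%:M.
Proof.
rewrite -[c%:MP]mulr1 mul_mpolyC -mpolyX0 actmxX /act_mon xpow0 map_mx1 scalemx1.
have -> : ymon 0 = 0%MM by apply/mnmP=> y; rewrite mnmE !mnm0E.
by rewrite !mpolyX0 -mul_mpolyC mulr1.
Qed.

Lemma actmx_rshift y : actmx 'X_(rshift p y) = ('X_y)%:M.
Proof.
rewrite -[X in actmx X]scale1r actmxX /act_mon scale1r.
have -> : xpow U_(rshift p y) = 1.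
  rewrite /xpow big1 // => l _; rewrite mnm1E; case: eqP; rewrite ?expr0 //.
  by move/(congr1 val) => /=; have := ltn_ord l; lia.
rewrite map_mx1 scalemx1; congr (_%:M); congr 'X_[_].
by apply/mnmP=> y'; rewrite !mnmE (inj_eq (@rshift_inj p q)).
Qed.

Lemma actmx_ylift f : actmx (ylift f) = f%:M.
Proof.
elim/mpolyind: f => [|c m f _ _ IH]; first by rewrite !raddf0.
rewrite !raddfD /= IH; congr (_ + _).
rewrite -mul_mpolyC !rmorphM /= {1}/ylift mmapC actmxC; congr (_ * _).
rewrite mpolyXE_id !rmorph_prod; apply: eq_bigr => y _.
rewrite !rmorphXn; congr (_ ^+ _).
by rewrite /= /ylift mmapX mmap1U actmx_rshift.
Qed.

Local Notation ext_module := (ext_module p q D).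

HB.instance Definition _ := GRing.Zmodule.on ext_module.

Definition ext_scale (f : R) (v : ext_module) : ext_module := v *m actmx f.

Fact ext_scaleA f g v : ext_scale f (ext_scale g v) = ext_scale (f * g) v.
Proof. by rewrite /ext_scale mulrC rmorphM /= -mulmxA. Qed.

Fact ext_scale1 : left_id 1 ext_scale.
Proof. by move=> v; rewrite /ext_scale rmorph1 mulmx1. Qed.

Fact ext_scaleDr : right_distributive ext_scale +%R.
Proof. by move=> f u v; rewrite /ext_scale mulmxDl. Qed.

Fact ext_scaleDl v : {morph ext_scale^~ v : f g / f + g}.
Proof. by move=> f g; rewrite /ext_scale raddfD mulmxDr. Qed.

HB.instance Definition _ := GRing.Zmodule_isLmodule.Build R ext_module
  ext_scaleA ext_scale1 ext_scaleDr ext_scaleDl.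

Lemma ext_scaleE (f : R) (v : ext_module) : f *: v = v *m actmx f.
Proof. by []. Qed.

Lemma ext_scale_ylift (f : S) (v : ext_module) : ylift f *: v = (f *: v : 'rV[S]_N).
Proof. by rewrite ext_scaleE actmx_ylift mul_mx_scalar. Qed.

Definition ext_basis (s : 'I_N) : ext_module := delta_mx 0 s.

Lemma ext_sum_basis (v : 'rV[S]_N) :
  (v : ext_module) = \sum_s ylift (v 0 s) *: ext_basis s.
Proof.
rewrite [LHS]row_sum_delta; apply: eq_bigr => s _.
by rewrite ext_scale_ylift.
Qed.

Definition zdeg (s : 'I_N) : int := (deg s)%:Z.

Definition ext_piece (j : int) (v : ext_module) : Prop := hrow zdeg j v.

Lemma actmx_homog d f : f \is d.-homog ->
  forall s t, homog_int (d%:Z + zdeg s - zdeg t) (actmx f s t).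
Proof.
move=> /dhomogP hf s t; rewrite /actmx /mext summxE big_seq; apply: homog_int_sum => m.
move/hf => deg_m; rewrite /act_mon 2!mxE.
have [->|nz] := eqVneq (xpow m s t) 0; first by rewrite mpolyC0 mulr0; left.
rewrite /zdeg (raises_by_xpow nz) mulrC mul_mpolyC scalerA.
right; exists (mdeg (ymon m)); last by rewrite dhomogZ // dhomogX.
by move: (mdeg_split m); rewrite deg_m; lia.
Qed.

Lemma ext_piece0 j : ext_piece j 0.
Proof. by move=> s; rewrite mxE; left. Qed.

Lemma ext_pieceB j x y : ext_piece j x -> ext_piece j y -> ext_piece j (x - y).
Proof. exact: hrowB. Qed.

Lemma ext_pieceZ d j (f : R) x :
  f \is d.-homog -> ext_piece j x -> ext_piece (d%:Z + j) (f *: x).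
Proof.
move=> /actmx_homog hf hx.
apply: (@hrow_mul _ _ _ _ (fun s => d%:Z + zdeg s)) => // s.
by have := hx s; congr homog_int; lia.
Qed.

Lemma ext_decomp (x : ext_module) : exists (r : seq int) (y : int -> ext_module),
  [/\ uniq r, forall j, ext_piece j (y j) & x = \sum_(j <- r) y j].
Proof.
have [r [uniq_r x0]] := hcomp_finite zdeg x.
exists r, (fun j => hcomp zdeg j x); split=> // [j|]; first exact: hrow_hcomp.
exact: hcomp_sum.
Qed.

Lemma ext_direct (r : seq int) (y : int -> ext_module) :
  uniq r -> (forall j, ext_piece j (y j)) -> \sum_(j <- r) y j = 0 ->
  forall j, j \in r -> y j = 0.
Proof.
move=> uniq_r hy y0 j rj.
have := congr1 (hcomp zdeg j) y0.
have -> : hcomp zdeg j (\sum_(i <- r) y i) = \sum_(i <- r) hcomp zdeg j (y i).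
  apply/rowP=> s; rewrite summxE mxE summxE raddf_sum.
  by apply: eq_bigr => i _; rewrite mxE.
rewrite (bigD1_seq j) //= (hcomp_id (hy j)) big1 ?addr0 => [->|i ne_ij].
  by apply/rowP=> s; rewrite !mxE raddf0.
exact: hcomp_neq (hy i) ne_ij.
Qed.

Lemma ext_fingen : exists (m : nat) (g : 'I_m -> ext_module),
  forall x, exists f : 'I_m -> R, x = \sum_(a < m) f a *: g a.
Proof.
exists N, ext_basis => x; exists (fun s => ylift ((x : 'rV[S]_N) 0 s)).
exact: ext_sum_basis.
Qed.

Definition ext_gmodule : gradedModule k (p + q) :=
  GradedModule ext_piece0 ext_pieceB ext_pieceZ ext_decomp ext_direct ext_fingen.

End ExtendedModule.

(** * The Koszul resolution of the extended module *)

Section ExtendedResolution.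
Variables (k : fieldType) (p q : nat) (D : graded_ops k).
Local Notation R := {mpoly k[p + q]}.
Local Notation S := {mpoly k[q]}.
Local Notation N := (go_dim D).
Local Notation X := (go_X D).
Local Notation deg := (@go_deg k D).
Local Notation M := (ext_gmodule p q D).
Local Notation basis := (@ext_basis k p q D).
Local Notation xv := (@xvar k (p + q)).
Local Notation act := (@actmx k p q D).

Definition theta (l : nat) : 'M[R]_N := map_mx (@mpolyC (p + q) k) (X l) - (xv l)%:M.

Lemma theta_comm l l' : theta l *m theta l' = theta l' *m theta l.
Proof.
apply: (@commrB 'M[R]_N); last exact: scalar_mxC.
apply/commr_sym/(@commrB 'M[R]_N); last exact: scalar_mxC.
by rewrite /GRing.comm -[LHS]map_mxM -[RHS]map_mxM go_comm.
Qed.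

Lemma theta_homog l s t : (l < p)%N ->
  homog_int ((deg s)%:Z + 1 - (deg t)%:Z) (theta l s t).
Proof.
move=> lt_lp; rewrite !mxE; apply: homog_intB.
  have [->|/go_graded->] := eqVneq (X l s t) 0; first by rewrite mpolyC0; left.
  by right; exists 0%N; [lia | rewrite -[_%:MP]mulr1 mul_mpolyC dhomogZ ?dhomog1].
have [->|_] := eqVneq s t; last by left.
right; exists 1%N; first by lia.
by rewrite mulr1n /xvar; case: insubP => [i _ _|_]; rewrite ?dhomog0 // dhomogX /= mdeg1.
Qed.

Definition kdeg i (s : 'I_(krank N p i)) : int := (deg (kbase s) + i)%:Z.

Lemma kdiff_theta_homog i r s :
  homog_int (@kdeg i.+1 r - kdeg s) (kdiff theta p i r s).
Proof.
have := @kdiff_entry _ _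
  (fun s t a => homog_int ((deg s)%:Z + 1 - (deg t)%:Z) a) theta p i _ _ _ r s.
suff e : (deg (kbase r))%:Z + 1 - (deg (kbase s))%:Z = @kdeg i.+1 r - kdeg s.
  rewrite e; apply=> [s' t'|s' t' a|l s' t' lt_lp]; first by left.
    by rewrite -[- a]sub0r => ha; apply: homog_intB => //; left.
  exact: theta_homog.
by rewrite /kdeg; lia.
Qed.

Definition aug (v : 'rV[R]_N) : M := \sum_s v 0 s *: basis s.

Lemma augB u v : aug (u - v) = aug u - aug v.
Proof.
rewrite /aug -sumrB; apply: eq_bigr => s _.
by rewrite !mxE scalerBl.
Qed.

Lemma augD u v : aug (u + v) = aug u + aug v.
Proof.
rewrite /aug -big_split; apply: eq_bigr => s _.
by rewrite !mxE scalerDl.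
Qed.

Lemma aug0 : aug 0 = 0.
Proof. by rewrite -(subrr 0) augB subrr. Qed.

Lemma aug_sum (I : Type) (r : seq I) (F : I -> 'rV[R]_N) :
  aug (\sum_(i <- r) F i) = \sum_(i <- r) aug (F i).
Proof. exact: (big_morph _ augD aug0). Qed.

Lemma aug_theta l (u : 'rV[R]_N) : (l < p)%N -> aug (u *m theta l) = 0.
Proof.
move=> lt_lp.
have xvl : xv l = 'X_(lshift q (Ordinal lt_lp)) by rewrite -xvarE.
transitivity (\sum_s u 0 s *: (\sum_t theta l s t *: basis t)).
  rewrite /aug; under eq_bigr do rewrite mxE scaler_suml.
  rewrite exchange_big; apply: eq_bigr => s _; rewrite scaler_sumr.
  by apply: eq_bigr => t _; rewrite scalerA.
rewrite big1 // => s _.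
suff -> : \sum_t theta l s t *: basis t = 0 by rewrite scaler0.
under eq_bigr do rewrite !mxE scalerBl.
rewrite sumrB (bigD1 s) //= [X in _ - X](bigD1 s) //= eqxx mulr1n.
rewrite [X in _ - (_ + X)]big1 => [|t /negPf ne_ts]; last first.
  by rewrite eq_sym ne_ts scale0r.
rewrite -(bigD1 s (P := xpredT) (F := fun t => (X l s t)%:MP *: basis t)) //= addr0.
apply/eqP; rewrite subr_eq0 xvl ext_scaleE actmx_lshift /ext_basis -rowE; apply/eqP.
rewrite [RHS]row_sum_delta; apply: eq_bigr => t _.
by rewrite ext_scaleE actmxC mul_mx_scalar !mxE.
Qed.

Lemma augE (v : 'rV[R]_N) : aug v = \sum_s row s (act (v 0 s)) :> 'rV[S]_N.
Proof. by apply: eq_bigr => s _; rewrite ext_scaleE rowE. Qed.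

Lemma aug_kdiff0 (w : 'rV[R]_(krank N p 1)) : aug (w *m kdiff theta p 0) = 0.
Proof.
have [u ->] := (kdiff0_im theta p (w *m kdiff theta p 0)).1 (ex_intro _ w erefl).
by rewrite aug_sum big1 // => l _; apply: aug_theta.
Qed.

Definition yext (m : 'X_{1..q}) : 'X_{1..p + q} :=
  [multinom (match split i with inl _ => 0%N | inr y => m y end) | i < p + q].

Lemma yextE_l m l : yext m (lshift q l) = 0%N.
Proof. by rewrite mnmE (unsplitK (inl l)). Qed.

Lemma yextE_r m y : yext m (rshift p y) = m y.
Proof. by rewrite mnmE (unsplitK (inr y)). Qed.

Lemma yextK m : ymon (yext m) = m.
Proof. by apply/mnmP=> y; rewrite mnmE yextE_r. Qed.

Lemma ymonK m : xdeg m = 0%N -> yext (ymon m) = m.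
Proof.
move=> /eqP; rewrite sum_nat_eq0 => /forallP m0; apply/mnmP=> i.
rewrite -[i]splitK; case: (split i) => j /=; last by rewrite yextE_r mnmE.
by rewrite yextE_l; apply/esym/eqP/m0.
Qed.

Lemma xdeg_yext m : xdeg (yext m) = 0%N.
Proof. by rewrite /xdeg big1 // => l _; rewrite yextE_l. Qed.

(* Multiplication by x_l raises the degree of the basis vectors, so below and
   on the diagonal only the part of f in the y variables is visible. *)
Lemma actmx_low f s t m : (deg t <= deg s)%N ->
  (act f s t)@_m = if s == t then f@_(yext m) else 0.
Proof.
move=> le_ts; elim/mpolyind: f => [|c m' f _ _ IH].
  by rewrite raddf0 mxE !mcoeff0 if_same.
rewrite raddfD /= mxE !mcoeffD IH actmxX.
suff -> : (act_mon D m' c s t)@_m = if s == t then (c *: 'X_[m'])@_(yext m) else 0.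
  by case: ifP; rewrite ?addr0.
rewrite 2!mxE mulrC mul_mpolyC mcoeffZ !mcoeffZ !mcoeffX.
have [m'0|m'0] := eqVneq (xdeg m') 0%N.
  have -> : xpow D m' = 1%:M.
    rewrite /xpow big1 // => l _; move/eqP: m'0.
    by rewrite sum_nat_eq0 => /forallP/(_ l)/eqP->; rewrite expr0.
  rewrite mxE; case: eqP => _; rewrite ?mul0r // mul1r; congr (_ * _%:R).
  by congr nat_of_bool; apply/eqP/eqP => [<-|->]; rewrite ?ymonK ?yextK.
rewrite (_ : m' == yext m = false); last first.
  by apply: contraNF m'0 => /eqP->; rewrite xdeg_yext.
rewrite mulr0 if_same.
have [->|/raises_by_xpow def_t] := eqVneq (xpow D m' s t) 0; first by rewrite mul0r.
by move: le_ts m'0; rewrite def_t; lia.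
Qed.

Lemma kill_vars_yext (f : R) : (forall m, f@_(yext m) = 0) -> kill_vars p f = 0.
Proof.
move=> f0; apply/mpolyP=> m; rewrite mcoeff_kill_vars mcoeff0.
case: ifP => // /forallP m0; rewrite -(@ymonK m) //.
by rewrite /xdeg big1 // => l _; apply/eqP; have := m0 (lshift q l); rewrite /= ltn_ord.
Qed.

Definition theta0 (l : nat) : 'M[R]_N := - (xv l)%:M.

Lemma theta0_deg l s t : theta0 l s t != 0 -> deg t = deg s.
Proof. by rewrite !mxE; case: (eqVneq s t) => [->|_] //; rewrite mulr0n oppr0 eqxx. Qed.

Lemma theta_deg l s t : (theta l - theta0 l) s t != 0 -> (deg s < deg t)%N.
Proof.
rewrite /theta /theta0 opprK subrK mxE mpolyC_eq0 => /go_graded->.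
exact: ltnSn.
Qed.

Lemma sum_theta0_im b (v : 'rV[R]_N) :
  (exists u : nat -> 'rV[R]_N, v = \sum_(l < b) u l *m theta0 l) <->
  forall s, kill_vars b (v 0 s) = 0.
Proof.
split=> [[u ->] s|v0].
  apply/kill_vars_eq0; exists (fun l => - u l 0 s); rewrite summxE.
  by apply: eq_bigr => l _; rewrite mulmxN mul_mx_scalar !mxE mulrN.
have [g def_v] := fin_all_exists (fun s => (kill_vars_eq0 b (v 0 s)).1 (v0 s)).
exists (fun l => - \row_s g s l); apply/rowP=> s; rewrite def_v summxE.
by apply: eq_bigr => l _; rewrite mulmxN mulNmx opprK mul_mx_scalar !mxE.
Qed.

(** The x variables form a regular sequence on the free module: [kill_vars l] is a ring morphism
    into a domain in which x_l survives. *)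
Lemma theta0_exact i (v : 'rV[R]_(krank N p i.+1)) : v *m kdiff theta0 p i = 0 ->
  exists u, v = u *m kdiff theta0 p i.+1.
Proof.
move=> cl; have [u _ ->] : exists2 u, ksupp predT u & v = u *m kdiff theta0 p i.+1;
  last by exists u.
apply: (@kregular_exact _ _ _ _ predT) => // [l l' _ _|l lt_lp w _ [u eq_wu]].
  by rewrite !(mulmxN, mulNmx) scalar_mxC.
have /(sum_theta0_im l) wl0 : exists u : nat -> 'rV[R]_N,
    w *m theta0 l = \sum_(l' < l) u l' *m theta0 l'.
  by apply/kdiff0_im; exists u.
have [|u' def_w] := (kdiff0_im theta0 l w).2; last by exists u'.
apply/sum_theta0_im => s; have := wl0 s.
rewrite mulmxN mul_mx_scalar !mxE -mulNr rmorphM rmorphN /= kill_vars_xvar ltnn.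
move/eqP; rewrite mulf_eq0 oppr_eq0 => /orP[|/eqP //].
by rewrite /xvar; case: insubP => [j _ _|]; rewrite -?msupp_eq0 ?msuppX // -leqNgt; lia.
Qed.

(** The perturbation argument with the kernel of [aug] as cycles. In lowest weight w, the
    t-coordinate of [aug v] shows exactly the x-free part of [v 0 t]: other basis vectors of weight
    at least w do not contribute, by [actmx_low]. Hence the lowest component has entries in the
    ideal of the x variables. *)
Lemma ext_exact0 (v : 'rV[R]_N) :
  \sum_s v 0 s *: basis s = 0 <-> exists w, v = w *m kdiff theta p 0.
Proof.
split=> [v0|[w ->]]; last exact: aug_kdiff0.
apply: (@kperturb _ _ theta theta0 deg (go_bound D) p (@go_degW _ D) theta0_deg theta_deg 0
  (fun v => aug v = 0)) v0 => [u w u0 w0|u|w {}v v0 Qv].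
- by rewrite augB u0 w0 subrr.
- exact: aug_kdiff0.
apply/kdiff0_im/sum_theta0_im => t; rewrite mxE; case: ifP => [/eqP deg_t|];
  last by rewrite rmorph0.
apply: kill_vars_yext => m.
have := congr1 (fun x : 'rV[S]_N => (x 0 t)@_m) v0.
rewrite augE !mxE mcoeff0 => <-.
rewrite summxE raddf_sum (bigD1 t) //= big1 ?addr0 => [|s ne_st].
  by rewrite mxE actmx_low ?eqxx.
have [->|/Qv le_s] := eqVneq (v 0 s) 0; first by rewrite raddf0 !mxE mcoeff0.
by rewrite mxE actmx_low ?(negPf ne_st) // deg_t.
Qed.

Lemma ext_exact i (v : 'rV[R]_(krank N p i.+1)) :
  v *m kdiff theta p i = 0 <-> exists w, v = w *m kdiff theta p i.+1.
Proof.
have comm l l' : (l < p)%N -> (l' < p)%N -> theta l *m theta l' = theta l' *m theta l.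
  by move=> _ _; apply: theta_comm.
split=> [|[w ->]]; last by rewrite -mulmxA kdiff_kdiff ?mulmx0.
apply: (kperturb_exact (@go_degW _ D) theta0_deg theta_deg) => //.
exact: theta0_exact.
Qed.

Lemma ext_basis_homog s : ext_piece (@kdeg 0 s) (basis s).
Proof.
move=> t; rewrite mxE eqxx /=; have [->|_] := eqVneq t s; last by left.
by right; exists 0%N; rewrite ?dhomog1 // /kdeg /zdeg /=; lia.
Qed.

Lemma ext_aug_surj (x : M) : exists v : 'rV[R]_N, x = \sum_s v 0 s *: basis s.
Proof.
exists (\row_s ylift p ((x : 'rV[S]_N) 0 s)); rewrite [LHS]ext_sum_basis.
by apply: eq_bigr => s _; rewrite mxE.
Qed.

Definition ext_resolution : free_resolution M :=
  @FreeResolution k (p + q) M (krank N p) kdeg basis (kdiff theta p)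
    ext_basis_homog kdiff_theta_homog ext_aug_surj ext_exact0 ext_exact.

(** The constant term of [theta l] is X_l, so reducing the resolution modulo the variables gives the
    Koszul complex of the operators over k. *)
Lemma ext_tor_diff i j r s : tor_diff ext_resolution i j r s =
  if (@kdeg i.+1 r == j) && (kdeg s == j) then kdiff X p i r s else 0.
Proof.
rewrite mxE /=; case: ifP => // _.
transitivity (map_mx (mcoeff 0%MM) (kdiff theta p i) r s); first by rewrite mxE.
rewrite (map_kdiff (mcoeff 0%MM : {rmorphism R -> k})).
congr (fun_of_matrix _ _ _); apply: eq_kdiff => l.
apply/matrixP=> a b; rewrite !mxE /= mcoeffB mcoeffC eqxx mulr1.
suff -> : (xv l *+ (a == b))@_0 = 0 by rewrite subr0.
rewrite mcoeffMn /xvar; case: insubP => [i' _ _|_]; last by rewrite mcoeff0 mul0rn.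
by rewrite mcoeffX mnm1_eq0 mul0rn.
Qed.

Hypothesis dim_gt0 : (0 < N)%N.

Lemma ext_x_nilpotent l (x : M) : 'X_(lshift q l) ^+ (go_bound D) *: x = 0.
Proof.
rewrite ext_scaleE rmorphXn /= actmx_lshift -rmorphXn /=.
by rewrite (raises_by_eq0 (@raises_byX _ D l _) (leqnn _)) map_mx0 mulmx0.
Qed.

Lemma ext_krull_dim : krull_dim (annihilator M) q.
Proof.
apply: krull_dimP => [f annf|l]; last by exists (go_bound D) => x; apply: ext_x_nilpotent.
apply: kill_vars_yext => m; pose s := Ordinal dim_gt0.
have := congr1 (fun x : 'rV[S]_N => (x 0 s)@_m) (annf (basis s)).
by rewrite ext_scaleE -rowE !mxE actmx_low // eqxx mcoeff0.
Qed.

Lemma ext_codim : has_codim M p.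
Proof.
exists (p + q)%N, q; split; last by rewrite addnC.
- apply: (@krull_dimP k 0 (p + q)) => [f ->|[]//].
  by rewrite rmorph0.
exact: ext_krull_dim.
Qed.

Definition yvars : seq R := [seq 'X_(rshift p y) | y <- enum 'I_q].

Lemma yvars_nth a : (a < q)%N -> exists2 y : 'I_q, yvars`_a = 'X_(rshift p y) & val y = a.
Proof.
move=> lt_aq; exists (Ordinal lt_aq) => //.
rewrite (nth_map (Ordinal lt_aq)) ?size_enum_ord //.
by congr 'X_(rshift p _); apply: val_inj => /=; rewrite nth_enum_ord.
Qed.

Lemma yvars_span a (x : 'rV[S]_N) : (a <= q)%N ->
  @in_span _ _ M (take a yvars) x <-> forall t, kill_vars a (x 0 t) = 0.
Proof.
move=> le_aq.
have sz : size (take a yvars) = a by rewrite size_take_min size_map size_enum_ord; apply/minn_idPl.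
have ynth i (v : M) : (i < a)%N ->
    (take a yvars)`_i *: v = (@xvar k q i *: v : 'rV[S]_N).
  move=> lt_ia; rewrite nth_take //; have [|y -> <-] := @yvars_nth i; first exact: leq_trans le_aq.
  by rewrite xvarE ext_scaleE actmx_rshift mul_mx_scalar.
split=> [[v def_x] t|x0].
  apply/kill_vars_eq0.
  pose F i : S := if insub i is Some i' then (v i' : 'rV[S]_N) 0 t else 0.
  exists F; transitivity (\sum_(l < size (take a yvars)) xvar k q l * F l); last by rewrite sz.
  rewrite def_x summxE; apply: eq_bigr => i _.
  by rewrite /F valK ynth ?mxE //; apply: leq_trans (ltn_ord i) _; rewrite sz.
have [g def_x] := fin_all_exists (fun t => (kill_vars_eq0 a (x 0 t)).1 (x0 t)).
exists (fun i => \row_t g t i); apply/rowP=> t; rewrite def_x summxE.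
transitivity (\sum_(l < size (take a yvars)) xvar k q l * g t l); first by rewrite sz.
apply: eq_bigr => i _; rewrite ynth ?mxE //.
by apply: leq_trans (ltn_ord i) _; rewrite sz.
Qed.

Lemma yvars_regular : regular_seq M yvars.
Proof.
split.
- apply/allP=> _ /mapP[y _ ->]; rewrite mcoeffX mnm1_eq0 //.
- move=> a x; rewrite size_map size_enum_ord => lt_aq.
  have [y -> def_y] := yvars_nth lt_aq.
  rewrite ext_scaleE actmx_rshift mul_mx_scalar => /(yvars_span _ (ltnW lt_aq)) x0.
  apply/(yvars_span _ (ltnW lt_aq)) => t; have := x0 t.
  rewrite mxE rmorphM /= kill_varsX -def_y ltnn => /eqP.
  by rewrite mulf_eq0 -msupp_eq0 msuppX => /eqP.
exists (basis (Ordinal dim_gt0)).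
rewrite -[yvars]take_size size_map size_enum_ord => /(yvars_span _ (leqnn q)).
move/(_ (Ordinal dim_gt0)); rewrite mxE !eqxx rmorph1 => /eqP.
by rewrite oner_eq0.
Qed.

Lemma ext_cohen_macaulay : cohen_macaulay M.
Proof.
exists q; first exact: ext_krull_dim.
split; first by exists yvars; [rewrite size_map size_enum_ord | apply: yvars_regular].
by move=> s; apply: regular_seq_leq; apply: ext_x_nilpotent.
Qed.

End ExtendedResolution.

(** * Independence of Tor from the resolution *)

Section Tor.
Variables (k : fieldType) (n : nat) (M : gradedModule k n).
Local Notation R := {mpoly k[n]}.
Local Notation cst := (map_mx (mcoeff 0%MM : R -> k)).

Section OneResolution.
Variable F : free_resolution M.
Local Notation d := (fr_diff F).

Definition degmask i (j : int) : 'M[k]_(fr_rank F i) := maskmx k (fun s => fr_deg s == j).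

Lemma fr_diff_diff i : d i.+1 *m d i = 0.
Proof.
apply/row_matrixP=> r; rewrite row0 row_mul.
by apply/fr_exact; exists (delta_mx 0 r); rewrite -rowE.
Qed.

Lemma fr_aug_diff (w : 'rV[R]_(fr_rank F 1)) :
  \sum_s (w *m d 0) 0 s *: fr_aug s = 0.
Proof. by apply/fr_exact0; exists w. Qed.

Lemma cst_diff_deg i r s : cst (d i) r s != 0 -> fr_deg r = fr_deg s.
Proof.
rewrite mxE; apply: contraNeq => ne_deg.
by rewrite (mcoeff0_homog (fr_diff_homog r s)) ?subr_eq0.
Qed.

Lemma tor_diffE i j : tor_diff F i j = cst (d i) *m degmask i j.
Proof.
apply/matrixP=> r s; rewrite mul_mx_mask !mxE.
case: (eqVneq (fr_deg s) j) => [deg_s|_]; last by rewrite andbF.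
rewrite andbT; case: eqP => // ne_deg.
by apply/esym/eqP; apply: contra_notT ne_deg => nz; rewrite (cst_diff_deg (i := i) (s := s)) ?mxE.
Qed.

Lemma tor_diffE' i j : tor_diff F i j = degmask i.+1 j *m cst (d i).
Proof.
apply/matrixP=> r s; rewrite mul_maskmx !mxE.
case: (eqVneq (fr_deg r) j) => [deg_r|_] //=.
case: eqP => // ne_deg; apply/esym/eqP; apply: contra_notT ne_deg => nz.
by rewrite -deg_r; apply/esym; apply: (cst_diff_deg (i := i)); rewrite mxE.
Qed.

Lemma degmask_id i j : degmask i j *m degmask i j = degmask i j.
Proof. by apply/matrixP=> s t; rewrite mul_maskmx maskmxE; case: (_ == j). Qed.

Lemma tor_diff_diff i j : tor_diff F i.+1 j *m tor_diff F i j = 0.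
Proof.
rewrite tor_diffE tor_diffE' -mulmxA (mulmxA (degmask _ _)) degmask_id.
rewrite mulmxA -tor_diffE tor_diffE' -mulmxA -map_mxM /=.
by rewrite fr_diff_diff map_mx0 mulmx0.
Qed.

(** The differential leaving term i. It has no columns for i = 0, which absorbs the case distinction
    in [tor_dim]. *)
Definition tor_in i j : 'M[k]_(fr_rank F i, if i is i'.+1 then fr_rank F i' else 0%N) :=
  match i with 0 => 0 | i'.+1 => tor_diff F i' j end.

Lemma tor_dimE i j : tor_dim F i j =
  (#|[pred s : 'I_(fr_rank F i) | fr_deg s == j]| - \rank (tor_in i j)
    - \rank (tor_diff F i j))%N.
Proof.
rewrite /tor_dim cardsE; congr (_ - _ - _)%N.
by case: i => [|i] //=; rewrite mxrank0.
Qed.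

Lemma tor_homology i j :
  (\rank (tor_in i j) + \rank (tor_diff F i j) <= #|[pred s : 'I_(fr_rank F i) | fr_deg s == j]|)%N
  /\ (tor_dim F i j = 0%N <-> forall v : 'rV[k]_(fr_rank F i),
       v *m degmask i j = v -> v *m tor_in i j = 0 -> exists u, v = u *m tor_diff F i j).
Proof.
rewrite tor_dimE; apply: homology_dim.
- by rewrite tor_diffE -mulmxA degmask_id.
- by case: i => [|i]; rewrite ?mulmx0 //= tor_diffE' mulmxA degmask_id.
by case: i => [|i] /=; rewrite ?mulmx0 ?tor_diff_diff.
Qed.

Lemma piece_scale e j (f : R) (x : M) :
  homog_int e f -> gm_piece j x -> gm_piece (e + j) (f *: x).
Proof.
case=> [->|[d' -> hf]] hx; first by rewrite scale0r; apply: gm_piece0.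
exact: gm_pieceZ.
Qed.

Lemma piece_sum j (I : Type) (r : seq I) (P : pred I) (G : I -> M) :
  (forall i, P i -> gm_piece j (G i)) -> gm_piece j (\sum_(i <- r | P i) G i).
Proof.
move=> hG; elim/big_rec: _ => [|i x /hG hi hx]; first exact: gm_piece0.
by rewrite -[x]opprK -[- x]sub0r; apply: gm_pieceB => //; apply: gm_pieceB => //; apply: gm_piece0.
Qed.

(** The images of the components of v, with x subtracted in degree e, are homogeneous of distinct
    degrees and sum to zero, so each of them vanishes. *)
Lemma aug_hcomp e (x : M) (v : 'rV[R]_(fr_rank F 0)) :
  gm_piece e x -> x = \sum_s v 0 s *: fr_aug s ->
  x = \sum_s hcomp (@fr_deg _ _ _ F 0) e v 0 s *: fr_aug s.
Proof.
move=> hx def_x; have [S0 [uniqS0 v0]] := hcomp_finite (@fr_deg _ _ _ F 0) v.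
pose S := if e \in S0 then S0 else e :: S0.
have Se : e \in S by rewrite /S; case: ifP; rewrite // inE eqxx.
have uniqS : uniq S by rewrite /S; case: ifPn => //= ->.
have vS j : j \notin S -> hcomp (@fr_deg _ _ _ F 0) j v = 0.
  rewrite /S; case: ifP => _ Sj; apply: v0 => //.
  by move: Sj; rewrite inE negb_or => /andP[].
pose y j := \sum_s hcomp (@fr_deg _ _ _ F 0) j v 0 s *: fr_aug s.
have hy j : gm_piece j (y j).
  apply: piece_sum => s _; rewrite -{1}[j](subrK (fr_deg s)).
  by apply: piece_scale; [apply: hrow_hcomp | apply: fr_aug_homog].
pose z j := y j - (if j == e then x else 0).
have hz j : gm_piece j (z j).
  by apply: gm_pieceB => //; case: eqP => [->|_] //; apply: gm_piece0.
have z0 : \sum_(j <- S) z j = 0.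
  rewrite sumrB [X in _ - X](bigD1_seq _ Se uniqS) /= eqxx.
  rewrite [X in _ - (_ + X)]big1 ?addr0 => [|j /negPf-> //].
  apply/eqP; rewrite subr_eq0 /y exchange_big /= def_x; apply/eqP.
  apply: eq_bigr => s _; rewrite -scaler_suml; congr (_ *: _).
  by rewrite [in RHS](hcomp_sum uniqS vS) summxE.
by have /eqP := gm_direct uniqS hz z0 Se; rewrite /z eqxx subr_eq0 => /eqP.
Qed.

Lemma aug_lift e (x : M) : gm_piece e x ->
  exists2 v, hrow (@fr_deg _ _ _ F 0) e v & x = \sum_s v 0 s *: fr_aug s.
Proof.
move=> hx; have [v def_x] := fr_aug_surj F x.
exists (hcomp (@fr_deg _ _ _ F 0) e v); first exact: hrow_hcomp.
exact: aug_hcomp.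
Qed.

(** Lift a vector v of degree j to M, write it through generators of degree 0 and lift these back to
    rows W of degree 0. The difference is a boundary, and in coordinates of degree j its constant
    term is v, because the entries of W there have degree -j and so no constant term. *)
Lemma tor_dim0_eq0 j : generated_in_degree M 0 -> j != 0 -> tor_dim F 0 j = 0%N.
Proof.
move=> gen nz_j; apply/(tor_homology 0 j).2 => v vj _.
pose x : M := \sum_s (v 0 s)%:MP *: fr_aug s.
have [m [g [f [hg def_x]]]] := gen x.
have [W hW def_g] := fin_all_exists2 (fun a => aug_lift (hg a)).
pose V := map_mx (@mpolyC n k) v - \sum_a f a *: W a.
have V0 : \sum_s V 0 s *: fr_aug s = 0.
  rewrite /V; under eq_bigr do rewrite !mxE scalerBl.
  rewrite sumrB -/x {1}def_x; apply/eqP; rewrite subr_eq0; apply/eqP.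
  under [RHS]eq_bigr do rewrite summxE scaler_suml.
  rewrite exchange_big; apply: eq_bigr => a _; rewrite def_g scaler_sumr.
  by apply: eq_bigr => s _; rewrite mxE scalerA.
have [w def_V] := (fr_exact0 V).1 V0.
exists (cst w); rewrite tor_diffE mulmxA -map_mxM /= -def_V.
apply/rowP=> s; rewrite mul_mx_mask.
have := congr1 (fun u : 'rV_(fr_rank F 0) => u 0 s) vj; rewrite mul_mx_mask => <-.
case: eqP => // deg_s; rewrite !mxE /= mcoeffB mcoeffC eqxx mulr1 summxE raddf_sum.
rewrite big1 ?subr0 // => a _; rewrite mxE /= rmorphM /=.
by rewrite (mcoeff0_homog (hW a s)) ?mulr0 // deg_s sub0r oppr_eq0.
Qed.

Definition homog_mx r r' (degr : 'I_r -> int) (degs : 'I_r' -> int) (B : 'M[R]_(r, r')) :=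
  forall a s, homog_int (degr a - degs s) (B a s).

Lemma homog_mxM r r' r'' (degr : 'I_r -> int) (degs : 'I_r' -> int) (degt : 'I_r'' -> int)
    B C : homog_mx degr degs B -> homog_mx degs degt C -> homog_mx degr degt (B *m C).
Proof.
move=> hB hC a t; rewrite mxE; apply: homog_int_sum => s _.
by have := homog_intM (hB a s) (hC s t); rewrite addrA subrK.
Qed.

Lemma homog_mxB r r' (degr : 'I_r -> int) (degs : 'I_r' -> int) B C :
  homog_mx degr degs B -> homog_mx degr degs C -> homog_mx degr degs (B - C).
Proof. by move=> hB hC a s; rewrite !mxE; apply: homog_intB. Qed.

Lemma homog_mx1 r (degr : 'I_r -> int) : homog_mx degr degr 1%:M.
Proof.
move=> a s; rewrite mxE; have [->|_] := eqVneq a s; last by left.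
by rewrite subrr; right; exists 0%N; rewrite ?dhomog1.
Qed.

Lemma cst_homog_mx r r' (degr : 'I_r -> int) (degs : 'I_r' -> int) B j :
  homog_mx degr degs B ->
  maskmx k (fun a => degr a == j) *m cst B = cst B *m maskmx k (fun s => degs s == j).
Proof.
move=> hB; apply/matrixP=> a s; rewrite mul_maskmx mul_mx_mask !mxE.
have [eq_deg|ne_deg] := eqVneq (degr a) (degs s); first by rewrite eq_deg.
by rewrite (mcoeff0_homog (hB a s)) ?subr_eq0 // !if_same.
Qed.

Lemma lift_rows i r (degr : 'I_r -> int) (B : 'M[R]_(r, fr_rank F i)) :
  homog_mx degr (@fr_deg _ _ _ F i) B ->
  (forall a, exists w, row a B = w *m d i) ->
  exists2 C, homog_mx degr (@fr_deg _ _ _ F i.+1) C & B = C *m d i.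
Proof.
move=> hB exB.
have ex a : exists2 w, hrow (@fr_deg _ _ _ F i.+1) (degr a) w & row a B = w *m d i.
  have [w def_w] := exB a; exists (hcomp (@fr_deg _ _ _ F i.+1) (degr a) w).
    exact: hrow_hcomp.
  rewrite -(hcomp_mul _ _ (@fr_diff_homog _ _ _ F i)) -def_w hcomp_id //.
  by move=> s; rewrite mxE; apply: hB.
have [W hW def_W] := fin_all_exists2 ex.
exists (\matrix_a W a); first by move=> a s; rewrite mxE; apply: hW.
by apply/row_matrixP=> a; rewrite row_mul rowK.
Qed.

Lemma lift_diff0 r (degr : 'I_r -> int) (B : 'M[R]_(r, fr_rank F 0)) :
  homog_mx degr (@fr_deg _ _ _ F 0) B ->
  (forall a, \sum_s B a s *: fr_aug s = 0) ->
  exists2 C, homog_mx degr (@fr_deg _ _ _ F 1) C & B = C *m d 0.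
Proof.
move=> hB B0; apply: lift_rows => // a; apply/fr_exact0.
by under eq_bigr do rewrite mxE.
Qed.

Lemma lift_diff i r (degr : 'I_r -> int) (B : 'M[R]_(r, fr_rank F i.+1)) :
  homog_mx degr (@fr_deg _ _ _ F i.+1) B -> B *m d i = 0 ->
  exists2 C, homog_mx degr (@fr_deg _ _ _ F i.+2) C & B = C *m d i.+1.
Proof.
move=> hB B0; apply: lift_rows => // a; apply/fr_exact.
by rewrite -row_mul B0 row0.
Qed.

End OneResolution.

Local Notation hommx F i F' i' := (homog_mx (@fr_deg _ _ _ F i) (@fr_deg _ _ _ F' i')).

Lemma aug_sum_mul (F : free_resolution M) r (u : 'rV[R]_r) (B : 'M[R]_(r, fr_rank F 0)) :
  \sum_s (u *m B) 0 s *: fr_aug s = \sum_a u 0 a *: (\sum_s B a s *: fr_aug s).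
Proof.
under eq_bigr do rewrite mxE scaler_suml.
rewrite exchange_big; apply: eq_bigr => a _; rewrite scaler_sumr.
by apply: eq_bigr => s _; rewrite scalerA.
Qed.

Lemma aug_mx (F F' : free_resolution M) :
  exists2 A : 'M[R]_(fr_rank F 0, fr_rank F' 0), hommx F 0%N F' 0%N A &
    forall s, fr_aug s = \sum_t A s t *: fr_aug t.
Proof.
have [W hW def_W] := fin_all_exists2 (fun s => aug_lift F' (@fr_aug_homog _ _ _ F s)).
exists (\matrix_s W s); first by move=> s t; rewrite mxE; apply: hW.
by move=> s; rewrite {1}def_W; apply: eq_bigr => t _; rewrite mxE.
Qed.

Section Comparison.
Variables F F' : free_resolution M.

(* Consecutive components of chain maps A : F -> F' and B : F' -> F, and of a
   homotopy H from A B to the identity of F. *)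
Definition homotopy_step i : Prop :=
  exists (A0 : 'M[R]_(fr_rank F i, fr_rank F' i)) (B0 : 'M[R]_(fr_rank F' i, fr_rank F i))
    (A1 : 'M[R]_(fr_rank F i.+1, fr_rank F' i.+1))
    (B1 : 'M[R]_(fr_rank F' i.+1, fr_rank F i.+1))
    (H0 : 'M[R]_(fr_rank F i, fr_rank F i.+1))
    (H1 : 'M[R]_(fr_rank F i.+1, fr_rank F i.+2)),
  [/\ [/\ hommx F i F' i A0, hommx F i.+1 F' i.+1 A1 & hommx F' i.+1 F i.+1 B1],
      A1 *m fr_diff F' i = fr_diff F i *m A0, B1 *m fr_diff F i = fr_diff F' i *m B0,
      hommx F i.+1 F i.+2 H1
    & A1 *m B1 - 1%:M - fr_diff F i *m H0 = H1 *m fr_diff F i.+1].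

(** The comparison theorem. Only a window of consecutive components is kept: it is all that the next
    step consumes, so no infinite choice of chain maps is made. *)
Lemma homotopy_stepP i : homotopy_step i.
Proof.
elim: i => [|i [A0 [B0 [A1 [B1 [H0 [H1 [[hA0 hA1 hB1] eqA eqB hH1 eqH]]]]]]]].
  have [A0 hA0 augA] := aug_mx F F'; have [B0 hB0 augB] := aug_mx F' F.
  have [A1 hA1 eqA] : exists2 A1, hommx F 1%N F' 1%N A1 &
      fr_diff F 0 *m A0 = A1 *m fr_diff F' 0.
    apply: lift_diff0; first by apply: homog_mxM hA0; apply: fr_diff_homog.
    move=> a; transitivity (\sum_s (row a (fr_diff F 0 *m A0)) 0 s *: fr_aug s).
      by apply: eq_bigr => s _; rewrite [row _ _ 0 s]mxE.
    rewrite row_mul aug_sum_mul.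
    under eq_bigr do rewrite -augA.
    by rewrite rowE; apply: fr_aug_diff.
  have [B1 hB1 eqB] : exists2 B1, hommx F' 1%N F 1%N B1 &
      fr_diff F' 0 *m B0 = B1 *m fr_diff F 0.
    apply: lift_diff0; first by apply: homog_mxM hB0; apply: fr_diff_homog.
    move=> a; transitivity (\sum_s (row a (fr_diff F' 0 *m B0)) 0 s *: fr_aug s).
      by apply: eq_bigr => s _; rewrite [row _ _ 0 s]mxE.
    rewrite row_mul aug_sum_mul.
    under eq_bigr do rewrite -augB.
    by rewrite rowE; apply: fr_aug_diff.
  have [H0 hH0 eqH0] : exists2 H0, hommx F 0%N F 1%N H0 & A0 *m B0 - 1%:M = H0 *m fr_diff F 0.
    apply: lift_diff0.
      by apply: homog_mxB; [apply: homog_mxM hB0 | apply: homog_mx1].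
    move=> a; under eq_bigr do rewrite !mxE scalerBl.
    rewrite sumrB (bigD1 a) //= [X in _ - X](bigD1 a) //= eqxx scale1r.
    rewrite [X in _ - (_ + X)]big1 => [|s /negPf ne_s]; last by rewrite eq_sym ne_s scale0r.
    rewrite addr0 -(bigD1 a (P := xpredT) (F := fun s => (\sum_j A0 a j * B0 j s) *: fr_aug s)) //=.
    apply/eqP; rewrite subr_eq0 augA; apply/eqP.
    under eq_bigr do rewrite scaler_suml.
    rewrite exchange_big; apply: eq_bigr => t _; rewrite augB scaler_sumr.
    by apply: eq_bigr => s _; rewrite scalerA.
  have [H1 hH1 eqH1] : exists2 H1, hommx F 1%N F 2%N H1 &
      A1 *m B1 - 1%:M - fr_diff F 0 *m H0 = H1 *m fr_diff F 1.
    apply: lift_diff.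
      apply: homog_mxB; first by apply: homog_mxB; [apply: homog_mxM hB1 | apply: homog_mx1].
      by apply: homog_mxM hH0; apply: fr_diff_homog.
    rewrite !mulmxBl mul1mx -mulmxA -eqB mulmxA -eqA -!mulmxA -eqH0.
    by rewrite mulmxBr mulmx1 subrr.
  by exists A0, B0, A1, B1, H0, H1; split.
have [A2 hA2 eqA2] : exists2 A2, hommx F i.+2 F' i.+2 A2 &
    fr_diff F i.+1 *m A1 = A2 *m fr_diff F' i.+1.
  apply: lift_diff; first by apply: homog_mxM hA1; apply: fr_diff_homog.
  by rewrite -mulmxA eqA mulmxA fr_diff_diff mul0mx.
have [B2 hB2 eqB2] : exists2 B2, hommx F' i.+2 F i.+2 B2 &
    fr_diff F' i.+1 *m B1 = B2 *m fr_diff F i.+1.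
  apply: lift_diff; first by apply: homog_mxM hB1; apply: fr_diff_homog.
  by rewrite -mulmxA eqB mulmxA fr_diff_diff mul0mx.
have [H2 hH2 eqH2] : exists2 H2, hommx F i.+2 F i.+3 H2 &
    A2 *m B2 - 1%:M - fr_diff F i.+1 *m H1 = H2 *m fr_diff F i.+2.
  apply: lift_diff.
    apply: homog_mxB; first by apply: homog_mxB; [apply: homog_mxM hB2 | apply: homog_mx1].
    by apply: homog_mxM hH1; apply: fr_diff_homog.
  rewrite !mulmxBl mul1mx -mulmxA -eqB2 mulmxA -eqA2 -!mulmxA -eqH.
  rewrite !mulmxBr mulmx1 [fr_diff F i.+1 *m (fr_diff F i *m _)]mulmxA.
  by rewrite fr_diff_diff mul0mx subr0 subrr.
by exists A1, B1, A2, B2, H1, H2; split.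
Qed.

(** Push a cycle to the other resolution, where it bounds, and pull it back; the homotopy accounts
    for the difference. Vanishing is all that is wanted in order to compare levelness with a given
    Betti diagram. *)
Lemma tor_dim_eq0_transfer i j : tor_dim F' i.+1 j = 0%N -> tor_dim F i.+1 j = 0%N.
Proof.
move/(tor_homology F' i.+1 j).2 => exact'; apply/(tor_homology F i.+1 j).2 => v vj v0.
have [A0 [B0 [A1 [B1 [H0 [H1 [[hA0 hA1 hB1] eqA eqB hH1 eqH]]]]]]] := homotopy_stepP i.
have [B2 _ eqB2] : exists2 B2, hommx F' i.+2 F i.+2 B2 &
    fr_diff F' i.+1 *m B1 = B2 *m fr_diff F i.+1.
  apply: lift_diff; first by apply: homog_mxM hB1; apply: fr_diff_homog.
  by rewrite -mulmxA eqB mulmxA fr_diff_diff mul0mx.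
have vd : v *m cst (fr_diff F i) = 0.
  by rewrite -vj -mulmxA -tor_diffE'.
have [||u def_u] := exact' (v *m cst A1).
- by rewrite -{2}vj -!mulmxA (cst_homog_mx j hA1).
- by rewrite /= tor_diffE mulmxA -(mulmxA v) -map_mxM eqA map_mxM mulmxA vd !mul0mx.
(* Modulo the variables, the homotopy gives v = v A1 B1 - v H1 d for a cycle v, and v A1 = u d'
   turns the first term into u B2 d. *)
pose w := u *m degmask F' i.+2 j *m cst B2 - v *m cst H1.
exists w; rewrite tor_diffE mulmxA -{1}vj; congr (_ *m _).
have := congr1 (fun E => v *m cst E) eqH.
rewrite /= !map_mxB !map_mxM map_mx1 !mulmxBr mulmx1 !mulmxA vd mul0mx subr0 def_u.
rewrite tor_diffE' mulmxA -(mulmxA _ _ (cst B1)) -map_mxM eqB2 map_mxM mulmxA => eq_v.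
by rewrite /w mulmxBl -eq_v opprB addrC subrK.
Qed.

End Comparison.
End Tor.

(** * Betti numbers of an extended module *)

Section LabelledTor.
Variables (k : fieldType) (p q : nat) (D : graded_ops k) (T : finType).
Local Notation N := (go_dim D).
Local Notation X := (go_X D).
Local Notation deg := (@go_deg k D).
Variable lab : 'I_N -> T.
Hypothesis lab_X : forall l s t, X l s t != 0 -> lab s = lab t.
Local Notation F := (ext_resolution p q D).

Definition kmask i (j : int) (a : T) : pred 'I_(krank N p i) :=
  fun s => (kdeg s == j) && (lab (kbase s) == a).

Lemma kdiff_lab i s t : kdiff X p i s t != 0 ->
  lab (kbase s) = lab (kbase t) /\ @kdeg k p D i.+1 s = kdeg t.
Proof.
move: s t; apply: (@kdiff_entry _ _ (fun s t a => a != 0 ->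
   lab s = lab t /\ (deg s + i.+1)%:Z = (deg t + i)%:Z)).
- by move=> s t; rewrite eqxx.
- by move=> s t a; rewrite oppr_eq0.
move=> l s t _ nz; split; first exact: lab_X nz.
by rewrite (go_graded nz) addnS addSn.
Qed.

Definition kpart i j a : 'M[k]_(krank N p i.+1, krank N p i) :=
  maskmx k (kmask (i := i.+1) j a) *m kdiff X p i.

Lemma kpartE i j a : kpart i j a = kdiff X p i *m maskmx k (kmask j a).
Proof.
apply/matrixP=> s t; rewrite mul_maskmx mul_mx_mask.
have [->|/kdiff_lab[eq_lab eq_deg]] := eqVneq (kdiff X p i s t) 0.
  by rewrite !if_same.
by rewrite /kmask eq_lab eq_deg.
Qed.

Lemma maskmx_id n (P : pred 'I_n) : maskmx k P *m maskmx k P = maskmx k P.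
Proof. by apply/matrixP=> s t; rewrite mul_maskmx maskmxE; case: (P s). Qed.

Lemma kpart_kpart i j a : kpart i.+1 j a *m kpart i j a = 0.
Proof.
rewrite kpartE /kpart -mulmxA (mulmxA (maskmx _ _)) maskmx_id -/(kpart i j a) kpartE.
by rewrite mulmxA kdiff_kdiff ?mul0mx // => l l' _ _; apply: go_comm.
Qed.

Definition kpart_in i j a : 'M[k]_(krank N p i, if i is i'.+1 then krank N p i' else 0%N) :=
  match i with 0 => 0 | i'.+1 => kpart i' j a end.

(** Graded Betti numbers of the direct summand with label [a]: the operators preserve labels, so the
    complex splits along them. *)
Definition lab_betti (a : T) i j : nat :=
  (#|kmask (i := i) j a| - \rank (kpart_in i j a) - \rank (kpart i j a))%N.

Lemma lab_betti_homology a i j :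
  (\rank (kpart_in i j a) + \rank (kpart i j a) <= #|kmask (i := i) j a|)%N /\
  (lab_betti a i j = 0%N <-> forall v : 'rV[k]_(krank N p i),
     v *m maskmx k (kmask j a) = v -> v *m kpart_in i j a = 0 ->
     exists u, v = u *m kpart i j a).
Proof.
apply: homology_dim; first by rewrite kpartE -mulmxA maskmx_id.
  by case: i => [|i]; rewrite ?mulmx0 //= /kpart mulmxA maskmx_id.
by case: i => [|i] /=; rewrite ?mulmx0 ?kpart_kpart.
Qed.

Lemma lab_betti_eq0 a i j :
  (forall v : 'rV[k]_(krank N p i),
     ksupp (fun s => (deg s + i == j :> int) && (lab s == a)) v ->
     kclosed X v -> exists u, v = u *m kdiff X p i) ->
  lab_betti a i j = 0%N.
Proof.
move=> exact; apply/(lab_betti_homology a i j).2 => v vP v_in.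
have Qv : ksupp (fun s => (deg s + i == j :> int) && (lab s == a)) v.
  by move=> s; rewrite -vP mul_mx_mask; case: ifP => //; rewrite eqxx.
have [|u def_v] := exact v Qv.
  by case: i v vP v_in {exact Qv} => //= i v vP; rewrite /kpart mulmxA vP.
by exists u; rewrite kpartE mulmxA -def_v.
Qed.

Lemma ext_tor_diffE i j :
  tor_diff F i j = maskmx k (fun s => @kdeg k p D i.+1 s == j) *m kdiff X p i.
Proof.
apply/matrixP=> s t; rewrite ext_tor_diff mul_maskmx.
have [->|/kdiff_lab[_ <-]] := eqVneq (kdiff X p i s t) 0; first by rewrite !if_same.
by rewrite andbb.
Qed.

Lemma rank_tor_diff i j : \rank (tor_diff F i j) = (\sum_a \rank (kpart i j a))%N.
Proof.
rewrite (rank_label (rl := fun s => lab (kbase s)) (cl := fun s => lab (kbase s))) => [|s t].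
  apply: eq_bigr => a _; congr (\rank _); rewrite ext_tor_diffE.
  apply/matrixP=> s t; rewrite !mul_maskmx /kmask.
  by case: (_ == a); case: (_ == j).
by rewrite ext_tor_diff; case: ifP => [_ /kdiff_lab[]|]; rewrite ?eqxx.
Qed.

Lemma ext_betti_sum i j : tor_dim F i j = (\sum_a lab_betti a i j)%N.
Proof.
have card_sum : #|[pred s : 'I_(krank N p i) | kdeg s == j]|
    = (\sum_a #|kmask (i := i) j a|)%N.
  rewrite -sum1_card (partition_big (fun s => lab (kbase s)) xpredT) //=.
  by apply: eq_bigr => a _; rewrite -sum1_card; apply: eq_bigl.
have in_sum : \rank (tor_in F i j) = (\sum_a \rank (kpart_in i j a))%N.
  case: i {card_sum} => [|i] /=; last exact: rank_tor_diff.
  by rewrite mxrank0 big1 // => a _; rewrite mxrank0.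
rewrite tor_dimE rank_tor_diff in_sum [X in (X - _ - _)%N]card_sum /lab_betti.
have le a : (\rank (kpart_in i j a) + \rank (kpart i j a) <= #|kmask (i := i) j a|)%N.
  by case: (lab_betti_homology a i j).
rewrite -subnDA -big_split /= -sumnB; last by move=> a _; apply: le.
by apply: eq_bigr => a _; rewrite subnDA.
Qed.

Lemma card_split_ord m m' (P : pred 'I_(m + m')) :
  #|P| = (#|[pred s | P (lshift m' s)]| + #|[pred s | P (rshift m s)]|)%N.
Proof.
by rewrite -!sum1_card [LHS]big_mkcond big_split_ord /= -!big_mkcond.
Qed.

End LabelledTor.

Section EulerCharacteristic.
Variables (k : fieldType) (D : graded_ops k) (T : finType).
Local Notation N := (go_dim D).
Local Notation deg := (@go_deg k D).
Variables (lab : 'I_N -> T) (a : T).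

(** The Hilbert function of the finite-dimensional summand with label [a]; as the remaining q
    variables act freely, it is the h-vector of the extended summand. *)
Definition hilbert (j : int) : int := #|[pred s : 'I_N | ((deg s)%:Z == j) && (lab s == a)]|%:Z.

Definition kcount p i j : int := #|kmask (D := D) lab (p := p) (i := i) j a|%:Z.

Lemma kcountSS p i j : kcount p.+1 i.+1 j = kcount p i.+1 j + kcount p i (j - 1).
Proof.
rewrite /kcount (@card_split_ord (krank N p i.+1) (krank N p i)) PoszD.
congr (_%:Z + _%:Z); apply: eq_card => s; rewrite !inE /kmask /kdeg.
  by rewrite (kbase_lshift s).
by rewrite (kbase_rshift s); congr (_ && _); apply/eqP/eqP; lia.
Qed.

(** By the cone recursion, one more operator multiplies the alternating sum by 1 - t. The upper
    limit [m] is left free because both p and p + q are used; terms beyond p are empty. *)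
Lemma kcount_alt p m j : (p <= m)%N ->
  alt_sum m (kcount p) j = iter p (@mul_1subt int) hilbert j.
Proof.
elim: p m j => [|p IH] m j le_pm.
  rewrite /alt_sum big_ord_recl big1 ?addr0 => [|i _].
    rewrite mul1r /kcount /hilbert; congr (_%:Z); apply: eq_card => s.
    by rewrite !unfold_in /kmask /kdeg addn0.
  by rewrite /kcount (eq_card0 (A := kmask _ _ _)) ?mulr0 // => -[].
case: m le_pm => // m le_pm; rewrite iterS {1}/mul_1subt.
rewrite -(IH m.+1 j (leqW le_pm)) -(IH m (j - 1) le_pm).
rewrite /alt_sum big_ord_recl [in RHS]big_ord_recl -addrA; congr (_ + _).
rewrite -sumrB; apply: eq_bigr => i _.
by rewrite lift0 kcountSS exprS; ring.
Qed.

End EulerCharacteristic.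

Section PureSum.
Variables (k : fieldType) (p q : nat) (D : graded_ops k) (T : finType).
Local Notation N := (go_dim D).
Local Notation X := (go_X D).
Local Notation deg := (@go_deg k D).
Variable lab : 'I_N -> T.
Hypothesis lab_X : forall l s t, X l s t != 0 -> lab s = lab t.
Local Notation F := (ext_resolution p q D).
Local Notation M := (ext_gmodule p q D).
Local Notation lbetti := (@lab_betti k p D T lab).

Lemma lab_betti_gt a i j : (p < i)%N -> lbetti a i j = 0%N.
Proof.
move=> lt_pi; apply/eqP; rewrite /lab_betti -leqn0.
rewrite (leq_trans (leq_subr _ _)) // (leq_trans (leq_subr _ _)) //.
by rewrite (leq_trans (max_card _)) // card_ord krank_gt.
Qed.

(** The Euler characteristic: in the alternating sum the ranks of the differentials telescope,
    leaving the sizes of the terms. *)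
Lemma lab_betti_alt a m j : (p <= m)%N ->
  alt_sum m (fun i l => (lbetti a i l)%:Z) j = iter p (@mul_1subt int) (hilbert lab a) j.
Proof.
move=> le_pm; rewrite -(kcount_alt lab a j le_pm).
pose rk i := \rank (kpart p lab i j a).
have lbettiE i : (lbetti a i j)%:Z =
    kcount lab a p i j - (if i is i'.+1 then (rk i')%:Z else 0) - (rk i)%:Z.
  have [le_rk _] := lab_betti_homology p lab_X a i j.
  rewrite /lab_betti /kcount -subnDA -subzn // PoszD opprD addrA; congr (_ - _ - _).
  by case: i {le_rk} => [|i] //=; rewrite mxrank0.
have tele n : \sum_(i < n.+1) (-1) ^+ i * (lbetti a i j)%:Z
    = \sum_(i < n.+1) (-1) ^+ i * kcount lab a p i j - (-1) ^+ n * (rk n)%:Z.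
  elim: n => [|n IH]; first by rewrite !big_ord1 lbettiE; ring.
  rewrite big_ord_recr [in RHS]big_ord_recr /= IH lbettiE exprS.
  by ring.
rewrite /alt_sum tele [rk m](_ : _ = 0%N) ?mulr0 ?subr0 //.
apply/eqP; rewrite -leqn0 (leq_trans (rank_leq_row _)) //.
by rewrite krank_gt.
Qed.

Lemma hilbert_fin_supp a : fin_supp (hilbert lab a).
Proof.
exists [seq (deg s)%:Z | s : 'I_N] => j nj; rewrite /hilbert.
rewrite (eq_card0 (A := [pred s | _])) // => s; rewrite inE; case: eqP => // def_j.
by case/negP: nj; apply/mapP; exists s; rewrite ?mem_enum.
Qed.

Variables (mm : T -> nat) (c : nat).
Hypothesis p_gt1 : (1 < p)%N.
Hypothesis le_mc : forall a, (mm a <= c)%N.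

Definition pure_type (m i : nat) : int :=
  if i == 0%N then 0 else if i == p then (c + p)%:Z else (m + i)%:Z.

Hypothesis lbetti_pure : forall a i j, (i <= p)%N -> j != pure_type (mm a) i -> lbetti a i j = 0%N.
Hypothesis lbetti0 : forall a, (0 < lbetti a 0 0)%N.

Definition pure_tuple (m : nat) : p.+1.-tuple int := [tuple pure_type m i | i < p.+1].

Lemma pure_tupleE m i : (i <= p)%N -> (pure_tuple m)`_i = pure_type m i.
Proof. by move=> le_ip; rewrite -(tnth_nth 0 _ (Ordinal (le_ip : (i < p.+1)%N))) tnth_mktuple. Qed.

Lemma pure_tuple_sorted m : (m <= c)%N -> sorted <%R (pure_tuple m).
Proof.
move=> le_m; apply/(sortedP 0) => i; rewrite size_tuple ltnS => lt_ip.
rewrite !pure_tupleE ?(ltnW lt_ip) // /pure_type /= (ltn_eqF lt_ip).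
by case: ifP => [/eqP i0|_]; case: ifP => /eqP Hp; rewrite ltz_nat; lia.
Qed.

Lemma lab_betti_pure_diagram a :
  is_pure_diagram (pure_tuple (mm a)) (fun i j => (lbetti a i j)%:R / (lbetti a 0 0)%:R).
Proof.
have nz0 : (lbetti a 0 0)%:R != 0 :> rat by rewrite pnatr_eq0 -lt0n.
have zero i j : j != (pure_tuple (mm a))`_i -> (lbetti a i j)%:R / (lbetti a 0 0)%:R = 0 :> rat.
  have [le_ip|lt_pi] := leqP i p; last by rewrite lab_betti_gt // mul0r.
  by rewrite pure_tupleE // => ne; rewrite lbetti_pure // mul0r.
split=> //; last by rewrite pure_tupleE // divff.
split.
- exists (pure_tuple (mm a)) => i j nj; have [le_ip|lt_pi] := leqP i p.
    by rewrite zero //; apply: contraNneq nj => ->; rewrite mem_nth // size_tuple.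
  by rewrite lab_betti_gt // mul0r.
- by move=> i j lt_pi; rewrite lab_betti_gt // mul0r.
have [S S0] := hilbert_fin_supp a.
exists (fun j => (hilbert lab a j)%:~R / (lbetti a 0 0)%:R).
  by exists S => j /S0->; rewrite mul0r.
move=> j; rewrite /alt_sum; under eq_bigr do rewrite mulrA.
rewrite -mulr_suml.
have -> : \sum_(i < p.+1) (-1) ^+ i * (lbetti a i j)%:R
    = (alt_sum p (fun i l => (lbetti a i l)%:Z) j)%:~R :> rat.
  rewrite /alt_sum rmorph_sum; apply: eq_bigr => i _.
  by rewrite rmorphM rmorphXn /= rmorphN1 -pmulrn.
rewrite lab_betti_alt //; move: (_%:R^-1) => z.
elim: (p) j => // p' IH j; rewrite !iterS /mul_1subt !IH.
by rewrite rmorphB /= mulrBl.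
Qed.

Lemma ext_pure_combination : pure_combination p (fun i j => (tor_dim F i j)%:R).
Proof.
exists #|T|, (fun l => (lbetti (enum_val l) 0 0)%:R),
  (fun l => pure_tuple (mm (enum_val l))),
  (fun l i j => (lbetti (enum_val l) i j)%:R / (lbetti (enum_val l) 0 0)%:R).
split=> [l|l|l|i j]; [exact: ler0n | exact: pure_tuple_sorted | exact: lab_betti_pure_diagram |].
rewrite (ext_betti_sum p q lab_X) natr_sum (reindex _ (onW_bij _ (@enum_val_bij T))) /=.
apply: eq_bigr => l _; rewrite mulrC divfK // pnatr_eq0 -lt0n //.
Qed.

Lemma ext_hvector : is_hvector (p + q) p (tor_dim F) (fun j => \sum_a hilbert lab a j).
Proof.
split.
  have [S S0] := fin_all_exists (fun a => hilbert_fin_supp a).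
  exists (flatten [seq S a | a : T]) => j nj; rewrite big1 // => a _; apply: S0.
  by apply: contra nj => Sj; apply/flattenP; exists (S a) => //; apply/mapP; exists a;
    rewrite ?mem_enum.
move=> j; rewrite /alt_sum.
transitivity (\sum_a iter p (@mul_1subt int) (hilbert lab a) j).
  elim: (p) j => // p' IH j; rewrite !iterS /mul_1subt !IH -sumrB.
  by apply: eq_bigr.
under [RHS]eq_bigr do rewrite (ext_betti_sum p q lab_X) (big_morph Posz PoszD (erefl
  (0 : int))) mulr_sumr.
rewrite [RHS]exchange_big; apply: eq_bigr => a _ /=.
by rewrite -(@lab_betti_alt a (p + q)) ?leq_addr.
Qed.

End PureSum.

(** * Generation in degree zero and levelness *)

Section Generation.
Variables (k : fieldType) (p q : nat) (D : graded_ops k).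
Local Notation N := (go_dim D).
Local Notation X := (go_X D).
Local Notation deg := (@go_deg k D).
Local Notation F := (ext_resolution p q D).
Local Notation M := (ext_gmodule p q D).
Local Notation basis := (@ext_basis k p q D).

Definition gens (x : M) : Prop :=
  exists (m : nat) (g : 'I_m -> M) (f : 'I_m -> {mpoly k[p + q]}),
    (forall a, gm_piece 0 (g a)) /\ x = \sum_(a < m) f a *: g a.

Lemma gens0 : gens 0.
Proof. by exists 0%N, (fun=> 0), (fun=> 0); split=> [[]|]; rewrite ?big_ord0. Qed.

Lemma gensD x y : gens x -> gens y -> gens (x + y).
Proof.
move=> [m1 [g1 [f1 [hg1 ->]]]] [m2 [g2 [f2 [hg2 ->]]]].
exists (m1 + m2)%N, (fun i => match split i with inl j => g1 j | inr j => g2 j end),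
  (fun i => match split i with inl j => f1 j | inr j => f2 j end); split.
  by move=> a; case: (split a).
rewrite big_split_ord; congr (_ + _); apply: eq_bigr => j _.
  by rewrite (unsplitK (inl j)).
by rewrite (unsplitK (inr j)).
Qed.

Lemma gensZ f x : gens x -> gens (f *: x).
Proof.
move=> [m [g [h [hg ->]]]]; exists m, g, (fun a => f * h a); split=> //.
by rewrite scaler_sumr; apply: eq_bigr => a _; rewrite scalerA.
Qed.

Lemma gens_sum (I : Type) (r : seq I) (P : pred I) (G : I -> M) :
  (forall i, P i -> gens (G i)) -> gens (\sum_(i <- r | P i) G i).
Proof. by move=> hG; elim/big_rec: _ => [|i x /hG]; [apply: gens0 | apply: gensD]. Qed.

(** Induction on the degree of a basis vector: if that degree is positive, vanishing of Tor_0 writes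
    the vector as a sum of x_l times combinations of basis vectors of one degree less. *)
Lemma ext_generated0 :
  (forall j, j != 0 -> tor_dim F 0 j = 0%N) -> generated_in_degree M 0.
Proof.
move=> tor0; suff gen_basis s : gens (basis s).
  move=> x; suff : gens x by [].
  by rewrite [x](@ext_sum_basis k p q D); apply: gens_sum => s _; apply: gensZ.
have [e] := ubnP (deg s); elim: e s => // e IH s; rewrite ltnS => le_e.
have [deg0|nz_deg] := eqVneq (deg s) 0%N.
  exists 1%N, (fun=> basis s), (fun=> 1); split; last by rewrite big_ord1 scale1r.
  move=> _; have := ext_basis_homog q (p := p) s.
  by rewrite /kdeg /= deg0.
have [_ [exact _]] := tor_homology F 0 (deg s)%:Z.
have [u] : exists u : 'rV[k]_(fr_rank F 1),
  (delta_mx 0 s : 'rV[k]_(fr_rank F 0)) = u *m tor_diff F 0 (deg s)%:Z.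
  have tor0s : tor_dim F 0 (deg s)%:Z = 0%N by apply: tor0; rewrite eqz_nat.
  apply: (exact tor0s (delta_mx 0 s)); last exact: mulmx0.
  apply/rowP=> t; rewrite mul_mx_mask !mxE eqxx /=; case: eqP => // ne.
  by case: eqP => // eq_ts; case: ne; rewrite eq_ts /= /kdeg /= addn0.
rewrite (ext_tor_diffE p q (lab := fun=> tt)) // mulmxA => def_s.
have [|w Qw def_w] := (kdiff0_im_supp (fun t => (deg t).+1 == deg s) X p (delta_mx 0 s)).1.
  exists (u *m maskmx k (fun r => @kdeg k p D 1 r == (deg s)%:Z)) => //.
  by move=> r; rewrite mul_mx_mask /kdeg addn1 eqz_nat; case: ifP => //; rewrite eqxx.
have -> : basis s = \sum_(l < p) 'X_(lshift q l) *: \sum_t (w l 0 t)%:MP *: basis t.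
  rewrite /ext_basis -[delta_mx 0 s](map_delta_mx (@mpolyC q k)) def_w.
  rewrite raddf_sum /=; apply: eq_bigr => l _.
  rewrite map_mxM ext_scaleE actmx_lshift; congr (_ *m _).
  rewrite [LHS]row_sum_delta; apply: eq_bigr => t _.
  by rewrite ext_scaleE actmxC mul_mx_scalar mxE.
apply: gens_sum => l _; apply: gensZ; apply: gens_sum => t _.
have [->|nz] := eqVneq (w l 0 t) 0; first by rewrite mpolyC0 scale0r; apply: gens0.
by apply: gensZ; apply: IH; have /eqP := Qw l t nz; rewrite /=; lia.
Qed.

End Generation.

Section Level.
Variables (k : fieldType) (p q : nat) (D : graded_ops k) (T : finType).
Variable lab : 'I_(go_dim D) -> T.
Hypothesis lab_X : forall l s t, go_X D l s t != 0 -> lab s = lab t.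
Local Notation F := (ext_resolution p q D).
Local Notation M := (ext_gmodule p q D).
Local Notation lbetti := (@lab_betti k p D T lab).
Variables (mm : T -> nat) (c : nat) (a0 : T).
Hypothesis p_gt1 : (1 < p)%N.
Hypothesis lbetti_pure : forall a i j, (i <= p)%N -> j != pure_type p c (mm a) i ->
  lbetti a i j = 0%N.
Hypothesis lbetti0 : forall a, (0 < lbetti a 0 0)%N.
Hypothesis lbettip : forall a, (0 < lbetti a p (c + p)%:Z)%N.

Lemma ext_betti0 j : j != 0 -> tor_dim F 0 j = 0%N.
Proof.
by move=> nz_j; rewrite (ext_betti_sum p q lab_X) big1 // => a _; apply: lbetti_pure.
Qed.

Lemma ext_level : level M p.
Proof.
have dim_gt0 : (0 < go_dim D)%N.
  rewrite lt0n; apply: contraTneq (lbetti0 a0) => dim0; rewrite -leqNgt.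
  rewrite /lab_betti (leq_trans (leq_subr _ _)) // (leq_trans (leq_subr _ _)) //.
  by rewrite (leq_trans (max_card _)) // card_ord dim0.
split; [exact: ext_codim | exact: ext_cohen_macaulay |].
exists (tor_dim F); first by exists F.
have sum_gt0 i j : (0 < lbetti a0 i j)%N -> tor_dim F i j <> 0%N.
  by move=> gt0; rewrite (ext_betti_sum p q lab_X) (bigD1 a0) //=; lia.
split.
  exists 0; split; first exact: sum_gt0.
  by move=> j nz; apply/esym/eqP; apply: contra_notT nz => /ext_betti0.
exists (c + p)%:Z; split; first exact: sum_gt0.
move=> j nz; apply/esym/eqP; apply: contra_notT nz => ne_j.
rewrite (ext_betti_sum p q lab_X) big1 // => a _; apply: lbetti_pure => //.
rewrite /pure_type eqxx (gtn_eqF (ltnW p_gt1)). exact: ne_j.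
Qed.

End Level.

(** * Numerics of the three-term determinants *)

(** The determinant expanded along its first row, for an arbitrary function [u] in that row, so that
    linearity in [u] is at hand. *)
Definition wron (p c : nat) (u : int -> rat) (i : int) : rat :=
  let r := rcoef p in
  u (i - 1) * (r i * r (c%:Z - i - 1) - r (i + 1) * r (c%:Z - i))
  - u i * (r (i - 1) * r (c%:Z - i - 1) - r (i + 1) * r (c%:Z - i + 1))
  + u (i + 1) * (r (i - 1) * r (c%:Z - i) - r i * r (c%:Z - i + 1)).

Lemma det_mx3 (A : 'M[rat]_3) : let a i j := A (inord i) (inord j) in
  \det A = a 0%N 0%N * (a 1%N 1%N * a 2%N 2%N - a 1%N 2%N * a 2%N 1%N)
         - a 0%N 1%N * (a 1%N 0%N * a 2%N 2%N - a 1%N 2%N * a 2%N 0%N)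
         + a 0%N 2%N * (a 1%N 0%N * a 2%N 1%N - a 1%N 1%N * a 2%N 0%N).
Proof.
move=> a; have aE i j : A i j = a (val i) (val j) by rewrite /a !inord_val.
rewrite (expand_det_row _ ord0) !big_ord_recl big_ord0 /cofactor.
rewrite !(expand_det_row _ ord0) !big_ord_recl !big_ord0 /cofactor !det_mx11 !mxE !aE /=.
by rewrite /bump /=; ring.
Qed.

Lemma det_hmatrix p c h i : \det (hmatrix p c h i) = wron p c (hcoef h) i.
Proof. by rewrite det_mx3 /= !mxE !inordK. Qed.

Lemma wron_ext p c u v i : u =1 v -> wron p c u i = wron p c v i.
Proof. by move=> eq_uv; rewrite /wron !eq_uv. Qed.

Lemma wron_sum p c (I : Type) (s : seq I) (P : pred I) (a : I -> rat) (u : I -> int -> rat) i :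
  wron p c (fun j => \sum_(l <- s | P l) a l * u l j) i
  = \sum_(l <- s | P l) a l * wron p c (u l) i.
Proof.
rewrite /wron /= !mulr_suml -sumrB -big_split; apply: eq_bigr => l _ /=.
by ring.
Qed.

Lemma wronZ p c a u i : wron p c (fun j => a * u j) i = a * wron p c u i.
Proof. by rewrite /wron; ring. Qed.

Section Coefficients.
Variable p : nat.
Hypothesis p_gt1 : (1 < p)%N.
Local Notation r := (rcoef p).

Lemma rcoef_lt0 j : j < 0 -> r j = 0.
Proof. by case: j. Qed.

Lemma rcoef_gt0 j : 0 <= j -> 0 < r j.
Proof. by case: j => // m _; rewrite /= ltr0n bin_gt0 leq_addr. Qed.

Lemma rcoef_ge0 j : 0 <= r j.
Proof. by case: (ltP j 0) => [/rcoef_lt0-> //|/rcoef_gt0/ltW]. Qed.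

Lemma rcoef_lt j : 0 <= j -> r (j - 1) < r j.
Proof.
case: j => // -[|m] _.
  by rewrite sub0r rcoef_lt0 // rcoef_gt0.
rewrite -(_ : m%:Z = m.+1%:Z - 1); last by lia.
rewrite /= ltr_nat; case: (p) p_gt1 => // -[|p'] // _ /=.
rewrite addnS binS -[X in (X < _)%N]addn0 ltn_add2l bin_gt0.
by rewrite addSn ltnW // ltnS leq_addr.
Qed.

Variable c : nat.

Lemma minor_lt0 (i : int) : 0 <= i -> i <= c%:Z + 1 ->
  r (i - 1) * r (c%:Z - i) - r i * r (c%:Z - i + 1) < 0.
Proof.
move=> i_ge0 i_le; rewrite subr_lt0.
have lt1 := rcoef_lt i_ge0.
have : 0 <= c%:Z - i + 1 by lia.
move=> /rcoef_lt; rewrite addrK => lt2.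
by apply: ltr_pM => //; apply: rcoef_ge0.
Qed.

(* Two proportional pieces glued at m; these are the h-vectors of the pure
   diagrams of type (0, m+1, ..., m+p-1, c+p). *)
Definition hat (m : nat) (j : int) : rat :=
  if j <= m%:Z then r (c%:Z - m%:Z) * r j else r m%:Z * r (c%:Z - j).

Section Glued.
Variables (u : int -> rat) (A B : rat) (m : nat).
Hypotheses (le_mc : (m <= c)%N) (A_gt0 : 0 < A).
Hypothesis uA : forall j, j <= m%:Z -> u j = A * r j.
Hypothesis uB : forall j, m%:Z <= j -> u j = B * r (c%:Z - j).

(** Away from m the first row lies in a single piece: it is a multiple of the second row for i < m
    and of the third row for i > m. *)
Lemma wron_glued_neq i : i != m%:Z -> wron p c u i = 0.
Proof.
rewrite neq_lt => /orP[lt_im|lt_mi]; rewrite /wron /=.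
  by rewrite !uA; [ring | lia..].
rewrite !uB; try lia.
rewrite (_ : c%:Z - (i - 1) = c%:Z - i + 1); last by lia.
rewrite (_ : c%:Z - (i + 1) = c%:Z - i - 1); last by lia.
by ring.
Qed.

Lemma wron_glued_eq : 0 < wron p c u m%:Z.
Proof.
have eqAB : A * r m%:Z = B * r (c%:Z - m%:Z) by rewrite -uA -?uB.
(* Subtracting A times the second row leaves only the last entry of the first row. It is negative,
   since B r(c-m-1) < B r(c-m) = A r(m) < A r(m+1), and so is the complementary minor. *)
have -> : wron p c u m%:Z = (B * r (c%:Z - m%:Z - 1) - A * r (m%:Z + 1)) *
    (r (m%:Z - 1) * r (c%:Z - m%:Z) - r m%:Z * r (c%:Z - m%:Z + 1)).
  rewrite /wron /= (uA (lexx _)) (@uA (m%:Z - 1)) ?(@uB (m%:Z + 1)); try lia.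
  rewrite (_ : c%:Z - (m%:Z + 1) = c%:Z - m%:Z - 1); last by lia.
  by ring.
rewrite nmulr_lgt0; last by apply: minor_lt0; lia.
have m_ge0 : 0 <= m%:Z + 1 by lia.
have lt1 := rcoef_lt m_ge0; rewrite addrK in lt1.
have cm_ge0 : 0 <= c%:Z - m%:Z by lia.
have lt2 := rcoef_lt cm_ge0.
have r1 : 0 < r m%:Z by apply: rcoef_gt0.
have r2 := rcoef_gt0 cm_ge0.
have B_gt0 : 0 < B by rewrite -(pmulr_lgt0 _ r2) -eqAB mulr_gt0.
rewrite subr_lt0; apply: (@lt_trans _ _ (A * r m%:Z)).
  by rewrite eqAB ltr_pM2l.
by rewrite ltr_pM2l.
Qed.

Lemma wron_glued_ge0 i : 0 <= wron p c u i.
Proof.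
have [->|ne] := eqVneq i m%:Z; first exact/ltW/wron_glued_eq.
by rewrite wron_glued_neq.
Qed.

End Glued.

Lemma hat_glued_l m j : j <= m%:Z -> hat m j = r (c%:Z - m%:Z) * r j.
Proof. by rewrite /hat => ->. Qed.

Lemma hat_glued_r m j : m%:Z <= j -> hat m j = r m%:Z * r (c%:Z - j).
Proof.
rewrite /hat le_eqVlt => /orP[/eqP<-|]; first by rewrite lexx mulrC.
by move=> lt; rewrite leNgt lt.
Qed.

(** The coefficient of v(i+1) in the i-th determinant is a nonzero minor, so the vanishing is a
    recursion that determines v from v(0). The function r solves it, having two equal rows; hence v
    = v(0) r up to index c + 1, where v vanishes and r does not. *)
Lemma wron_inj (v : int -> rat) :
  (forall j, j < 0 -> v j = 0) -> (forall j, c%:Z < j -> v j = 0) ->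
  (forall i : nat, (i <= c)%N -> wron p c v i%:Z = 0) -> forall j, v j = 0.
Proof.
move=> vneg vpos wv0.
have vE n : (n <= c.+1)%N -> v n%:Z = v 0 * r n%:Z /\ v (n%:Z - 1) = v 0 * r (n%:Z - 1).
  elim: n => [_|n IH lt_nc].
    split; first by rewrite /= addn0 binn mulr1.
    by rewrite vneg // rcoef_lt0 // mulr0.
  have [vn vn1] := IH (ltnW lt_nc); rewrite -addn1 PoszD addrK; split=> //.
  have := wv0 n lt_nc; rewrite /wron /= vn vn1 => w0.
  have M3 : r (n%:Z - 1) * r (c%:Z - n%:Z) - r n%:Z * r (c%:Z - n%:Z + 1) != 0.
    by rewrite lt_eqF // minor_lt0 //; lia.
  apply/eqP; rewrite -subr_eq0 -(mulIr_eq0 _ (mulIf M3)); apply/eqP.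
  by rewrite -{}[RHS]w0; ring.
have v00 : v 0 = 0.
  have [vc _] := vE c.+1 (leqnn _); have := vpos c.+1%:Z; rewrite vc ltz_nat ltnSn.
  move=> /(_ isT)/eqP; rewrite mulf_eq0 => /orP[/eqP //|].
  by rewrite gt_eqF // rcoef_gt0.
move=> j; have [/vneg //|j_ge0] := ltP j 0; have [/vpos //|j_le] := ltP c%:Z j.
case: j j_ge0 j_le => // n _; rewrite lez_nat => le_nc.
by have [-> _] := vE n (leqW le_nc); rewrite v00 mul0r.
Qed.

(** The determinants of the hats form a positive diagonal matrix, which dictates the coefficients;
    the remainder has vanishing determinants and is zero by [wron_inj]. *)
Lemma hat_decomposition (u : int -> rat) :
  (forall j, j < 0 -> u j = 0) -> (forall j, c%:Z < j -> u j = 0) ->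
  (forall i, 0 <= wron p c u i) ->
  exists2 lam : nat -> rat, forall m, 0 <= lam m &
    forall j, u j = \sum_(m < c.+1) lam m * hat m j.
Proof.
move=> uneg upos wu.
have wh (m : nat) : (m <= c)%N -> 0 < wron p c (hat m) m%:Z.
  move=> le_mc; apply: (wron_glued_eq le_mc _ (@hat_glued_l m) (@hat_glued_r m)).
  by apply: rcoef_gt0; lia.
pose lam m := if (m <= c)%N then wron p c u m%:Z / wron p c (hat m) m%:Z else 0.
exists lam.
  by move=> m; rewrite /lam; case: ifP => // le_mc; rewrite divr_ge0 // ltW // wh.
suff v0 : forall j, u j - \sum_(m < c.+1) lam m * hat m j = 0.
  by move=> j; apply/eqP; rewrite -subr_eq0 v0.
apply: wron_inj => [j lt_j|j lt_j|i le_ic].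
- rewrite uneg // big1 ?subr0 // => m _; rewrite hat_glued_l; last by lia.
  by rewrite (@rcoef_lt0 j) // !mulr0.
- rewrite upos // big1 ?subr0 // => m _.
  rewrite hat_glued_r; last by have := ltn_ord m; lia.
  by rewrite (@rcoef_lt0 (_ - j)) ?mulr0 //; lia.
transitivity (wron p c u i%:Z - \sum_(m < c.+1) lam m * wron p c (hat m) i%:Z).
  by rewrite -wron_sum /wron /=; ring.
rewrite (bigD1 (inord i)) //= big1 => [|m ne_m].
  by rewrite inordK // /lam le_ic addr0 divfK ?subrr // gt_eqF // wh.
have le_mc : (m <= c)%N by rewrite -ltnS.
have A_gt0 : 0 < r (c%:Z - m%:Z) by apply: rcoef_gt0; lia.
rewrite (wron_glued_neq le_mc A_gt0 (@hat_glued_l m) (@hat_glued_r m)) ?mulr0 //.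
by apply: contraNneq ne_m => -[->]; rewrite inord_val.
Qed.

End Coefficients.

(** * Pure diagrams as divided differences *)

Section DividedDifference.

Definition ddw (s : seq int) (x : int) : rat := \prod_(y <- s | y != x) (x - y)%:~R.

(* The divided difference of phi at the nodes s. *)
Definition dd (s : seq int) (phi : int -> rat) : rat := \sum_(x <- s) phi x / ddw s x.

Lemma ddw_neq0 s x : ddw s x != 0.
Proof.
rewrite /ddw; elim/big_rec: _ => [|y z ne_yx nz_z]; first exact: oner_neq0.
by rewrite mulf_neq0 // intr_eq0 subr_eq0 eq_sym.
Qed.

Lemma ddw_perm s s' x : perm_eq s s' -> ddw s x = ddw s' x.
Proof. by move=> eq_s; rewrite /ddw (perm_big s' eq_s). Qed.

Lemma dd_perm s s' phi : perm_eq s s' -> dd s phi = dd s' phi.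
Proof.
move=> eq_s; rewrite /dd (perm_big s' eq_s); apply: eq_bigr => x _.
by rewrite (ddw_perm _ eq_s).
Qed.

Lemma ddB s phi psi : dd s (fun x => phi x - psi x) = dd s phi - dd s psi.
Proof. by rewrite /dd -sumrB; apply: eq_bigr => x _; rewrite mulrBl. Qed.

Lemma ddw_cons a s x : x != a -> ddw (a :: s) x = (x - a)%:~R * ddw s x.
Proof. by move=> ne; rewrite /ddw big_cons eq_sym ne. Qed.

Lemma ddw_head a s : ddw (a :: s) a = ddw s a.
Proof. by rewrite /ddw big_cons eqxx. Qed.

Lemma dd_cons a s phi : a \notin s ->
  dd (a :: s) phi = phi a / ddw s a + \sum_(x <- s) phi x / ((x - a)%:~R * ddw s x).
Proof.
move=> nas; rewrite /dd big_cons ddw_head; congr (_ + _).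
rewrite big_seq [RHS]big_seq; apply: eq_bigr => x xs; rewrite ddw_cons //.
by apply: contraNneq nas => <-.
Qed.

Lemma dd_cons2 a b s phi : uniq [:: a, b & s] ->
  dd [:: a, b & s] phi = phi a / ((a - b)%:~R * ddw s a) + phi b / ((b - a)%:~R * ddw s b)
    + \sum_(x <- s) phi x / ((x - a)%:~R * ((x - b)%:~R * ddw s x)).
Proof.
rewrite /= inE negb_or => /and3P[/andP[ne_ab nas] nbs _].
rewrite dd_cons ?inE ?negb_or ?ne_ab // big_cons ddw_cons // ddw_head -addrA.
congr (_ + (_ + _)); rewrite big_seq [RHS]big_seq; apply: eq_bigr => x xs.
by rewrite ddw_cons //; apply: contraNneq nbs => <-.
Qed.

Lemma intrB_neq0 (a b : int) : a != b -> a%:~R - b%:~R != 0 :> rat.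
Proof. by rewrite subr_eq0 eqr_int. Qed.

(** By [dd_diff], both sides are the difference of the divided differences on b :: s and a :: s,
    telescoped through y. For a < y < b the coefficients are positive. *)
Lemma dd_exchange a b y s phi : uniq [:: a, b, y & s] ->
  (b - a)%:~R * dd [:: a, b & s] phi
  = (b - y)%:~R * dd [:: y, b & s] phi + (y - a)%:~R * dd [:: a, y & s] phi.
Proof.
move=> uniq_s; have := uniq_s; rewrite /= !inE !negb_or => /and4P[].
move=> /and3P[ne_ab ne_ay nas] /andP[ne_by nbs] nys uniqs.
have ne_yb : y != b by rewrite eq_sym.
have [ne_ba ne_ya] : b != a /\ y != a by rewrite ![_ == a]eq_sym.
rewrite !dd_cons2 /= ?inE ?negb_or ?ne_ab ?nas ?nbs ?nys ?ne_yb ?ne_ay //.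
rewrite !mulrDr !mulr_sumr.
have -> : \sum_(x <- s) (b - a)%:~R * (phi x / ((x - a)%:~R * ((x - b)%:~R * ddw s x))) =
    \sum_(x <- s) (b - y)%:~R * (phi x / ((x - y)%:~R * ((x - b)%:~R * ddw s x)))
    + \sum_(x <- s) (y - a)%:~R * (phi x / ((x - a)%:~R * ((x - y)%:~R * ddw s x))).
  rewrite -big_split [LHS]big_seq [RHS]big_seq; apply: eq_bigr => x xs.
  have xa : x != a by apply: contraNneq nas => <-.
  have xb : x != b by apply: contraNneq nbs => <-.
  have xy : x != y by apply: contraNneq nys => <-.
  have := ddw_neq0 s x; move: (ddw s x) => W nzW; rewrite !rmorphB /=.
  by field; rewrite nzW !intrB_neq0.
have := (ddw_neq0 s a, ddw_neq0 s b, ddw_neq0 s y).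
move: (ddw s a) (ddw s b) (ddw s y) => Wa Wb Wy [[nza nzb] nzy]; rewrite !rmorphB /=.
move: (\sum_(x <- s) _) (\sum_(x <- s) _) => S1 S2.
by field; rewrite nza nzb nzy !intrB_neq0.
Qed.

Lemma dd_diff a b s phi : uniq [:: a, b & s] ->
  (a - b)%:~R * dd [:: a, b & s] phi = dd (a :: s) phi - dd (b :: s) phi.
Proof.
move=> uniq_s; have := uniq_s; rewrite /= !inE !negb_or => /and3P[/andP[ne_ab nas] nbs uniqs].
have ne_ba : b != a by rewrite eq_sym.
rewrite dd_cons2 // !dd_cons // !mulrDr !mulr_sumr.
have -> : \sum_(x <- s) (a - b)%:~R * (phi x / ((x - a)%:~R * ((x - b)%:~R * ddw s x))) =
    \sum_(x <- s) phi x / ((x - a)%:~R * ddw s x)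
    - \sum_(x <- s) phi x / ((x - b)%:~R * ddw s x).
  rewrite -sumrB [LHS]big_seq [RHS]big_seq; apply: eq_bigr => x xs.
  have xa : x != a by apply: contraNneq nas => <-.
  have xb : x != b by apply: contraNneq nbs => <-.
  have := ddw_neq0 s x; move: (ddw s x) => W nzW; rewrite !rmorphB /=.
  by field; rewrite nzW !intrB_neq0.
have := (ddw_neq0 s a, ddw_neq0 s b).
move: (ddw s a) (ddw s b) => Wa Wb [nza nzb]; rewrite !rmorphB /=.
move: (\sum_(x <- s) _) (\sum_(x <- s) _) => S1 S2.
by field; rewrite nza nzb !intrB_neq0.
Qed.

Lemma dd_const s a : uniq s -> (1 < size s)%N -> dd s (fun _ => a) = 0.
Proof.
have [m] := ubnP (size s); elim: m s => // m IH [|x [|y s]] //.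
rewrite ltnS => le_sm uniq_s _.
have ne_xy : x != y by move: uniq_s; rewrite /= inE negb_or => /and3P[/andP[]].
apply: (mulfI (intrB_neq0 ne_xy)); rewrite mulr0 -rmorphB dd_diff //.
have [uxs uys] : uniq (x :: s) /\ uniq (y :: s).
  by move: uniq_s => /=; rewrite inE negb_or => /and3P[/andP[_ ->] -> ->].
case: s le_sm uniq_s uxs uys => [|z s] le_sm uniq_s uxs uys.
  by rewrite /dd /ddw !big_cons !big_nil !eqxx /= subrr.
by rewrite !IH ?subrr //; apply: leq_trans le_sm.
Qed.

(** Writing P - P(a) = Q (X - a) trades the node a for one degree. *)
Lemma dd_poly s (P : {poly rat}) : uniq s -> (size P < size s)%N ->
  dd s (fun x => P.[x%:~R]) = 0.
Proof.
elim: s P => // a s IH P uniq_s; rewrite ltnS => le_P.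
have [nas uniqs] := andP uniq_s.
have [Q def_P] : exists Q, P - (P.[a%:~R])%:P = Q * ('X - (a%:~R)%:P).
  by apply/factor_theorem; rewrite rootE !hornerE subrr.
case: (posnP (size s)) => [s0|s_gt0].
  have -> : P = 0 by apply/eqP; rewrite -size_poly_eq0 -leqn0 -s0.
  by rewrite /dd big1 // => x _; rewrite horner0 mul0r.
have sizeQ : (size Q < size s)%N.
  have [->|nzQ] := eqVneq Q 0; first by rewrite size_poly0.
  have : (size (Q * ('X - (a%:~R)%:P))%R <= size s)%N.
    rewrite -def_P (leq_trans (size_polyD _ _)) // geq_max le_P size_polyN.
    by rewrite (leq_trans (size_polyC_leq1 _)).
  by rewrite size_Mmonic ?monicXsubC // size_XsubC addn2.
rewrite (_ : dd _ _ = dd (a :: s) (fun x => P.[x%:~R] - P.[a%:~R])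
                      + dd (a :: s) (fun _ => P.[a%:~R])); last by rewrite ddB subrK.
rewrite dd_const // addr0 dd_cons // subrr mul0r add0r -[RHS](IH Q) //.
rewrite /dd big_seq [RHS]big_seq; apply: eq_bigr => x xs.
have -> : P.[x%:~R] - P.[a%:~R] = Q.[x%:~R] * (x - a)%:~R.
  by have := congr1 (fun E : {poly rat} => E.[x%:~R]) def_P; rewrite !hornerE rmorphB.
have xa : x != a by apply: contraNneq nas => <-.
have := ddw_neq0 s x; move: (ddw s x) => W nzW; rewrite !rmorphB /=.
by field; rewrite nzW !intrB_neq0.
Qed.

Lemma sign_ddw_min s x : (forall y, y \in s -> x < y) -> 0 < (-1) ^+ size s * ddw s x.
Proof.
elim: s => [|y s IH] lt_x; first by rewrite /ddw big_nil.
have lt_xy : x < y by apply: lt_x; rewrite inE eqxx.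
rewrite ddw_cons ?lt_eqF // exprS mulN1r mulNr mulrCA -mulNr -rmorphN.
apply: mulr_gt0; first by rewrite /= ltr0z; lia.
by apply: IH => z zs; apply: lt_x; rewrite inE zs orbT.
Qed.

Lemma ddw_max_gt0 s x : (forall y, y \in s -> y < x) -> 0 < ddw s x.
Proof.
move=> lt_x; rewrite /ddw big_seq_cond; apply: prodr_gt0 => y /andP[/lt_x lt_yx _].
by rewrite ltr0z; lia.
Qed.

End DividedDifference.

(** * Discrete splines and the sign of their determinants *)

Section PureDiagrams.
Variable p : nat.
Hypothesis p_gt1 : (1 < p)%N.
Local Notation r := (rcoef p).

(** The polynomial x -> binomial(p - 1 + j - x, p - 1), which agrees with r(j - x) as long as j - x
    > -p. *)
Definition rpoly (j : int) : {poly rat} :=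
  ((p.-1)`!%:R^-1)%:P * \prod_(l < p.-1) ((j + l%:Z + 1)%:~R%:P - 'X).

Lemma size_rpoly j : (size (rpoly j) <= p)%N.
Proof.
rewrite /rpoly mul_polyC (leq_trans (size_scale_leq _ _)) //.
apply: leq_trans (size_poly_prod_leq _ _) _ => /=.
rewrite (eq_bigr (fun _ => 2%N)) => [|l _]; last by rewrite -size_polyN opprB size_XsubC.
by rewrite sum_nat_const card_ord; move: p_gt1; lia.
Qed.

Lemma rpolyE j x : (rpoly j).[x%:~R] =
  ((p.-1)`!%:R)^-1 * \prod_(l < p.-1) (j - x + l%:Z + 1)%:~R.
Proof.
rewrite /rpoly hornerM hornerC horner_prod; congr (_ * _).
by apply: eq_bigr => l _; rewrite !hornerE -rmorphB; congr (_%:~R); lia.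
Qed.

Lemma rcoef_poly (y : int) : - p%:Z < y ->
  r y = ((p.-1)`!%:R)^-1 * \prod_(l < p.-1) (y + l%:Z + 1)%:~R.
Proof.
case: y => m y_gt.
  have nz_f : (p.-1)`!%:R != 0 :> rat by rewrite pnatr_eq0 -lt0n fact_gt0.
  apply: (mulfI nz_f); rewrite mulrA mulfV // mul1r [r _]/rcoef.
  rewrite -natrM mulnC bin_ffact ffact_prod natr_prod.
  rewrite (reindex_inj rev_ord_inj) /=; apply: eq_bigr => l _.
  have lt_l := ltn_ord l.
  by rewrite pmulrn; congr (_ *~ _); lia.
rewrite [LHS]rcoef_lt0 //; apply/esym/eqP; rewrite mulf_eq0; apply/orP; right.
have lt_mp : (m < p.-1)%N by lia.
by apply/prodf_eq0; exists (Ordinal lt_mp) => //; rewrite intr_eq0 /=; lia.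
Qed.

(** Binomial reciprocity: the reflection y -> -p - y multiplies the untruncated polynomial by
    (-1)^(p-1), and r agrees with that polynomial for y > -p. *)
Lemma rcoef_reflect (y : int) :
  r y - ((p.-1)`!%:R)^-1 * \prod_(l < p.-1) (y + l%:Z + 1)%:~R = (-1) ^+ p * r (- p%:Z - y).
Proof.
have [y_gt|y_le] := ltP (- p%:Z) y.
  by rewrite -rcoef_poly // subrr rcoef_lt0 ?mulr0 //; lia.
rewrite rcoef_lt0 ?sub0r; last by lia.
rewrite rcoef_poly; last by lia.
rewrite -mulrN mulrCA; congr (_ * _).
rewrite (reindex_inj rev_ord_inj) /=.
rewrite (eq_bigr (fun l : 'I_p.-1 => - (- p%:Z - y + l%:Z + 1)%:~R)) => [|l _]; last first.
  by rewrite -rmorphN /=; congr (_%:~R); have := ltn_ord l; lia.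
rewrite prodrN card_ord -mulNr; congr (_ * _).
by case: (p) p_gt1 => // p' _ /=; rewrite exprS mulN1r.
Qed.

(** A discrete B-spline, with r in the role of the truncated power. *)
Definition dspline (s : seq int) (j : int) : rat := dd s (fun x => r (j - x)).

Lemma dspline_left a s j : a \notin s -> (forall x, x \in s -> j < x) ->
  dspline (a :: s) j = (ddw s a)^-1 * r (j - a).
Proof.
move=> nas lt_j; rewrite /dspline dd_cons // big_seq big1 ?addr0 => [|x /lt_j lt_jx].
  by rewrite mulrC.
by rewrite rcoef_lt0 ?mul0r //; lia.
Qed.

(** The p + 1 nodes annihilate [rpoly j]. After subtracting it the nodes in [s] contribute nothing,
    and the node [b] contributes the reflected value. *)
Lemma dspline_right b s j : uniq (b :: s) -> size s = p ->
  (forall x, x \in s -> x < j + p%:Z) ->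
  dspline (b :: s) j = (-1) ^+ p / ddw s b * r (b - p%:Z - j).
Proof.
move=> uniq_s sz lt_x; have [nbs _] := andP uniq_s.
have dd0 : dd (b :: s) (fun x => (rpoly j).[x%:~R]) = 0.
  by apply: dd_poly; rewrite //= sz ltnS size_rpoly.
rewrite /dspline -[LHS]subr0 -dd0 -ddB dd_cons // rpolyE rcoef_reflect.
rewrite big_seq big1 ?addr0 => [|x /lt_x lt_xj].
  rewrite mulrAC -!mulrA; congr (_ * (_ * r _)); lia.
by rewrite rpolyE rcoef_poly ?subrr ?mul0r //; lia.
Qed.

(** The left formula holds for j <= lo - 1, the right one for j >= hi - p + 1. For p - 1 consecutive
    inner nodes these bounds coincide, so the spline is glued at m = lo - 1. *)
Lemma wron_dspline_consecutive (c : nat) (lo hi : int) D i :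
  0 < lo -> hi < c%:Z + p%:Z -> uniq D -> size D = p.-1 ->
  (forall x, x \in D -> lo <= x <= hi) -> hi - lo + 1 = p.-1%:Z ->
  0 <= wron p c (fun j => (-1) ^+ p * dspline [:: 0, c%:Z + p%:Z & D] j) i.
Proof.
move=> lo_gt0 hi_lt uniqD sizeD D_in eq_hi.
have n0 : 0 \notin c%:Z + p%:Z :: D.
  rewrite inE negb_or; apply/andP; split; first by apply/eqP; lia.
  by apply/negP => /D_in; lia.
have nb : c%:Z + p%:Z \notin 0 :: D.
  rewrite inE negb_or; apply/andP; split; first by apply/eqP; lia.
  by apply/negP => /D_in; lia.
have le_mc : (`|lo - 1| <= c)%N by lia.
have abs_lo : `|lo - 1|%N%:Z = lo - 1 by lia.
have gt0 x : x \in c%:Z + p%:Z :: D -> 0 < x by rewrite inE => /orP[/eqP->|/D_in]; lia.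
apply: (@wron_glued_ge0 p p_gt1 c _ ((-1) ^+ p / ddw (c%:Z + p%:Z :: D) 0)
  (ddw (0 :: D) (c%:Z + p%:Z))^-1 `|lo - 1|%N le_mc); rewrite ?abs_lo.
- have := sign_ddw_min gt0; rewrite /= sizeD prednK; last by move: p_gt1; lia.
  by rewrite -invr_gt0 invfM invr_sign.
- move=> j le_j; rewrite dspline_left // ?subr0 ?mulrA // => x.
  by rewrite inE => /orP[/eqP->|/D_in]; lia.
move=> j le_j; rewrite /dspline (@dd_perm _ [:: c%:Z + p%:Z, 0 & D]); last first.
  by rewrite -[[:: 0, _ & D]]/([:: 0] ++ [:: c%:Z + p%:Z] ++ D) perm_catCA.
rewrite -/(dspline _ _) dspline_right //=.
- by rewrite !mulrA -expr2 sqrr_sign mul1r; congr (_ * r _); lia.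
- by move: n0; rewrite nb inE negb_or uniqD => /andP[_ ->].
- by rewrite sizeD; move: p_gt1; lia.
by move=> x; rewrite inE => /orP[/eqP->|/D_in]; move: p_gt1; lia.
Qed.

(* Exchanging an extreme inner node for one in a gap expresses the divided
   difference as a convex combination, and shrinks the range of inner nodes. *)
Lemma wron_dspline_ge0 (c : nat) (lo hi : int) D i :
  0 < lo -> hi < c%:Z + p%:Z -> uniq D -> size D = p.-1 ->
  (forall x, x \in D -> lo <= x <= hi) ->
  0 <= wron p c (fun j => (-1) ^+ p * dspline [:: 0, c%:Z + p%:Z & D] j) i.
Proof.
have [m] := ubnP `|hi - lo|%N; elim: m lo hi D => // m IH lo hi D; rewrite ltnS => le_m.
move=> lo_gt0 hi_lt uniqD sizeD D_in.
have D_gt0 : (0 < size D)%N by rewrite sizeD; move: p_gt1; lia.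
have le_lohi : lo <= hi.
  by case: (D) D_gt0 D_in => // x D' _ /(_ x); rewrite inE eqxx => /(_ isT); lia.
have [loD|nloD] := boolP (lo \in D); last first.
  have D_in' x : x \in D -> lo + 1 <= x <= hi.
    move=> xD; have := D_in x xD; have : x != lo by apply: contraNneq nloD => <-.
    by lia.
  have [x xD] : exists x, x \in D by case: (D) D_gt0 => // x D' _; exists x; rewrite inE eqxx.
  apply: (IH (lo + 1) hi) => //; have := D_in' x xD; lia.
have [hiD|nhiD] := boolP (hi \in D); last first.
  have D_in' x : x \in D -> lo <= x <= hi - 1.
    move=> xD; have := D_in x xD; have : x != hi by apply: contraNneq nhiD => <-.
    by lia.
  have [x xD] : exists x, x \in D by case: (D) D_gt0 => // x D' _; exists x; rewrite inE eqxx.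
  apply: (IH lo (hi - 1)) => //; have := D_in' x xD; lia.
pose I := [seq lo + n%:Z | n <- iota 0 `|hi - lo|.+1].
have I_P x : (x \in I) = (lo <= x <= hi).
  apply/mapP/idP => [[n]|x_in]; first by rewrite mem_iota => n_in ->; lia.
  by exists `|x - lo|%N; [rewrite mem_iota; lia | lia].
have uniqI : uniq I by rewrite map_inj_uniq ?iota_uniq // => a b; lia.
(* Both ends of the range are now nodes. Either no integer between them is missing, which is the
   consecutive case, or some y is and can be exchanged. *)
have [sub|/allPn[y y_in nyD]] := boolP (all (mem D) I).
  have eqID : I =i D.
    by move=> x; apply/idP/idP => [/(allP sub) //|/D_in]; rewrite I_P.
  apply: (wron_dspline_consecutive i lo_gt0 hi_lt) => //.
  have := perm_size (uniq_perm uniqI uniqD eqID).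
  by rewrite size_map size_iota sizeD; move: le_lohi; lia.
have y_range : lo < y < hi.
  move: y_in; rewrite I_P => y_in.
  have ne_lo : y != lo by apply: contraNneq nyD => ->.
  have ne_hi : y != hi by apply: contraNneq nyD => ->.
  by lia.
have bounds : [/\ 0 < lo + 1, hi - 1 < c%:Z + p%:Z, (`|(hi - (lo + 1))%R| < m)%N,
    (`|(hi - 1 - lo)%R| < m)%N & lo < hi] by split; lia.
pose U := rem hi (rem lo D).
have ne_lohi : hi != lo by apply/eqP; lia.
have eqD : perm_eq D [:: lo, hi & U].
  by rewrite (perm_trans (perm_to_rem loD)) // perm_cons perm_to_rem // mem_rem_uniq // inE ne_lohi.
have uniqU : uniq [:: lo, hi & U] by rewrite -(perm_uniq eqD).
have sizeU : size D = (size U).+2 by rewrite (perm_size eqD).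
have U_in x : x \in U -> lo + 1 <= x <= hi - 1.
  move=> xU; have := D_in x; rewrite (perm_mem eqD) !inE xU !orbT => /(_ isT).
  move: uniqU; rewrite /= inE negb_or => /and3P[/andP[_ nlo] nhi _].
  have : x != lo by apply: contraNneq nlo => <-.
  have : x != hi by apply: contraNneq nhi => <-.
  by lia.
have nyU : y \notin U by apply: (@contra _ (y \in D)) nyD => yU;
  rewrite (perm_mem eqD) !inE yU !orbT.
set K := fun D j => (-1) ^+ p * dspline [:: 0, c%:Z + p%:Z & D] j.
have nodes x : x \in [:: lo, hi, y & U] -> 0 < x < c%:Z + p%:Z.
  by rewrite !inE => /or4P[/eqP->|/eqP->|/eqP->|/U_in]; lia.
have uniq_all : uniq [:: lo, hi, y, 0, c%:Z + p%:Z & U].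
  have n0 : 0 \notin [:: lo, hi, y & U] by apply/negP => /nodes; lia.
  have nb : c%:Z + p%:Z \notin [:: lo, hi, y & U] by apply/negP => /nodes; lia.
  move: uniqU n0 nb; rewrite /= !inE !negb_or nyU.
  case/and3P=> /andP[_ ->] -> -> /and4P[? ? ? ->] /and4P[? ? ? ->].
  by rewrite !andbT; repeat (apply/andP; split); rewrite // ?andbT; apply/eqP; lia.
have exch j : (hi - lo)%:~R * K D j =
    (hi - y)%:~R * K (y :: hi :: U) j + (y - lo)%:~R * K (lo :: y :: U) j.
  rewrite /K !(mulrCA _ ((-1) ^+ p)) -mulrDr; congr (_ * _).
  have toD a b : perm_eq [:: 0, c%:Z + p%:Z, a, b & U] [:: a, b, 0, c%:Z + p%:Z & U].
    exact: permEl (perm_catCA [:: 0; c%:Z + p%:Z] [:: a; b] U).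
  have eqD0 : perm_eq [:: 0, c%:Z + p%:Z & D] [:: lo, hi, 0, c%:Z + p%:Z & U].
    by rewrite (perm_trans _ (toD _ _)) // !perm_cons.
  rewrite /dspline (dd_perm _ eqD0) !(dd_perm _ (toD _ _)); apply: dd_exchange.
  by move: uniq_all.
rewrite -(pmulr_rge0 _ (x := (hi - lo)%:~R)); last by rewrite ltr0z; lia.
rewrite -wronZ.
have -> : wron p c (fun j => (hi - lo)%:~R * K D j) i =
  (hi - y)%:~R * wron p c (K (y :: hi :: U)) i + (y - lo)%:~R * wron p c (K (lo :: y :: U)) i.
  by rewrite /wron !exch; ring.
have [uloy uhiy] : uniq (lo :: y :: U) /\ uniq (y :: hi :: U).
  move: uniqU; rewrite /= !inE !negb_or nyU => /and3P[/andP[_ ->] -> ->].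
  by case/andP: y_range; rewrite !lt_neqAle => /andP[-> _] /andP[-> _].
have [b1 b2 b3 b4 b5] := bounds; have [ylo yhi] := andP y_range.
have sizeU' : (size U).+2 = p.-1 by rewrite -sizeU.
clear -IH b1 b2 b3 b4 b5 ylo yhi uloy uhiy sizeU' U_in lo_gt0 hi_lt.
apply: addr_ge0; apply: mulr_ge0; try by rewrite ler0z subr_ge0 ltW.
  apply: (IH (lo + 1) hi) => // x; rewrite !inE => /or3P[/eqP->|/eqP->|/U_in];
    clear -ylo yhi b5; lia.
apply: (IH lo (hi - 1)) => // x; rewrite !inE => /or3P[/eqP->|/eqP->|/U_in];
  clear -ylo yhi b5; lia.
Qed.

End PureDiagrams.

(** * Multiplication by powers of 1 - t and the equations of a pure diagram *)

Local Notation Delta := (@mul_1subt rat).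

Lemma iter_Delta_ext p u v : u =1 v -> iter p Delta u =1 iter p Delta v.
Proof. by elim: p => // p IH eq_uv j; rewrite !iterS /mul_1subt !IH. Qed.

Lemma iter_Delta_left p u v A : (forall j, j < A -> u j = v j) ->
  forall j, j < A -> iter p Delta u j = iter p Delta v j.
Proof.
move=> eq_uv; elim: p => // p IH j lt_j.
by rewrite !iterS /mul_1subt !IH //; lia.
Qed.

(** Multiplication by 1 - t is injective on series bounded below; agreement below [A] stands for the
    bound. *)
Lemma iter_Delta_inj p u v A : (forall j, j < A -> u j = v j) ->
  iter p Delta u =1 iter p Delta v -> u =1 v.
Proof.
move=> eqA; elim: p => // p IH eq_iter; apply: IH => j.
have [/(iter_Delta_left p eqA) //|le_A] := ltP j A.
have -> : j = A + `|(j - A)%R|%N%:Z by lia.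
elim: `|(j - A)%R|%N => [|n IHn].
  have := eq_iter A; rewrite !iterS /mul_1subt addr0.
  by rewrite (iter_Delta_left p eqA (j := A - 1)) => [/addIr|] //; lia.
have := eq_iter (A + n.+1%:Z); rewrite !iterS /mul_1subt.
have -> : A + n.+1%:Z - 1 = A + n%:Z by lia.
by rewrite IHn => /addIr.
Qed.

Lemma iter_Delta_sum p (I : Type) (s : seq I) (a : I -> rat) (u : I -> int -> rat) j :
  iter p Delta (fun j => \sum_(l <- s) a l * u l j) j
  = \sum_(l <- s) a l * iter p Delta (u l) j.
Proof.
elim: p j => // p IH j; rewrite iterS /mul_1subt !IH -sumrB.
by apply: eq_bigr => l _; rewrite -mulrBr.
Qed.

Lemma iter_Delta_support p g A B : (forall j, j < A -> g j = 0) -> (forall j, B <= j -> g j = 0) ->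
  (forall j, j < A -> iter p Delta g j = 0) /\
  (forall j, B + p%:Z <= j -> iter p Delta g j = 0).
Proof.
move=> gA gB; elim: p => [|p [IHA IHB]]; first by rewrite addr0.
split=> j le_j; rewrite iterS /mul_1subt; first by rewrite !IHA ?subrr //; lia.
by rewrite !IHB ?subrr //; lia.
Qed.

Lemma Delta_rcoef p x j : (0 < p)%N ->
  Delta (fun j => rcoef p.+1 (j - x)) j = rcoef p (j - x).
Proof.
case: p => // p _; rewrite /mul_1subt.
have -> : j - 1 - x = j - x - 1 by lia.
case: (j - x) => [[|m]|m].
- by rewrite sub0r /= subr0 !addn0 !binn.
- have -> : m.+1%:Z - 1 = m%:Z by lia.
  rewrite /= -natrB; last by rewrite addnS leq_bin2l ?leqnSn.
  by rewrite (addSn p m.+1) binS (addSnnS p m) addKn.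
by have -> : Negz m - 1 = Negz m.+1 by lia.
Qed.

Lemma iter_Delta_rcoef p x j : (0 < p)%N ->
  iter p Delta (fun j => rcoef p (j - x)) j = (j == x)%:R.
Proof.
case: p => // p _; elim: p => [|p IH].
  rewrite /= /mul_1subt -(subr_eq0 j x).
  have -> : j - 1 - x = j - x - 1 by lia.
  case: (j - x) => [[|m]|m] //.
  by rewrite (_ : m.+1%:Z - 1 = m%:Z); [rewrite /= !bin0 subrr | lia].
rewrite iterSr (iter_Delta_ext _ (fun j => Delta_rcoef x j (ltn0Sn p))).
exact: IH.
Qed.

Lemma size_difference (P : {poly rat}) :
  (size (P - (P \Po ('X + 1%:P)))%R <= (size P).-1)%N.
Proof.
elim/poly_ind: P => [|P c IH]; first by rewrite raddf0 subr0 size_poly0.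
have [->|nzP] := eqVneq P 0.
  by rewrite mul0r add0r comp_polyC subrr size_poly0.
rewrite size_MXaddC (negPf nzP) /= comp_poly_MXaddC.
have -> : P * 'X + c%:P - ((P \Po ('X + 1%:P)) * ('X + 1%:P) + c%:P)
    = (P - (P \Po ('X + 1%:P))) * 'X - (P \Po ('X + 1%:P)).
  by rewrite polyC1; ring.
rewrite (leq_trans (size_polyD _ _)) // geq_max size_polyN.
rewrite size_comp_poly2 ?leqnn ?andbT; last by rewrite size_XaddC.
rewrite (leq_trans (size_polyMleq _ _)) // size_polyX addn2 /=.
by rewrite (leq_ltn_trans IH) // prednK // lt0n size_poly_eq0.
Qed.

Lemma sum_by_parts A M (g phi : int -> rat) : g (A - 1) = 0 -> g (A + M%:Z - 1) = 0 ->
  \sum_(n < M) Delta g (A + n%:Z) * phi (A + n%:Z)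
  = \sum_(n < M) g (A + n%:Z) * (phi (A + n%:Z) - phi (A + n%:Z + 1)).
Proof.
move=> gA gB.
rewrite /mul_1subt; under eq_bigr do rewrite mulrBl; under [RHS]eq_bigr do rewrite mulrBr.
rewrite !sumrB; congr (_ - _).
pose f n := g (A + n%:Z - 1) * phi (A + n%:Z).
have fS n : f n.+1 = g (A + n%:Z) * phi (A + n%:Z + 1).
  by rewrite /f -addn1 PoszD addrA addrK.
under [RHS]eq_bigr do rewrite -fS.
have e1 : \sum_(n < M.+1) f n = \sum_(n < M) f n.+1.
  by rewrite big_ord_recl /= {1}/f addr0 gA mul0r add0r.
have e2 : \sum_(n < M.+1) f n = \sum_(n < M) f n.
  by rewrite big_ord_recr /= {2}/f gB mul0r addr0.
by rewrite -e1 e2.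
Qed.

(* A Laurent polynomial divisible by (1 - t)^p is annihilated by polynomials
   of degree less than p in the exponent. *)
Lemma iter_Delta_orthogonal p g A B M (P : {poly rat}) :
  (forall j, j < A -> g j = 0) -> (forall j, B <= j -> g j = 0) ->
  B + p%:Z <= A + M%:Z - 1 -> (size P <= p)%N ->
  \sum_(n < M) iter p Delta g (A + n%:Z) * P.[(A + n%:Z)%:~R] = 0.
Proof.
move=> gA gB; elim: p P => [|p IH] P le_B le_P.
  have -> : P = 0 by apply/eqP; rewrite -size_poly_eq0 -leqn0.
  by rewrite big1 // => n _; rewrite horner0 mulr0.
have [iA iB] := iter_Delta_support p gA gB.
under eq_bigr do rewrite iterS.
have le_B' : B + p%:Z <= A + M%:Z - 1 by lia.
have le_P' : (size (P - (P \Po ('X + 1%:P)))%R <= p)%N.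
  by rewrite (leq_trans (size_difference P)) // -subn1 leq_subLR.
rewrite (sum_by_parts (g := iter p Delta g) (fun j => P.[j%:~R])).
- rewrite -[RHS](IH _ le_B' le_P').
  apply: eq_bigr => n _; congr (_ * _).
  by rewrite hornerD hornerN horner_comp hornerD hornerX hornerC /= [(A + n%:Z + 1)%:~R]rmorphD.
- by apply: iA; lia.
by apply: iB; lia.
Qed.

Lemma seq_bound (s : seq int) : exists A : nat, forall x, x \in s -> (`|x| < A)%N.
Proof.
elim: s => [|y s [A IH]]; first by exists 0%N.
exists (maxn A `|y|.+1) => x; rewrite inE => /orP[/eqP->|/IH lt_x]; first by lia.
by rewrite leq_max lt_x.
Qed.

Section PureDiagram.
Variables (p : nat) (d : p.+1.-tuple int) (E : nat -> int -> rat).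
Hypothesis pureE : is_pure_diagram d E.
Hypothesis uniq_d : uniq d.

(** The Herzog-Kuehl equations, tested on all polynomials of degree less than p at once. *)
Lemma pure_orthogonal (P : {poly rat}) : (size P <= p)%N ->
  \sum_(i < p.+1) (-1) ^+ i * E i d`_i * P.[(d`_i)%:~R] = 0.
Proof.
move=> le_P; have [[_ _ [g [sg g0] gE]] E0 _] := pureE.
have [A0 boundA] := seq_bound (sg ++ d).
(* The window from A to A + M - 1 contains all shifts and the support of g, and its last point is A0
   + p, past which differences up to order p vanish as well. *)
pose A := - A0%:Z; pose M := (A0 + A0 + p + 1)%N.
have gA j : j < A -> g j = 0.
  move=> lt_j; apply: g0; apply/negP => sj.
  by have := boundA j; rewrite mem_cat sj => /(_ isT); rewrite /A in lt_j; lia.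
have gB j : A0%:Z <= j -> g j = 0.
  move=> le_j; apply: g0; apply/negP => sj.
  by have := boundA j; rewrite mem_cat sj => /(_ isT); lia.
have le_BM : A0%:Z + p%:Z <= A + M%:Z - 1 by rewrite /A /M; lia.
rewrite -[RHS](iter_Delta_orthogonal gA gB le_BM le_P).
under [RHS]eq_bigr do rewrite gE /alt_sum mulr_suml.
rewrite exchange_big; apply: eq_bigr => i _.
have lt_i : (i < size d)%N by rewrite size_tuple.
have := boundA d`_i; rewrite mem_cat mem_nth ?orbT // => /(_ isT) bound_i.
have lt_n : (`|(d`_i - A)%R| < M)%N by rewrite /A /M; lia.
rewrite (bigD1 (Ordinal lt_n)) //= big1 ?addr0 => [|n ne_n].
  by have -> : A + `|(d`_i - A)%R|%N%:Z = d`_i by rewrite /A; lia.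
rewrite E0 ?mulr0 ?mul0r //; apply: contraNneq ne_n => eq_n.
by apply/eqP/val_inj => /=; rewrite -eq_n; lia.
Qed.

(** Testing the equations on the polynomial with roots at all shifts other than d_0 and d_i leaves
    two terms. So the signed entries are the weights of a divided difference, normalised at d_0. *)
Lemma pure_weight i : (i < p.+1)%N -> (-1) ^+ i * E i d`_i * ddw d d`_i = ddw d d`_0.
Proof.
move=> lt_i; have [_ _ E00] := pureE.
have [->|nz_i] := eqVneq i 0%N; first by rewrite E00 mulr1 mul1r.
have d_i : d`_i \in tval d by rewrite mem_nth // size_tuple.
have d_0 : d`_0 \in tval d by rewrite mem_nth // size_tuple.
have ne_d : d`_i != d`_0 by rewrite nth_uniq ?size_tuple.
pose s := rem d`_i (rem d`_0 d).
have perm_d : perm_eq d [:: d`_0, d`_i & s].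
  rewrite (perm_trans (perm_to_rem d_0)) // perm_cons perm_to_rem //.
  by rewrite mem_rem_uniq // inE ne_d.
have size_s : (size s).+2 = p.+1 by rewrite -[RHS](size_tuple d) (perm_size perm_d).
pose P : {poly rat} := \prod_(y <- s) ('X - (y%:~R)%:P).
have uniq_s : uniq [:: d`_0, d`_i & s] by rewrite -(perm_uniq perm_d).
have [n0s nis] : d`_0 \notin s /\ d`_i \notin s.
  by move: uniq_s; rewrite /= inE negb_or => /and3P[/andP[_ ->] ->].
have P_ddw x : x \notin s -> P.[x%:~R] = ddw s x.
  move=> nxs; rewrite horner_prod /ddw [RHS]big_mkcond /= [LHS]big_seq [RHS]big_seq.
  apply: eq_bigr => y ys; rewrite !hornerE rmorphB; case: eqP => // eq_y.
  by rewrite -eq_y ys in nxs.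
have P_root x : x \in s -> P.[x%:~R] = 0.
  by move=> xs; rewrite horner_prod (big_rem x) //= !hornerE subrr mul0r.
have le_P : (size P <= p)%N by rewrite size_prod_XsubC -ltnS size_s.
have := pure_orthogonal le_P.
rewrite (bigD1 ord0) //= (bigD1 (Ordinal lt_i)) //= big1 => [|j].
  rewrite expr0 mul1r E00 mul1r addr0 !P_ddw // => /eqP; rewrite addr_eq0 => /eqP eqP0.
  rewrite !(ddw_perm _ perm_d) ddw_head (ddw_cons _ ne_d) ddw_head ddw_cons; last by rewrite eq_sym.
  by rewrite eqP0 !rmorphB /=; ring.
move=> /andP[ne_j0 ne_ji]; rewrite P_root ?mulr0 //.
have lt_j : (j < size d)%N by rewrite size_tuple.
have := mem_nth 0 lt_j; rewrite (perm_mem perm_d) !inE => /or3P[|| //].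
  by rewrite nth_uniq ?size_tuple //; rewrite -val_eqE /= in ne_j0; rewrite (negPf ne_j0).
by rewrite nth_uniq ?size_tuple //; rewrite -val_eqE /= in ne_ji; rewrite (negPf ne_ji).
Qed.

Lemma pure_functional (phi : int -> rat) :
  \sum_(i < p.+1) (-1) ^+ i * E i d`_i * phi d`_i = ddw d d`_0 * dd d phi.
Proof.
rewrite /dd [in RHS](big_nth 0) size_tuple big_mkord mulr_sumr; apply: eq_bigr => i _.
rewrite -(pure_weight (ltn_ord i)); have := ddw_neq0 d d`_i; move: (ddw d d`_i) => W nzW.
by field.
Qed.

Lemma pure_Delta (j : int) : (0 < p)%N ->
  iter p Delta (fun j => ddw d d`_0 * dspline p d j) j = alt_sum p E j.
Proof.
move=> p_gt0; have [_ E0 _] := pureE.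
transitivity (iter p Delta (fun j => \sum_(i <- index_enum 'I_p.+1)
    ((-1) ^+ i * E i d`_i) * rcoef p (j - d`_i)) j).
  by apply: iter_Delta_ext => i; rewrite -pure_functional.
rewrite iter_Delta_sum; apply: eq_bigr => i _; rewrite iter_Delta_rcoef // -mulrA.
by have [->|/E0->] := eqVneq j d`_i; rewrite ?mulr1 ?mulr0.
Qed.

End PureDiagram.

Lemma sorted_ends p (d : p.+1.-tuple int) : (0 < p)%N -> sorted <%R d ->
  exists D, [/\ perm_eq d [:: d`_0, d`_p & D], uniq D, size D = p.-1
    & forall x, x \in D -> d`_0 < x < d`_p].
Proof.
case: d => [[//|x s] /= /[!eqSS] /eqP sz] p_gt0.
case/lastP: s sz => [|D y] /=; first by move=> sz; rewrite -sz in p_gt0.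
rewrite size_rcons => sz; have sizeD : size D = p.-1 by rewrite -sz.
have -> : (x :: rcons D y)`_p = y by rewrite -sz /= nth_rcons ltnn eqxx.
rewrite -[path _ _ _]/(sorted _ (x :: rcons D y)) => sorted_d.
have uniq_d := lt_sorted_uniq sorted_d.
move: sorted_d; rewrite lt_sorted_pairwise pairwise_cons pairwise_rcons all_rcons.
case/and3P=> /andP[lt_xy /allP lt_x] /allP lt_y _.
exists D; split=> //.
- by rewrite perm_cons perm_rcons.
- by move: uniq_d; rewrite /= rcons_uniq => /and3P[].
by move=> z zD; rewrite /= lt_x // lt_y.
Qed.

Section SortedPureDiagram.
Variables (p : nat) (d : p.+1.-tuple int) (E : nat -> int -> rat).
Hypotheses (p_gt1 : (1 < p)%N) (pureE : is_pure_diagram d E) (sorted_d : sorted <%R d).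

Let p_gt0 : (0 < p)%N := ltnW p_gt1.
Let uniq_d : uniq d := lt_sorted_uniq sorted_d.

Lemma first_lt_last : d`_0 < d`_p.
Proof. by rewrite (lt_sorted_ltn_nth 0 sorted_d) ?inE ?size_tuple. Qed.

Lemma pure_sign : 0 < (-1) ^+ p * ddw d d`_0.
Proof.
have [D [perm_d uniqD sizeD D_in]] := sorted_ends p_gt0 sorted_d.
rewrite (ddw_perm _ perm_d) ddw_head.
have := @sign_ddw_min (d`_p :: D) d`_0; rewrite /= sizeD prednK //; apply=> y.
by rewrite inE => /orP[/eqP->|/D_in/andP[] //]; apply: first_lt_last.
Qed.

(** Positivity in the last column is what rules out cancellation in [hvector_wron_ge0]. *)
Lemma pure_last_gt0 : 0 < E p d`_p.
Proof.
have [D [perm_d uniqD sizeD D_in]] := sorted_ends p_gt0 sorted_d.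
have wp : 0 < ddw d d`_p.
  rewrite (ddw_perm _ perm_d).
  rewrite ddw_cons ?gt_eqF ?first_lt_last // ddw_head mulr_gt0 //.
    by rewrite ltr0z subr_gt0 first_lt_last.
  by apply: ddw_max_gt0 => y /D_in/andP[].
have := pure_sign; rewrite -(pure_weight pureE uniq_d (ltnSn p)) !mulrA -expr2 sqrr_sign mul1r.
by rewrite pmulr_lgt0.
Qed.

(** The tail is a positive multiple of a reflected r, so the h-vector ends exactly at d_p - p, with
    a positive coefficient. *)
Lemma pure_hilbert_right j : d`_p - p%:Z <= j ->
  ddw d d`_0 * dspline p d j = E p d`_p * rcoef p (d`_p - p%:Z - j).
Proof.
move=> le_j; have [D [perm_d uniqD sizeD D_in]] := sorted_ends p_gt0 sorted_d.
have perm_d' : perm_eq d [:: d`_p, d`_0 & D].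
  by rewrite (perm_trans perm_d) // (permEl (perm_catCA [:: d`_0] [:: d`_p] D)).
rewrite -(pure_weight pureE uniq_d (ltnSn p)) {1}/dspline (dd_perm _ perm_d').
rewrite -/(dspline _ _ _) dspline_right //.
- have -> : ddw d d`_p = ddw (d`_0 :: D) d`_p by rewrite (ddw_perm _ perm_d') ddw_head.
  have := ddw_neq0 (d`_0 :: D) d`_p; move: (ddw _ _) => W nz.
  have E1 (s e y : rat) : s * e * W * (s / W * y) = s * s * (e * y) by field.
  by rewrite E1 -expr2 sqrr_sign mul1r.
- by rewrite -(perm_uniq perm_d').
- by rewrite /= sizeD prednK.
by move=> x; rewrite inE => /orP[/eqP->|/D_in/andP[_]]; have := first_lt_last; lia.
Qed.

Lemma pure_wron_ge0 (c : nat) i : d`_0 = 0 -> d`_p = c%:Z + p%:Z ->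
  0 <= wron p c (fun j => ddw d d`_0 * dspline p d j) i.
Proof.
move=> d0 dp; have [D [perm_d uniqD sizeD D_in]] := sorted_ends p_gt0 sorted_d.
have := pure_sign; rewrite d0 dp in perm_d D_in *; move=> sign.
rewrite (@wron_ext _ _ _ (fun j => ((-1) ^+ p * ddw d 0) *
    ((-1) ^+ p * dspline p [:: 0, c%:Z + p%:Z & D] j))) => [|j]; last first.
  rewrite /dspline -(dd_perm _ perm_d) mulrACA -expr2 sqrr_sign mul1r //.
rewrite wronZ mulr_ge0 ?(ltW sign) //.
apply: (wron_dspline_ge0 p_gt1 (lo := 1) (hi := c%:Z + p%:Z - 1)) => //; first by lia.
by move=> x /D_in; lia.
Qed.

End SortedPureDiagram.

Lemma iter_Delta_intr p (g : int -> int) j :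
  (iter p (@mul_1subt int) g j)%:~R = iter p (@mul_1subt rat) (fun j => (g j)%:~R) j.
Proof. by elim: p j => // p IH j; rewrite !iterS /mul_1subt rmorphB /= !IH. Qed.

(** * Necessity of the inequalities *)

Section PureHvector.
Variables (n p c : nat) (h : {poly rat}) (b : nat -> int -> nat) (g : int -> int) (q : rat).
Hypotheses (p_gt1 : (1 < p)%N) (le_pn : (p <= n)%N) (size_h : size h = c.+1).
Hypothesis comb : pure_combination p (fun i j => (b i j)%:R).
Hypothesis hvec : is_hvector n p b g.
Hypothesis q_gt0 : 0 < q.
Hypothesis hE : forall i, hcoef h i = q * (g i)%:~R.
Hypothesis b0 : forall j, j != 0 -> b 0%N j = 0%N.
Variable J : int.
Hypothesis bp : forall j, j != J -> b p j = 0%N.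

Lemma hvector_wron_ge0 i : 0 <= wron p c (hcoef h) i.
Proof.
have p_gt0 : (0 < p)%N := ltnW p_gt1.
have [m [a [d [E [a_ge0 sorted_d pureE bE]]]]] := comb.
have uniq_d l : uniq (d l) := lt_sorted_uniq (sorted_d l).
pose G l j := ddw (d l) (d l)`_0 * dspline p (d l) j.
have E0 l i' j : j != (d l)`_i' -> E l i' j = 0 by have [_ + _] := pureE l; apply.
have E_00 l : E l 0%N (d l)`_0 = 1 by have [] := pureE l.
(* In column 0 each diagram contributes its coefficient or zero, so a zero of b forces the
   coefficients of the diagrams starting there to vanish. The same argument works in column p, by
   [pure_last_gt0]. *)
have first0 l : a l != 0 -> (d l)`_0 = 0.
  move=> nz_a; apply/eqP; apply: contraNT nz_a => /b0 b00.
  have := bE 0%N (d l)`_0; rewrite b00 => /esym/psumr_eq0P => sum0.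
  have := sum0 _ l isT; rewrite E_00 mulr1 => -> // l' _.
  rewrite mulr_ge0 //; have [->|ne] := eqVneq (d l)`_0 (d l')`_0; first by rewrite E_00.
  by rewrite E0.
have last0 l : a l != 0 -> (d l)`_p = J.
  move=> nz_a; apply/eqP; apply: contraNT nz_a => /bp bp0.
  have := bE p (d l)`_p; rewrite bp0 => /esym/psumr_eq0P => sum0.
  have Ep l' : 0 < E l' p (d l')`_p := pure_last_gt0 p_gt1 (pureE l') (sorted_d l').
  have : a l * E l p (d l)`_p = 0.
    apply: sum0 => // l' _; rewrite mulr_ge0 //.
    have [->|ne] := eqVneq (d l)`_p (d l')`_p; first exact: ltW.
    by rewrite E0.
  by move/eqP; rewrite mulf_eq0 (gt_eqF (Ep l)) orbF.
(* Both sides vanish far to the left and have the same p-th difference. The terms with p < i <= n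
   drop out, because the diagrams have no such columns. *)
have gE j : (g j)%:~R = \sum_(l < m) a l * G l j.
  have [[sg sg0] gD] := hvec.
  have [B boundB] := seq_bound (sg ++ flatten [seq tval (d l) | l : 'I_m]).
  suff eq1 : (fun j => (g j)%:~R) =1 (fun j => \sum_(l < m) a l * G l j) by apply: eq1.
  apply: (@iter_Delta_inj p _ _ (- B%:Z)) => {}j.
    move=> lt_j; rewrite sg0 ?big1 // => [l _|]; last first.
      by apply/negP => sj; have := boundB j; rewrite mem_cat sj => /(_ isT); lia.
    rewrite /G /dspline /dd big_seq big1 ?mulr0 // => x xd.
    rewrite rcoef_lt0 ?mul0r //; have := boundB x; rewrite mem_cat.
    have -> : x \in flatten [seq tval (d l) | l : 'I_m].
      by apply/flattenP; exists (tval (d l)) => //; apply/mapP; exists l; rewrite ?mem_enum.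
    by rewrite orbT => /(_ isT); lia.
  rewrite -iter_Delta_intr gD iter_Delta_sum /alt_sum rmorph_sum.
  transitivity (\sum_(i' < p.+1) (-1) ^+ i' * (b i' j)%:R : rat).
    rewrite -(subnKC le_pn) -addSn big_split_ord /= [X in _ + X]big1 ?addr0 => [|i' _].
      by apply: eq_bigr => i' _; rewrite rmorphM rmorphXn /= rmorphN1 -pmulrn.
    rewrite (_ : b _ j = 0%N) ?mulr0 //.
    apply/eqP; rewrite -(eqr_nat rat) bE big1 // => l _.
    by have [[_ + _] _ _] := pureE l => ->; rewrite ?mulr0 //= addSn ltnS leq_addr.
  under eq_bigr do rewrite bE mulr_sumr.
  rewrite exchange_big; apply: eq_bigr => l _.
  rewrite (pure_Delta (pureE l)) // /alt_sum mulr_sumr.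
  by apply: eq_bigr => i' _; rewrite mulrCA.
have hG j : hcoef h j = \sum_(l < m) (q * a l) * G l j.
  by rewrite hE gE mulr_sumr; apply: eq_bigr => l _; rewrite mulrA.
have hc : hcoef h c%:Z != 0.
  by rewrite /= -[c]/(c.+1.-1) -size_h -lead_coefE lead_coef_eq0 -size_poly_eq0 size_h.
have [l0 nz_l0] : exists l, a l != 0.
  apply/existsP; apply: contraNT hc; rewrite negb_exists => /forallP a0.
  by rewrite hG big1 // => l _; have := a0 l; rewrite negbK => /eqP->; rewrite mulr0 mul0r.
have GJ l j : a l != 0 -> J - p%:Z <= j -> G l j = E l p J * rcoef p (J - p%:Z - j).
  move=> nz_a; have := @pure_hilbert_right p (d l) (E l) p_gt1 (pureE l) (sorted_d l) j.
  by rewrite (last0 l nz_a); apply.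
have EJ l : a l != 0 -> 0 < E l p J.
  by move=> nz_a; rewrite -(last0 l nz_a) (pure_last_gt0 p_gt1 (pureE l)).
have hJ : 0 < hcoef h (J - p%:Z).
  rewrite hG (bigD1 l0) //= ltr_pwDl //.
    by rewrite GJ // !mulr_gt0 ?EJ ?rcoef_gt0 ?subrr // lt_def nz_l0 a_ge0.
  apply: sumr_ge0 => l _; have [->|nz_a] := eqVneq (a l) 0; first by rewrite mulr0 mul0r.
  by rewrite GJ // !mulr_ge0 ?(ltW q_gt0) ?(ltW (EJ l _)) ?rcoef_ge0.
(* All h-vectors involved end at J - p with a positive coefficient, so J - p is the degree of h. *)
have eqJ : J = c%:Z + p%:Z.
  have le_cJ : c%:Z <= J - p%:Z.
    rewrite leNgt; apply: contraNN hc => lt_Jc; rewrite hG big1 // => l _.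
    have [->|nz_a] := eqVneq (a l) 0; first by rewrite mulr0 mul0r.
    by rewrite GJ ?ltW // rcoef_lt0 ?mulr0 //; lia.
  have le_Jc : J - p%:Z <= c%:Z.
    move: hJ; case: (J - p%:Z) => // N; rewrite /hcoef lez_nat.
    by apply: contraTT; rewrite -ltnNge => lt_cN; rewrite nth_default ?ltxx // size_h.
  by lia.
rewrite (wron_ext _ _ _ hG) wron_sum; apply: sumr_ge0 => l _.
have [->|nz_a] := eqVneq (a l) 0; first by rewrite mulr0 mul0r.
rewrite mulr_ge0 ?mulr_ge0 ?(ltW q_gt0) //.
by apply: (pure_wron_ge0 p_gt1 (sorted_d l) _ (first0 l nz_a)); rewrite last0.
Qed.

End PureHvector.

(** * Gluing a polynomial ring to its dual *)

Lemma digits_inj (c p : nat) (f g : 'I_p -> nat) :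
  (forall v, f v <= c)%N -> (forall v, g v <= c)%N ->
  (\sum_v f v * c.+1 ^ v = \sum_v g v * c.+1 ^ v)%N -> f =1 g.
Proof.
elim: p f g => [|p IH] f g fc gc; first by move=> _ [].
have recl (f' : 'I_p.+1 -> nat) : (\sum_v f' v * c.+1 ^ v =
    f' ord0 + (\sum_(v < p) f' (lift ord0 v) * c.+1 ^ v) * c.+1)%N.
  rewrite big_ord_recl expn0 muln1 big_distrl; congr (_ + _)%N.
  by apply: eq_bigr => v _; rewrite lift0 expnSr mulnA.
rewrite !recl => eq_fg.
have eq0 : f ord0 = g ord0.
  have := congr1 (modn^~ c.+1) eq_fg.
  by rewrite !(addnC (_ ord0)) !modnMDl !modn_small ?ltnS.
have /IH eqS : (\sum_(v < p) f (lift ord0 v) * c.+1 ^ v = \sum_(v < p) g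
  (lift ord0 v) * c.+1 ^ v)%N.
  by move: eq_fg; rewrite eq0 => /addnI/eqP; rewrite eqn_pmul2r // => /eqP.
move=> v; case: (unliftP ord0 v) => [w|] -> //.
exact: (eqS _ _ w).
Qed.

(* C is a companion matrix of 1 + X G up to a scalar, where G is the product of
   the differences X^(E i) - X^(E j): any divisor of X G is invertible at C. *)
Lemma separating_matrix (k : fieldType) (I : finType) (E : I -> nat) :
  injective E ->
  exists d (C : 'M[k]_d.+1), C \is a GRing.unit /\
    forall i j, i != j -> C ^+ E i - C ^+ E j \is a GRing.unit.
Proof.
move=> injE.
pose G : {poly k} := \prod_(ij : I * I | ij.1 != ij.2) ('X^(E ij.1) - 'X^(E ij.2)).
have nzG : G != 0.
  apply/prodf_neq0 => -[i j] /= ne_ij; apply: contra ne_ij; rewrite subr_eq0.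
  by move/eqP/(congr1 (fun f : {poly k} => size f)); rewrite !size_polyXn => -[/injE->].
pose q0 := G * 'X + 1.
have size_q0 : size q0 = (size G).+1.
  by rewrite /q0 size_MXaddC (negPf nzG).
have nz_q0 : q0 != 0 by rewrite -size_poly_gt0 size_q0.
pose q := (lead_coef q0)^-1 *: q0.
have monic_q : q \is monic.
  by rewrite monicE lead_coefZ mulVf // lead_coef_eq0.
have size_q : (size q).-1 = (size G).-1.+1.
  rewrite size_scale ?invr_eq0 ?lead_coef_eq0 // size_q0 /= prednK //.
  by rewrite size_poly_gt0.
have := companionmxK monic_q.
move: (companionmx q); rewrite size_q => C charC.
have q0C : horner_mx C q0 = 0.
  have := Cayley_Hamilton C; rewrite charC /q linearZ /= => /eqP.
  by rewrite scaler_eq0 invr_eq0 lead_coef_eq0 (negPf nz_q0) => /eqP.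
have unitC f g : G * 'X = f * g -> horner_mx C f \is a GRing.unit.
  move=> def_fg; apply/unitrP; exists (- horner_mx C g).
  move: q0C; rewrite /q0 def_fg rmorphD rmorph1 rmorphM /= => /eqP.
  rewrite addr_eq0 => /eqP fg; split; last by rewrite mulrN fg opprK.
  have comm_fg : GRing.comm (horner_mx C g) (horner_mx C f).
    by rewrite /GRing.comm -!rmorphM mulrC.
  by rewrite mulNr comm_fg fg opprK.
exists (size G).-1, C; split.
  by have := unitC 'X G; rewrite horner_mx_X; apply; rewrite mulrC.
move=> i j ne_ij.
have := unitC ('X^(E i) - 'X^(E j))
  (\prod_(ij : I * I | (ij.1 != ij.2) && (ij != (i, j))) ('X^(E ij.1) - 'X^(E ij.2)) * 'X).
rewrite rmorphB !rmorphXn /= horner_mx_X; apply.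
by rewrite mulrA; congr (_ * _); rewrite /G (bigD1 (i, j)).
Qed.

Section Vandermonde.
Variables (k : fieldType) (d : nat) (C : 'M[k]_d.+1) (I : finType) (E : I -> nat).
Variable P : pred I.
Hypothesis C_unit : C \is a GRing.unit.
Hypothesis C_sep : forall i j, i != j -> C ^+ E i - C ^+ E j \is a GRing.unit.

Definition pidx (i : I) : nat := index i (enum P).

(** The blocks C^(E i (j + u)) form a Vandermonde matrix in the C^(E i), with row i scaled by the
    invertible C^(E i u). The shift u is there for [glue], whose exponents add the positions of two
    monomials. *)
Lemma vandermonde_inverse :
  exists W : nat -> I -> I -> 'M[k]_d.+1, forall u,
  (forall i i', P i -> P i' -> \sum_(j in P) C ^+ (E i * (pidx j + u)) * W u j i' = (i == i')%:R) /\
  (forall j j', P j -> P j' -> \sum_(i in P) W u j i * C ^+ (E i * (pidx j' + u)) = (j == j')%:R) /\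
  (forall i j e, GRing.comm (W u j i) (C ^+ e)).
Proof.
pose n := #|P|.
(* The Vandermonde matrix is formed over k[X] and evaluated at C afterwards: its determinant becomes
   a product of the invertible differences, and values at C commute. *)
pose V : 'M[{poly k}]_n := Vandermonde n (\row_i 'X^(E (enum_val i))).
pose D := horner_mx C (\det V).
have unitD : D \is a GRing.unit.
  rewrite /D det_Vandermonde rmorph_prod rpred_prod // => i _.
  rewrite rmorph_prod rpred_prod // => j lt_ij.
  rewrite !mxE rmorphB !rmorphXn /= horner_mx_X; apply: C_sep.
  by rewrite (inj_eq enum_val_inj); apply: contraTneq lt_ij => ->; rewrite ltnn.
have rk i (Pi : P i) : exists2 a : 'I_n, enum_val a = i & val a = pidx i.
  have lt_i : (pidx i < n)%N by rewrite /n cardE index_mem mem_enum.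
  exists (Ordinal lt_i) => //.
  by rewrite (enum_val_nth i) nth_index // mem_enum.
have rkv (a : 'I_n) : pidx (enum_val a) = a.
  by rewrite /pidx (enum_val_nth (enum_val a)) index_uniq ?enum_uniq // -cardE.
have PV (a : 'I_n) : P (enum_val a) by exact: enum_valP a.
have comm_h f g : GRing.comm (horner_mx C f) (horner_mx C g).
  by rewrite /GRing.comm -!rmorphM mulrC.
pose W0 a b : 'M[k]_d.+1 := horner_mx C (\adj V b a) * D^-1.
have VE a b : horner_mx C (V a b) = C ^+ (E (enum_val b) * a).
  by rewrite !mxE rmorphXn rmorphXn /= horner_mx_X exprM.
have W01 (a b : 'I_n) : \sum_(c < n) C ^+ (E (enum_val a) * c) * W0 c b = (a == b)%:R.
  rewrite /W0; under eq_bigr do rewrite mulrA.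
  rewrite -mulr_suml (_ : \sum_c _ = D * (a == b)%:R) ?mulr_natr ?mulrnAl ?divrr //.
  transitivity (horner_mx C ((\adj V *m V) b a)).
    rewrite mxE rmorph_sum; apply: eq_bigr => c _.
    by rewrite rmorphM /= -VE; apply: comm_h.
  by rewrite mul_adj_mx mxE rmorphMn /= eq_sym.
have W02 (a b : 'I_n) : \sum_(c < n) W0 a c * C ^+ (E (enum_val c) * b) = (a == b)%:R.
  transitivity (horner_mx C ((V *m \adj V) b a) * D^-1).
    rewrite mxE rmorph_sum mulr_suml; apply: eq_bigr => c _.
    rewrite rmorphM /= -VE /W0 -!mulrA.
    rewrite -(commrV (comm_h _ _ : GRing.comm (horner_mx C (V b c)) D)).
    by rewrite !mulrA comm_h.
  by rewrite mul_mx_adj mxE rmorphMn /= mulrnAl divrr // eq_sym.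
exists (fun u j i => \sum_(a | enum_val a == j) \sum_(b | enum_val b == i) W0 a b * C ^-
  (E i * u)) => u.
have WE (a b : 'I_n) : \sum_(a' | enum_val a' == enum_val a) \sum_(b' | enum_val b' == enum_val b)
    W0 a' b' * C ^- (E (enum_val b) * u) = W0 a b * C ^- (E (enum_val b) * u).
  rewrite (big_pred1 a) => [|a']; last by rewrite (inj_eq enum_val_inj).
  by rewrite (big_pred1 b) => [|b']; last by rewrite (inj_eq enum_val_inj).
have commX a b : GRing.comm (C ^+ a) (C ^+ b) by apply/commrX/commr_sym/commrX.
split=> [i i' /rk[a <- _] /rk[b <- _]|].
  rewrite big_enum_val /=.
  under eq_bigr do rewrite rkv WE mulnDr exprD commX -mulrA [_ ^+ _ * (_ * _)]mulrA mulrA.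
  rewrite -mulr_suml; under eq_bigr do rewrite -mulrA.
  rewrite -mulr_sumr W01 (inj_eq enum_val_inj).
  by have [->|_] := eqVneq a b; rewrite ?mulr1 ?divrr ?unitrX // mulr0 mul0r.
split=> [j j' Pj Pj'|i j e]; last first.
  apply/commr_sym; apply: commr_sum => a _; apply: commr_sum => b _.
  apply: commrM; last exact/commrV.
  have CX : C ^+ e = horner_mx C 'X^e by rewrite rmorphXn /= horner_mx_X.
  by rewrite CX; apply: commrM; [|apply: commrV]; apply: comm_h.
have [a def_j ja] := rk j Pj; have [b def_j' jb] := rk j' Pj'.
rewrite big_enum_val /= -def_j -def_j' rkv.
under eq_bigr do rewrite WE mulnDr exprD commX -mulrA mulKr ?unitrX //.
by rewrite W02 (inj_eq enum_val_inj).
Qed.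
End Vandermonde.

Section Gluing.
Variables (k : fieldType) (p c d : nat).
Local Notation mon := 'X_{1..p}.
Local Notation bmon := 'X_{1..p < c.+1}.
Variable K : mon -> mon -> mon -> 'M[k]_d.

(* x and y index the new basis of the part of degree m, and g and h the old
   one. As K depends on g and y only through g + y, the variables still commute
   when they act through this change of basis. *)
Definition glue (m : nat) (f : mon -> mon -> 'rV[k]_d) (x y : mon) : 'rV[k]_d :=
  \sum_(g : bmon | mdeg g == m) \sum_(h : bmon | mdeg h == (c - m)%N)
    f g h *m K (g + y)%MM x h.

(** Asks for a two-sided inverse [L] of [glue]. The first clause lets [L] see only values in the two
    relevant degrees. *)
Definition gluing (m : nat) : Prop :=
  exists L : (mon -> mon -> 'rV[k]_d) -> mon -> mon -> 'rV[k]_d,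
  [/\ forall f1 f2 : mon -> mon -> 'rV[k]_d,
        (forall x y, mdeg x = m -> mdeg y = (c - m)%N -> f1 x y = f2 x y) ->
        forall x y, L f1 x y = L f2 x y,
      forall f x y, mdeg x = m -> mdeg y = (c - m)%N -> glue m (L f) x y = f x y
    & forall f x y, mdeg x = m -> mdeg y = (c - m)%N -> L (glue m f) x y = f x y].

End Gluing.

Lemma bmnmW (p c : nat) (x : 'X_{1..p}) : (mdeg x <= c)%N -> exists g : 'X_{1..p < c.+1}, x = g.
Proof. by move=> le_x; exists (@BMultinom _ c.+1 x le_x). Qed.

Lemma linear_inverse (k : fieldType) (d : nat) (I : finType) (P Q : pred I)
    (F G : I -> I -> 'M[k]_d.+1) :
  (forall i i', P i -> P i' -> \sum_(j in Q) F i j * G j i' = (i == i')%:R) ->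
  forall (x : I -> 'rV_d.+1) i', P i' ->
    \sum_(j in Q) (\sum_(i in P) x i *m F i j) *m G j i' = x i'.
Proof.
move=> FG x i' Pi'.
transitivity (\sum_(i in P) x i *m (\sum_(j in Q) F i j * G j i')).
  under eq_bigr do rewrite mulmx_suml.
  rewrite exchange_big; apply: eq_bigr => i Pi; rewrite mulmx_sumr.
  by apply: eq_bigr => j _; rewrite -mulmxA.
rewrite (bigD1 i') //= FG // eqxx mulmx1 big1 ?addr0 // => i /andP[Pi ne].
by rewrite FG // (negPf ne) mulmx0.
Qed.

(** With K(s, x, y) = C^(E s (ix x + ix y)) and E additive, the exponent at (g + y, x, h) is E g (ix
    x + ix h) + E y (ix h + ix x). So [glue] is a Vandermonde transform in g for fixed h, followed
    by one in h for fixed x. E reads exponents as digits in base c + 1, hence is injective in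
    degrees at most c, and [ix] is the position among monomials of the same degree. *)
Lemma gluing_exists (k : fieldType) (p c : nat) :
  exists d (K : 'X_{1..p} -> 'X_{1..p} -> 'X_{1..p} -> 'M[k]_d.+1),
  forall m, (m <= c)%N -> gluing c K m.
Proof.
pose E (x : 'X_{1..p}) := (\sum_(v < p) x v * c.+1 ^ v)%N.
have ED x y : E (x + y)%MM = (E x + E y)%N.
  by rewrite /E -big_split; apply: eq_bigr => v _; rewrite mnmDE mulnDl.
have injE : injective (fun g : 'X_{1..p < c.+1} => E g).
  have le_c (g : 'X_{1..p < c.+1}) v : (g v <= c)%N.
    have : (mdeg g < c.+1)%N := bmdeg g.
    by rewrite mdegE (bigD1 v) //=; lia.
  move=> g h eq_gh; apply/val_inj/mnmP.
  by apply: (@digits_inj c); [apply: le_c | apply: le_c |].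
have [d [C [Cu Csep]]] := separating_matrix k injE.
pose P m := [pred g : 'X_{1..p < c.+1} | mdeg g == m].
pose ix (x : 'X_{1..p}) := index x [seq val g | g <- enum (P (mdeg x))].
have ixE m (g : 'X_{1..p < c.+1}) : mdeg g = m -> ix g = pidx (P m) g.
  by move=> dg; rewrite /ix dg /pidx index_map //; apply: val_inj.
exists d, (fun s x y => C ^+ (E s * (ix x + ix y))) => m le_mc.
have [W1 W1E] := vandermonde_inverse (P m) Cu Csep.
have [W2 W2E] := vandermonde_inverse (P (c - m)%N) Cu Csep.
pose bm (x : 'X_{1..p}) : 'X_{1..p < c.+1} := insubd bm0 x.
have bmK (g : 'X_{1..p < c.+1}) : bm g = g by rewrite /bm valKd.
(* The two transforms are inverted in reverse order: first in the second argument with x0 fixed and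
   shift [ix x0], then in the first one with shift [ix y]. *)
pose L f x y := \sum_(x0 in P m) (\sum_(y1 in P (c - m)%N) f (bmnm x0) (bmnm y1) *m W2 (ix x0)
  (bm y) y1) *m W1 (ix y) x0 (bm x) : 'rV[k]_d.+1.
have toP (x : 'X_{1..p}) e : (e <= c)%N -> mdeg x = e -> exists2 g : 'X_{1..p < c.+1},
  x = g & g \in P e.
  move=> le_e dx; have [|g def_x] := @bmnmW p c x; first by rewrite dx.
  by exists g; rewrite ?inE -?def_x ?dx.
have toP2 (x y : 'X_{1..p}) : mdeg x = m -> mdeg y = (c - m)%N ->
    exists g h : 'X_{1..p < c.+1}, [/\ x = g, y = h, g \in P m & h \in P (c - m)%N].
  move=> /(toP _ _ le_mc)[g -> Pg] /(toP _ _ (leq_subr _ _))[h -> Ph].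
  by exists g, h.
exists L; split=> [f1 f2 eq_f x y|f x' y' dx dy|f x' y' dx dy].
- apply: eq_bigr => g /eqP dg; congr (_ *m _); apply: eq_bigr => h /eqP dh.
  by rewrite eq_f.
- have [x [y [-> -> Px Py]]] := toP2 _ _ dx dy.
  rewrite /glue exchange_big /=.
  transitivity (\sum_(h in P (c - m)%N) (\sum_(y1 in P (c - m)%N) f (bmnm x) (bmnm y1) *m W2
    (ix x) h y1)
      *m C ^+ (E y * (pidx (P (c - m)%N) h + ix x))).
    apply: eq_bigr => h /eqP dh.
    have [_ [W1h _]] := W1E (ix h).
    rewrite -[X in X *m _](linear_inverse (Q := P m) W1h (fun x0 =>
      \sum_(y1 in P (c - m)%N) f (bmnm x0) (bmnm y1) *m W2 (ix x0) h y1)) //.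
    rewrite mulmx_suml; apply: eq_bigr => g dg; rewrite /L !bmK.
    rewrite -[RHS]mulmxA; congr (_ *m _).
    by rewrite -(ixE _ _ (eqP Px)) -(ixE _ _ dh) ED mulnDl exprD (addnC (ix h)).
  have [_ [_ W2c]] := W2E (ix x); have [W2x _] := W2E (ix x).
  apply: (linear_inverse (P := P (c - m)%N) (F := fun y1 h => W2 (ix x) h y1) (G := fun h y =>
    C ^+ (E y * (pidx (P (c - m)%N) h + ix x)))) => // i i' Pi Pi'.
  rewrite eq_sym -(W2x i' i Pi' Pi).
  by apply: eq_bigr => h _; apply: W2c.
have [x [y [-> -> Px Py]]] := toP2 _ _ dx dy.
transitivity (\sum_(x0 in P m) (\sum_(g in P m) f g y *m C ^+ (E g * (pidx
  (P m) x0 + ix y))) *m W1 (ix y) x0 x).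
  rewrite /L !bmK; apply: eq_bigr => x0 /eqP dx0; congr (_ *m _).
  have [_ [W2x W2c]] := W2E (ix x0).
  pose Y (h : 'X_{1..p < c.+1}) := \sum_(g in P m) f (bmnm g) (bmnm h) *m C ^+ (E g * (pidx
    (P m) x0 + ix h)).
  have W2x' h h' : P (c - m)%N h -> P (c - m)%N h' ->
      \sum_(y1 in P (c - m)%N) C ^+ (E y1 * (pidx (P (c - m)%N) h + ix x0)) * W2
        (ix x0) h' y1 = (h == h')%:R.
    move=> Ph Ph'; rewrite eq_sym -(W2x h' h Ph' Ph).
    by apply: eq_bigr => y1 _; rewrite W2c.
  rewrite -[RHS]/(Y y) -[RHS](linear_inverse (P := P (c - m)%N) W2x' Y) //.
  apply: eq_bigr => y1 dy1; congr (_ *m _); rewrite /glue exchange_big.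
  apply: eq_bigr => h /eqP dh; rewrite mulmx_suml; apply: eq_bigr => g dg.
  rewrite -[RHS]mulmxA; congr (_ *m _); rewrite -(ixE _ _ dh) -(ixE _ _ dx0).
  by rewrite ED mulnDl exprD (addnC (ix h)).
by have [W1y _] := W1E (ix y); apply: (linear_inverse (P := P m) W1y (fun g =>
  f (bmnm g) (bmnm y))).
Qed.

Section GluedModule.
Variables (k : fieldType) (p c d : nat) (T : finType) (mm : T -> nat).
Local Notation mon := 'X_{1..p}.
Local Notation bmon := 'X_{1..p < c.+1}.
Variable K : mon -> mon -> mon -> 'M[k]_d.
Hypothesis le_mc : forall a, (mm a <= c)%N.

(* In degrees at most m, the monomial y of degree c - m labels a copy of the
   polynomial ring and x is a monomial in it; in degrees at least m, the monomial
   x of degree m labels a copy of the dual and y is a dual monomial. The degree is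
   mdeg x + (c - m - mdeg y) in both cases. *)
Definition cell_ok m (x y : mon) : bool :=
  [&& (mdeg x <= m)%N, (mdeg y <= c - m)%N & (mdeg x == m) || (mdeg y == c - m)%N].

Definition cell : finType := {b : T * bmon * bmon * 'I_d | cell_ok (mm b.1.1.1) b.1.1.2 b.1.2}.
Definition cdim : nat := #|cell|.

Definition cl (s : 'I_cdim) : T := (val (enum_val s)).1.1.1.
Definition cx (s : 'I_cdim) : bmon := (val (enum_val s)).1.1.2.
Definition cy (s : 'I_cdim) : bmon := (val (enum_val s)).1.2.
Definition cn (s : 'I_cdim) : 'I_d := (val (enum_val s)).2.

Lemma cell_okP s : cell_ok (mm (cl s)) (cx s) (cy s).
Proof. exact: valP (enum_val s). Qed.

Lemma cell_inj s t : cl s = cl t -> cx s = cx t :> mon -> cy s = cy t :> mon -> cn s =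
  cn t -> s = t.
Proof.
rewrite /cl /cx /cy /cn => el /val_inj ex /val_inj ey en; apply/enum_val_inj/val_inj.
move: el ex ey en; case: (val (enum_val s)) => [[[? ?] ?] ?].
by case: (val (enum_val t)) => [[[? ?] ?] ?] /= -> -> -> ->.
Qed.

Lemma cell_exists a x y n : cell_ok (mm a) x y ->
  exists s, [/\ cl s = a, cx s = x :> mon, cy s = y :> mon & cn s = n].
Proof.
move=> ok; have /and3P[le_x le_y _] := ok.
have [|gx def_x] := @bmnmW p c x; first exact: leq_trans le_x (le_mc a).
have [|gy def_y] := @bmnmW p c y; first exact: leq_trans le_y (leq_subr _ _).
subst x y; pose b : cell := Sub (a, gx, gy, n) ok.
by exists (enum_rank b); rewrite /cl /cx /cy /cn enum_rankK.
Qed.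

Definition cdeg_of m (x y : mon) : nat := (mdeg x + (c - m - mdeg y))%N.
Definition cdeg s : nat := cdeg_of (mm (cl s)) (cx s) (cy s).

Lemma cdeg_lt s : (cdeg s < c.+1)%N.
Proof. by have /and3P[] := cell_okP s; rewrite /cdeg /cdeg_of; have := le_mc (cl s); lia. Qed.

(** The sum has at most one term; it is empty for inadmissible pairs, so that reading is total with
    value 0 there. *)
Definition cread (a : T) (x y : mon) (v : 'rV[k]_cdim) : 'rV[k]_d :=
  \row_n \sum_(s | [&& cl s == a, cx s == x :> mon, cy s == y :> mon & cn s == n]) v 0 s.

Definition cwrite (f : T -> mon -> mon -> 'rV[k]_d) : 'rV[k]_cdim :=
  \row_s f (cl s) (cx s) (cy s) 0 (cn s).

Lemma creadE v s : cread (cl s) (cx s) (cy s) v 0 (cn s) = v 0 s.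
Proof.
rewrite mxE (big_pred1 s) // => t; apply/and4P/eqP => [[/eqP e1 /eqP e2 /eqP e3 /eqP e4]|->].
  exact: cell_inj.
by rewrite !eqxx.
Qed.

Lemma cread_bad v a x y : ~~ cell_ok (mm a) x y -> cread a x y v = 0.
Proof.
move=> bad; apply/rowP=> n; rewrite !mxE big1 // => s /and4P[/eqP ea /eqP ex /eqP ey _].
by move: bad; rewrite -ea -ex -ey cell_okP.
Qed.

Lemma cread_write f a x y : cell_ok (mm a) x y -> cread a x y (cwrite f) = f a x y.
Proof.
move=> ok; apply/rowP=> n; have [s [<- <- <- <-]] := cell_exists n ok.
by rewrite creadE mxE.
Qed.

Lemma cread_inj v w : (forall a x y, cell_ok (mm a) x y -> cread a x y v = cread a x y w) -> v = w.
Proof.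
by move=> eq_vw; apply/rowP=> s; rewrite -!creadE eq_vw // cell_okP.
Qed.

Lemma cread_is_linear a x y : linear (cread a x y).
Proof.
move=> b u v; apply/rowP=> n; rewrite !mxE mulr_sumr -big_split.
by apply: eq_bigr => s _; rewrite !mxE.
Qed.

HB.instance Definition _ a x y := GRing.isLinear.Build k 'rV[k]_cdim 'rV[k]_d _
  (cread a x y) (cread_is_linear a x y).

(* Above degree m, x_l acts by contraction of the second monomial; glue translates
   between the two bases of the part of degree m. *)
Definition cstep (l : 'I_p) (m : nat) (f : mon -> mon -> 'rV[k]_d) (x y : mon) : 'rV[k]_d :=
  if mdeg y == (c - m)%N then (if (0 < x l)%N then f (x - U_(l))%MM y else 0)
  else if (mdeg y).+1 == (c - m)%N then glue c K m f x (y + U_(l))%MM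
  else f x (y + U_(l))%MM.

Definition cact (l : 'I_p) (v : 'rV[k]_cdim) : 'rV[k]_cdim :=
  cwrite (fun a => cstep l (mm a) (fun x y => cread a x y v)).

Lemma cact_is_linear l : linear (cact l).
Proof.
move=> b u v; apply/rowP=> s; rewrite !mxE /cstep.
case: ifP => _; first by case: ifP => _; rewrite ?linearP ?mxE //= mulr0 addr0.
case: ifP => _; last by rewrite linearP !mxE.
transitivity ((b *: glue c K (mm (cl s)) (fun x y => cread (cl s) x y u) (cx s) (cy s + U_(l))%MM
  + glue c K (mm (cl s)) (fun x y => cread (cl s) x y v) (cx s) (cy s + U_(l))%MM) 0 (cn s));
    last by rewrite !mxE.
congr (fun_of_matrix _ _ _).
rewrite /glue scaler_sumr -big_split; apply: eq_bigr => g _ /=.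
rewrite scaler_sumr -big_split; apply: eq_bigr => h _ /=.
by rewrite linearP mulmxDl scalemxAl.
Qed.

HB.instance Definition _ l := GRing.isLinear.Build k 'rV[k]_cdim 'rV[k]_cdim _ (cact l)
  (cact_is_linear l).

Definition cX (l : nat) : 'M[k]_cdim := oapp (fun l : 'I_p => lin1_mx (cact l)) 0 (insub l).

Lemma cXE (l : 'I_p) v : v *m cX l = cact l v.
Proof. by rewrite /cX valK /= mul_rV_lin1. Qed.

Lemma cread_cact l v a x y : cell_ok (mm a) x y ->
  cread a x y (cact l v) = cstep l (mm a) (fun x y => cread a x y v) x y.
Proof. exact: cread_write. Qed.

Lemma mdegU1 (x : mon) l : mdeg (x + U_(l))%MM = (mdeg x).+1.
Proof. by rewrite mdegD mdeg1 addn1. Qed.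

Lemma mnmBU (x : mon) l : (0 < x l)%N -> (x - U_(l) + U_(l))%MM = x.
Proof.
move=> gt0; apply/mnmP=> i; rewrite mnmDE mnmBE mnm1E subnK //.
by case: eqP => // <-.
Qed.

Lemma mdegBU (x : mon) l : (0 < x l)%N -> mdeg x = (mdeg (x - U_(l))%MM).+1.
Proof. by move=> gt0; rewrite -{1}(mnmBU gt0) mdegU1. Qed.

Lemma cstep_supp l m f x y : cell_ok m x y -> cstep l m f x y != 0 ->
  exists x' y', [/\ cell_ok m x' y', f x' y' != 0 & cdeg_of m x y = (cdeg_of m x' y').+1].
Proof.
rewrite /cstep /cell_ok /cdeg_of => /and3P[le_x le_y ok].
case: ifP => [/eqP dy|/eqP ndy].
  case: ifP => [xl nz|_]; last by rewrite eqxx.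
  exists (x - U_(l))%MM, y; split=> //; last by rewrite (mdegBU xl); lia.
  by apply/and3P; split; rewrite ?dy ?eqxx ?orbT //; move: le_x; rewrite (mdegBU xl); lia.
case: ifP => [/eqP dy nz|/eqP ndy' nz]; last first.
  by exists x, (y + U_(l))%MM; rewrite mdegU1; split=> //; [apply/and3P; split|]; lia.
have [g /andP[/eqP dg nz_g]] : exists g : bmon,
  (mdeg g == m) && (\sum_(h : bmon | mdeg h == (c - m)%N)
    f g h *m K (g + (y + U_(l)))%MM x h != 0).
  apply/existsP; apply: contraNT nz; rewrite negb_exists => /forallP z.
  by rewrite /glue big1 // => g dg; apply/eqP; have := z g; rewrite dg negbK.
have [h /andP[/eqP dh nz_h]] : exists h : bmon, (mdeg h == (c - m)%N) && (f g h != 0).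
  apply/existsP; apply: contraNT nz_g; rewrite negb_exists => /forallP z.
  rewrite big1 // => h dh; have := z h; rewrite dh negbK /= => /eqP->.
  by rewrite mul0mx.
by exists g, h; rewrite dg dh; split=> //; [rewrite !leqnn !eqxx | lia].
Qed.

Lemma cX_entry l s t : cX l s t != 0 -> cl s = cl t /\ cdeg t = (cdeg s).+1.
Proof.
rewrite /cX; case: insubP => [l' _ _|_] /=; last by rewrite mxE eqxx.
rewrite !mxE => nz.
have {nz} : cstep l' (mm (cl t)) (fun x y => cread (cl t) x y (delta_mx 0 s)) (cx t) (cy t) != 0.
  by apply: contraNneq nz => ->; rewrite mxE.
move/(cstep_supp (cell_okP t)) => [x' [y' [_ nz deg_t]]].
have [n] : exists n, cread (cl t) x' y' (delta_mx 0 s) 0 n != 0.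
  apply/existsP; apply: contraNT nz; rewrite negb_exists => /forallP z.
  by apply/eqP/rowP=> n; have := z n; rewrite negbK [in RHS]mxE => /eqP.
rewrite mxE => nz_n.
have [s' /andP[/and4P[/eqP el /eqP ex /eqP ey _]]] : exists s',
    [&& cl s' == cl t, cx s' == x' :> mon, cy s' == y' :> mon & cn s' == n] &&
      ((delta_mx 0 s : 'rV[k]_cdim) 0 s' != 0).
  apply/existsP; apply: contraNT nz_n; rewrite negb_exists => /forallP z.
  by rewrite big1 // => s' hs'; apply/eqP; have := z s'; rewrite hs' negbK.
rewrite mxE eqxx /=; case: (eqVneq s' s) => [e _|]; last by rewrite eqxx.
by rewrite /cdeg deg_t -e ex ey el.
Qed.

Lemma sum_shift (V : nmodType) m l (F : mon -> V) : (m <= c)%N ->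
  \sum_(g : bmon | (mdeg g == m) && (0 < g l)%N) F g =
  \sum_(g : bmon | (mdeg g).+1 == m) F (g + U_(l))%MM.
Proof.
move=> le_m.
pose up (g : bmon) : bmon := insubd bm0 (g + U_(l))%MM.
pose dn (g : bmon) : bmon := insubd bm0 (g - U_(l))%MM.
have upE (g : bmon) : (mdeg g < c)%N -> up g = (g + U_(l))%MM :> mon.
  by move=> lt; rewrite /up insubdK // unfold_in mdegU1.
have dnE (g : bmon) : (0 < g l)%N -> dn g = (g - U_(l))%MM :> mon.
  move=> gt0; rewrite /dn insubdK // unfold_in.
  by have := bmdeg g; rewrite {1}(mdegBU gt0); apply: ltnW.
rewrite (reindex_onto up dn) => [|g /andP[_ gl]]; last first.
  by apply/val_inj; rewrite /= upE dnE // ?mnmBU // -ltnS -mdegBU // bmdeg.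
apply: eq_big => [g|g /andP[/andP[/eqP dg gl] /eqP eg]].
  apply/andP/eqP=> [[/andP[/eqP dg gl] /eqP eg]|dg].
    by rewrite -{1}eg dnE // -mdegBU.
  have lt : (mdeg g < c)%N by rewrite dg.
  rewrite upE // mdegU1 dg eqxx mnmDE mnm1E eqxx addn1; split=> //.
  apply/eqP/val_inj; rewrite /= dnE ?upE ?mnmDE ?mnm1E ?eqxx ?addn1 //.
  by apply/mnmP=> i; rewrite mnmBE mnmDE addnK.
by rewrite upE // -eg dnE // -ltnS -mdegBU // ltnS dg.
Qed.

Lemma cact_comm l l' v : cact l (cact l' v) = cact l' (cact l v).
Proof.
apply: cread_inj => a x y ok; have /and3P[le_x le_y /orP top] := ok.
set m := mm a in ok le_x le_y top *.
rewrite !cread_cact // /cstep; case: ifP => [/eqP dy|/eqP ndy].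
  have okB i : (0 < x i)%N -> cell_ok m (x - U_(i))%MM y.
    move=> xi; rewrite /cell_ok dy leqnn eqxx orbT !andbT.
    by move: le_x; rewrite (mdegBU xi); apply: ltnW.
  have E i j : (if (0 < x i)%N then cread a (x - U_(i))%MM y (cact j v) else 0) =
      if (0 < x i)%N && (0 < x j - (i == j))%N then cread a (x - U_(i) - U_(j))%MM y v else 0.
    case: ifP => // xi; rewrite cread_cact ?okB // /cstep dy eqxx.
    by rewrite mnmBE mnm1E.
  rewrite !E eq_sym; have -> : (x - U_(l) - U_(l') = x - U_(l') - U_(l))%MM.
    by apply/mnmP=> i; rewrite !mnmBE subnAC.
  case: eqP => [-> //|_]; rewrite !subn0 andbC //.
have {top} dx : mdeg x = m by case: top => /eqP.
(* One degree above m, one variable multiplies in degree m - 1 and the other is carried across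
   [glue]. After reindexing by [sum_shift], both orders evaluate K at g + U_i + U_j + y, which is
   symmetric. *)
have [dy1|ndy1] := eqVneq (mdeg y).+1 (c - m)%N.
  have E i j : glue c K m (fun x y => cread a x y (cact i v)) x (y + U_(j))%MM =
      \sum_(g : bmon | (mdeg g).+1 == m) \sum_(h : bmon | mdeg h == (c - m)%N)
         cread a g h v *m K (g + (U_(i) + U_(j)) + y)%MM x h.
    pose F (g : mon) := \sum_(h : bmon | mdeg h == (c - m)%N)
      cread a (g - U_(i))%MM h v *m K (g + (y + U_(j)))%MM x h.
    transitivity (\sum_(g : bmon | (mdeg g == m) && (0 < g i)%N) F g).
      rewrite big_mkcondr; apply: eq_bigr => g /eqP dg; rewrite /F.
      case: ifP => gi; [|rewrite big1 // => h /eqP dh]; last first.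
        by rewrite cread_cact /cell_ok ?dg ?dh ?leqnn ?eqxx // /cstep dh eqxx gi mul0mx.
      apply: eq_bigr => h /eqP dh.
      by rewrite cread_cact /cell_ok ?dg ?dh ?leqnn ?eqxx // /cstep dh eqxx gi.
    rewrite sum_shift ?le_mc //; apply: eq_bigr => g _; apply: eq_bigr => h _.
    congr (cread _ _ _ _ *m K _ _ _); apply/mnmP=> e; rewrite !(mnmBE, mnmDE).
      by rewrite addnK.
    by lia.
  by rewrite !E (addmC U_(l)%MM).
have ndy2 : (mdeg y).+1 != (c - m)%N by [].
have okD i : cell_ok m x (y + U_(i))%MM.
  by rewrite /cell_ok dx mdegU1 leqnn eqxx /= andbT; lia.
rewrite !cread_cact // /cstep !mdegU1 (negPf ndy2).
have -> : (y + U_(l) + U_(l') = y + U_(l') + U_(l))%MM by rewrite -!addmA (addmC U_(l)%MM).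
by [].
Qed.

Lemma cX_comm l l' : cX l *m cX l' = cX l' *m cX l.
Proof.
rewrite /cX; case: insubP => [i _ _|_] /=; last by rewrite mul0mx mulmx0.
case: insubP => [j _ _|_] /=; last by rewrite mul0mx mulmx0.
apply/row_matrixP=> s; rewrite !row_mul !rowE -!mulmxA.
by rewrite !(mulmxA (delta_mx 0 s)) !mul_rV_lin1 /= cact_comm.
Qed.

Definition glued_ops : graded_ops k :=
  GradedOps cdeg_lt cX_comm (fun l s t nz => (cX_entry nz).2).

Lemma glued_lab l s t : go_X glued_ops l s t != 0 -> cl s = cl t.
Proof. by case/cX_entry. Qed.

End GluedModule.

(** * Koszul homology of the glued module *)

Section GluedTor.
Variables (k : fieldType) (p c d : nat) (T : finType) (mm : T -> nat).
Local Notation mon := 'X_{1..p}.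
Local Notation bmon := 'X_{1..p < c.+1}.
Variable K : mon -> mon -> mon -> 'M[k]_d.
Hypothesis le_mc : forall a, (mm a <= c)%N.
Hypothesis gluingK : forall m, (m <= c)%N -> gluing c K m.
Local Notation N := (@cdim p c d T mm).
Local Notation X := (@cX k p c d T mm K).
Local Notation cl := (@cl p c d T mm).
Local Notation cx := (@cx p c d T mm).
Local Notation cy := (@cy p c d T mm).
Local Notation cdeg := (@cdeg p c d T mm).
Local Notation cact := (@cact k p c d T mm K).
Local Notation cwrite := (@cwrite k p c d T mm).
Local Notation Q a e := (fun s : 'I_N => (cdeg s == e) && (cl s == a)).
Local Notation csupp R := (@ksupp k N R 0 0).

Lemma cread_supp a e (v : 'rV[k]_N) b x y : csupp (Q a e) v -> cread b x y v != 0 ->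
  [/\ b = a, cell_ok c (mm a) x y & cdeg_of c (mm a) x y = e].
Proof.
move=> Qv nz; have ok : cell_ok c (mm b) x y.
  by apply: contraNT nz => /(cread_bad (k := k) v) ->.
have [n nz_n] : exists n, cread b x y v 0 n != 0.
  apply/existsP; apply: contraNT nz; rewrite negb_exists => /forallP z.
  by apply/eqP/rowP=> n; have := z n; rewrite negbK [in RHS]mxE => /eqP.
have [s [el ex ey en]] := cell_exists le_mc n ok.
move: nz_n; rewrite -el -ex -ey -en creadE => /Qv /andP[/eqP <- /eqP <-].
by split=> //; exact: cell_okP.
Qed.

Lemma cwrite_supp a e (f : T -> mon -> mon -> 'rV[k]_d) :
  (forall b x y, cell_ok c (mm b) x y -> f b x y != 0 -> b = a /\ cdeg_of c (mm b) x y = e) ->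
  csupp (Q a e) (cwrite f).
Proof.
move=> hf s; rewrite mxE => nz.
have [|el def_e] := hf (cl s) (cx s) (cy s) (cell_okP s).
  by apply: contraNneq nz => ->; rewrite mxE.
by rewrite el eqxx andbT -def_e.
Qed.

Lemma csupp_mul a e l (v : 'rV[k]_N) : csupp (Q a e) v -> csupp (Q a e.+1) (v *m X l).
Proof.
apply: (@ksupp_mul _ _ _ _ 0 0 0 0) => s t /cX_entry[<- ->] /andP[/eqP <- ->].
by rewrite eqxx.
Qed.

Lemma cread_eq a e (v w : 'rV[k]_N) : csupp (Q a e) v -> csupp (Q a e) w ->
  (forall x y, cell_ok c (mm a) x y -> cdeg_of c (mm a) x y = e -> cread a x y v = cread a x y w) ->
  v = w.
Proof.
move=> Qv Qw eq_vw; apply: cread_inj => b x y ok.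
have [zv|/(cread_supp Qv)[-> ok' de]] := eqVneq (cread b x y v) 0; last exact: eq_vw.
have [zw|/(cread_supp Qw)[def_b ok' de]] := eqVneq (cread b x y w) 0; first by rewrite zv zw.
by rewrite def_b; apply: eq_vw.
Qed.

Lemma cread_top0 a e (v : 'rV[k]_N) : (c < e)%N -> csupp (Q a e) v -> v = 0.
Proof.
move=> lt_ce Qv; apply/rowP=> s; rewrite [RHS]mxE; apply/eqP.
apply/negPn/negP => /Qv /andP[/eqP de _].
by have := cdeg_lt le_mc s; rewrite de ltnS leqNgt lt_ce.
Qed.

(* In degrees at most m the module is free over the polynomial ring: an element
   all of whose monomials involve one of x_0, ..., x_(l-1) is divided by the
   first such variable. *)
Lemma monomial_division a e (l : nat) (v : 'rV[k]_N) : (l <= p)%N -> (e <= mm a)%N ->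
  csupp (Q a e) v ->
  (forall x y, cell_ok c (mm a) x y -> cdeg_of c (mm a) x y = e ->
     (forall i : 'I_p, (i < l)%N -> x i = 0%N) -> cread a x y v = 0) ->
  exists2 u : nat -> 'rV[k]_N, forall i, @ksupp k N (fun s =>
    ((cdeg s).+1 == e) && (cl s == a)) l 0 (u i) &
    v = \sum_(i < l) u i *m X i.
Proof.
move=> le_lp le_em Qv v0; set m := mm a in le_em v0.
pose f (i : 'I_p) b (x y : mon) : 'rV[k]_d :=
  if [&& b == a, mdeg y == (c - m)%N, (mdeg x).+1 == e & [forall j : 'I_p,
    (j < i)%N ==> (x j == 0%N)]]
  then cread a (x + U_(i))%MM y v else 0.
pose u (i : nat) : 'rV[k]_N := oapp (fun i : 'I_p => cwrite (f i)) 0 (insub i).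
have uE (i : 'I_p) : u i = cwrite (f i) by rewrite /u valK.
have Qu i : @ksupp k N (fun s => ((cdeg s).+1 == e) && (cl s == a)) 0 0 (u i).
  rewrite /u; case: insubP => [i' _ _|_] /=; last exact: ksupp0.
  have [e0|e_gt0] := posnP e.
    move=> s; rewrite mxE /f; case: ifP; last by rewrite mxE eqxx.
    by case/and4P=> _ _; rewrite e0.
  have def_e s : ((cdeg s).+1 == e) = (cdeg s == e.-1) by rewrite -[in LHS](prednK e_gt0).
  suff Q' : csupp (Q a e.-1) (cwrite (f i')) by move=> s /Q'; rewrite def_e.
  apply: cwrite_supp => b x y ok; rewrite /f; case: ifP; last by rewrite eqxx.
  case/and4P=> /eqP -> /eqP dy /eqP dx _ _; split=> //.
  by rewrite /cdeg_of dy -/m subnn addn0 -dx.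
exists u => //.
have QuX i : csupp (Q a e) (u i *m X i).
  move: (Qu i); case: (e) => [|e'] Qui; last exact: csupp_mul Qui.
  have -> : u i = 0 by apply/rowP=> s; rewrite [RHS]mxE; apply/eqP/negPn/negP => /Qui.
  by rewrite mul0mx; apply: (@ksupp0 _ _ _ 0 0).
apply: (@cread_eq a e) => //.
  elim/big_rec: _ => [|i w _ Qw]; first exact: (@ksupp0 _ _ _ 0 0).
  by apply: (@ksuppD _ _ _ 0 0).
move=> x y ok de; rewrite linear_sum /=.
have [dy dx] : mdeg y = (c - m)%N /\ mdeg x = e.
  have /and3P[le_x le_y top] := ok; move: de top; rewrite /cdeg_of -/m; lia.
have term (i : 'I_l) : cread a x y (u i *m X i) =
    if (0 < x (widen_ord le_lp i))%N && [forall j : 'I_p, (j < i)%N ==> (x j == 0%N)]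
    then cread a x y v else 0.
  pose i' := widen_ord le_lp i; rewrite -[X i]/(X i') cXE
    (cread_cact K le_mc) // /cstep dy eqxx -/i'.
  case: ifP => //= xi; rewrite -[u i]/(u i') uE (cread_write le_mc) /f ?eqxx ?dy //=; last first.
    by rewrite /cell_ok dy leqnn eqxx orbT !andbT -/m (leq_trans _ le_em) // -dx (mdegBU xi).
  rewrite -mdegBU // dx eqxx mnmBU //=; congr (if _ then _ else _).
  rewrite eqxx /=; apply: eq_forallb => j; case: ltnP => //= lt_ji.
  rewrite mnmBE mnm1E; have [eq_ij|_] := eqVneq i' j; last by rewrite subn0.
  by move: lt_ji; rewrite -eq_ij ltnn.
under eq_bigr do rewrite term.
have [/existsP[i0 nz_i0]|none] := boolP [exists i : 'I_l, (0 < x (widen_ord le_lp i))%N];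
  last first.
  rewrite v0 // => [|i lt_il].
    by rewrite big1 // => i _; rewrite if_same.
  apply/eqP; rewrite eqn0Ngt; apply: contra none => xi; apply/existsP.
  by exists (Ordinal lt_il); apply: etrans xi; congr (0 < x _)%N; apply: val_inj.
case: (@arg_minnP _ i0 (fun i : 'I_l => (0 < x (widen_ord le_lp i))%N) (fun i =>
  val i) nz_i0) => i1 x_i1 min_i1.
rewrite (bigD1 i1) //= x_i1 big1 ?addr0 => [|i ne_i].
  rewrite (_ : [forall j, _]) //; apply/forallP=> j; apply/implyP => lt_j.
  rewrite eqn0Ngt; apply/negP => xj.
  have lt_jl := ltn_trans lt_j (ltn_ord i1).
  suff /min_i1 : (0 < x (widen_ord le_lp (Ordinal lt_jl)))%N by rewrite /= leqNgt lt_j.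
  by apply: etrans xj; congr (0 < x _)%N; apply: val_inj.
case: ifP => // /andP[xi /forallP lo]; have := min_i1 _ xi; rewrite leq_eqVlt.
case/orP => [/eqP/val_inj e1|lt]; first by rewrite e1 eqxx in ne_i.
have := lo (widen_ord le_lp i1); rewrite /= lt /=.
by rewrite eqn0Ngt x_i1.
Qed.

Local Notation Qm a e := (fun s : 'I_N => ((cdeg s).+1 == e) && (cl s == a)).

(** The coefficient of v at a monomial x free of the earlier variables reappears in v X_l at x +
    U_l, where combinations of the earlier variables have none. The bound e < m keeps the product in
    the range where the module is free. *)
Lemma glued_regular a e l : (l < p)%N -> (e < mm a)%N -> kregular X (Qm a e) (Q a e) l.
Proof.
move=> lt_lp lt_em v Qv /kdiff0_im[u vX].
apply/(kdiff0_im_supp (Qm a e) X l v).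
apply: (@monomial_division a e) => //; [exact: ltnW | exact: ltnW |].
set m := mm a in lt_em *; move=> x y ok de hx.
have [dy dx] : mdeg y = (c - m)%N /\ mdeg x = e.
  have /and3P[le_x le_y top] := ok; move: de top; rewrite /cdeg_of; lia.
pose l' : 'I_p := Ordinal lt_lp.
have okU : cell_ok c m (x + U_(l'))%MM y.
  by rewrite /cell_ok mdegU1 dx dy lt_em leqnn eqxx orbT.
have <- : cread a (x + U_(l'))%MM y (v *m X l) = cread a x y v.
  rewrite -[X l]/(X l') cXE (cread_cact K le_mc) // /cstep dy eqxx mnmDE mnm1E eqxx addn1 /=.
  by congr (cread _ _ _ _); apply/mnmP=> i; rewrite mnmBE mnmDE addnK.
rewrite vX linear_sum big1 //= => i _.
pose i' := widen_ord (ltnW lt_lp) i; rewrite -[X i]/(X i') cXE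
  (cread_cact K le_mc) // /cstep dy eqxx.
rewrite mnmDE (hx i' (ltn_ord i)) mnm1E (_ : (l' == i') = false) //.
by apply/eqP => /(congr1 val) /= e1; have := ltn_ord i; rewrite -e1 ltnn.
Qed.

(** Contraction by x_l is inverted by multiplying with the dual variable, and this preserves being
    killed by the earlier variables. If the preimage falls in degree m, it must be rewritten in the
    old basis, by the inverse of [glue]. *)
Lemma glued_coregular a e l : (l < p)%N -> (mm a < e)%N -> kcoregular X (Qm a e) (Q a e) l.
Proof.
move=> lt_lp lt_me y Qy yX.
have [le_ec|lt_ce] := leqP e c; last first.
  exists 0; rewrite (cread_top0 lt_ce Qy) mul0mx; split=> //; first exact: ksupp0.
  by move=> l' _; rewrite mul0mx.
have [L [_ surjL _]] := gluingK (le_mc a); set m := mm a in lt_me L surjL *.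
pose l' : 'I_p := Ordinal lt_lp.
(* The preimage in the dual basis, valid in every degree from m on; only in degree m is it passed
   through [L]. *)
pose z (x w : mon) := if (0 < w l')%N then cread a x (w - U_(l'))%MM y else 0.
pose y' := cwrite (fun b x w =>
  if [&& b == a, (cdeg_of c m x w).+1 == e & mdeg x == m]
  then (if mdeg w == (c - m)%N then L z x w else z x w) else 0).
have Qy' : csupp (Qm a e) y'.
  suff Q' : csupp (Q a e.-1) y' by move=> s /Q';
    rewrite -{2}(prednK (leq_ltn_trans (leq0n m) lt_me)).
  apply: cwrite_supp => b x w ok; case: ifP; last by rewrite eqxx.
  by case/and3P=> /eqP -> /eqP <- _ _.
have y'X (i : 'I_p) x w : cell_ok c m x w -> cdeg_of c m x w = e ->
    cread a x w (y' *m X i) = z x (w + U_(i))%MM.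
  move=> ok de; rewrite cXE (cread_cact K le_mc) // /cstep -/m.
  have [dx dw] : mdeg x = m /\ mdeg w = (c - e)%N.
    have /and3P[le_x le_w top] := ok; move: de top; rewrite /cdeg_of; lia.
  rewrite ifN ?dw; last by lia.
  case: ifP => [/eqP dw1|ndw]; last first.
    rewrite (cread_write le_mc); last by rewrite /cell_ok mdegU1 -/m; lia.
    by rewrite eqxx /cdeg_of mdegU1 dx eqxx -/m ifT; [rewrite ifN // dw; lia | lia].
  rewrite -[RHS](surjL z) ?mdegU1 ?dw //.
  apply: eq_bigr => g /eqP dg; apply: eq_bigr => h /eqP dh; congr (_ *m _).
  rewrite (cread_write le_mc); last by rewrite /cell_ok dg dh !leqnn eqxx.
  by rewrite /cdeg_of -/m dg dh !eqxx ifT //; lia.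
exists y'; split=> //.
  move=> l1 lt_l1; have lt_l1p := ltn_trans lt_l1 lt_lp.
  pose i : 'I_p := Ordinal lt_l1p.
  have Qy'X : csupp (Q a e) (y' *m X l1).
    have := @csupp_mul a e.-1 l1 y'; rewrite prednK ?(leq_ltn_trans _ lt_me) //; apply.
    by move=> s /Qy'; rewrite -{1}(prednK (leq_ltn_trans (leq0n m) lt_me)).
  apply: (cread_eq Qy'X); first exact: (@ksupp0 _ _ _ 0 0).
  move=> x w ok de; rewrite -[X l1]/(X i) y'X // linear0 /z.
  have [dx dw] : mdeg x = m /\ mdeg w = (c - e)%N.
    have /and3P[le_x le_w top] := ok; move: de top; rewrite /cdeg_of -/m; lia.
  have neq_il : (i == l') = false.
    by apply/eqP => /(congr1 val) /= e1; rewrite e1 ltnn in lt_l1.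
  rewrite mnmDE mnm1E neq_il addn0; case: ifP => // wl.
  have -> : (w + U_(i) - U_(l') = (w - U_(l')) + U_(i))%MM.
    apply/mnmP=> j; rewrite !(mnmBE, mnmDE, mnm1E).
    by have [<-|_] := eqVneq l' j; rewrite /= ?neq_il; lia.
  have := congr1 (cread a x (w - U_(l'))%MM) (yX l1 lt_l1).
  rewrite linear0 -[X l1]/(X i) cXE; rewrite (mdegBU wl) in dw.
  rewrite (cread_cact K le_mc); last by rewrite /cell_ok -/m dx; lia.
  by rewrite /cstep -/m ifN ?ifN //; lia.
have QyX : csupp (Q a e) (y' *m X l).
  have := @csupp_mul a e.-1 l y'; rewrite prednK ?(leq_ltn_trans _ lt_me) //; apply.
  by move=> s /Qy'; rewrite -{1}(prednK (leq_ltn_trans (leq0n m) lt_me)).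
apply: (cread_eq Qy QyX) => x w ok de; rewrite -[X l]/(X l') y'X // /z.
rewrite mnmDE mnm1E eqxx addn1 /=; congr (cread _ _ _ _).
by apply/mnmP=> i; rewrite mnmBE mnmDE addnK.
Qed.

Lemma mdeg_gt0_var (x : mon) : (0 < mdeg x)%N -> exists i, (0 < x i)%N.
Proof.
move=> dx; apply/existsP; apply: contraTT dx; rewrite negb_exists => /forallP x0.
by rewrite mdegE big1 // => i _; apply/eqP; rewrite eqn0Ngt x0.
Qed.

(** Strictly between m and c each nonconstant dual monomial is detected by contraction with one of
    its variables. In degree m the same holds after [glue], which is injective. *)
Lemma glued_socle a e (v : 'rV[k]_N) : (mm a <= e)%N -> (e < c)%N -> csupp (Q a e) v ->
  (forall l, (l < p)%N -> v *m X l = 0) -> v = 0.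
Proof.
move=> le_me lt_ec Qv vX; have [L [extL _ injL]] := gluingK (le_mc a).
set m := mm a in le_me L extL injL.
apply: (cread_eq Qv (@ksupp0 _ _ _ 0 0)) => x y ok de; rewrite linear0.
have [dx dy] : mdeg x = m /\ mdeg y = (c - e)%N.
  have /and3P[le_x le_y top] := ok; move: de top; rewrite /cdeg_of -/m; lia.
have step (i : 'I_p) x' w : (mdeg x' = m)%N -> ((mdeg w).+1 = c - e)%N ->
    cstep c K i m (fun x y => cread a x y v) x' w = 0.
  move=> dx' dw; have := congr1 (cread a x' w) (vX i (ltn_ord i));
    rewrite linear0 cXE (cread_cact K le_mc) //.
  by rewrite /cell_ok -/m dx'; lia.
have [i yi] : exists i, (0 < y i)%N by apply: mdeg_gt0_var; lia.
have [lt_me|le_em] := ltnP m e.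
  have := step i x (y - U_(i))%MM; rewrite dx -(mdegBU yi) dy => /(_ erefl erefl).
  rewrite /cstep ifN ?ifN ?mnmBU -?(mdegBU yi) ?dy //; rewrite (mdegBU yi) in dy; lia.
have eq_me : e = m by lia.
have glue0 x' w : mdeg x' = m -> mdeg w = (c - m)%N ->
    glue c K m (fun x y => cread a x y v) x' w = glue c K m (fun _ _ => 0) x' w.
  move=> dx' dw; rewrite [RHS]big1 => [|g _]; last by rewrite big1 // => h _; rewrite mul0mx.
  have [j wj] : exists i, (0 < w i)%N by apply: mdeg_gt0_var; lia.
  have := step j x' (w - U_(j))%MM dx'; rewrite -(mdegBU wj) dw eq_me => /(_ erefl).
  by rewrite /cstep ifN ?ifT ?mnmBU -?(mdegBU wj) ?dw //; rewrite (mdegBU wj) in dw; lia.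
rewrite -(injL (fun x y => cread a x y v)) ?dy ?eq_me //.
by rewrite (extL _ _ glue0) injL // dy eq_me.
Qed.

End GluedTor.

Lemma card_bmon p c e : (0 < p)%N -> (e <= c)%N ->
  #|[set x : 'X_{1..p < c.+1} | mdeg x == e]| = 'C(p.-1 + e, p.-1).
Proof.
case: p => // n _ le_e; rewrite /= -(bin_sub (leq_addr _ _)) addKn addnC -size_basis cardE.
rewrite -(size_map val); apply/perm_size/uniq_perm.
- by rewrite (map_inj_uniq val_inj) enum_uniq.
- exact: uniq_basis.
move=> x; rewrite -basis_cover; apply/mapP/eqP => [[g + ->]|dx].
  by rewrite mem_enum inE => /eqP.
have [|g def_x] := @bmnmW _ c x; first by rewrite dx.
by exists g; rewrite // mem_enum inE -def_x dx.
Qed.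

Section GluedBetti.
Variables (k : fieldType) (p c d : nat) (T : finType) (mm : T -> nat).
Local Notation mon := 'X_{1..p}.
Local Notation bmon := 'X_{1..p < c.+1}.
Variable K : mon -> mon -> mon -> 'M[k]_d.
Hypothesis le_mc : forall a, (mm a <= c)%N.
Hypothesis gluingK : forall m, (m <= c)%N -> gluing c K m.
Hypotheses (d_gt0 : (0 < d)%N) (p_gt1 : (1 < p)%N).
Local Notation N := (@cdim p c d T mm).
Local Notation X := (@cX k p c d T mm K).
Local Notation cl := (@cl p c d T mm).
Local Notation cx := (@cx p c d T mm).
Local Notation cy := (@cy p c d T mm).
Local Notation cdeg := (@cdeg p c d T mm).
Local Notation D := (glued_ops K le_mc).
Local Notation lbetti := (@lab_betti k p D T cl).

(** Let e = j - i. For i = p and e >= m the homology is socle, found only in degree c; for e > m and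
    i < p coregularity applies, for e < m and i > 0 regularity, and for i = 0 with 0 < e <= m
    monomials are divisible by a variable. What remains is the pure type. *)
Lemma glued_pure a i j : (i <= p)%N -> j != pure_type p c (mm a) i -> lbetti a i j = 0%N.
Proof.
move=> le_ip ne_j; apply: lab_betti_eq0; first exact: glued_lab.
move=> v Qv cl_v.
have [v0|nz_v] := eqVneq v 0; first by exists 0; rewrite mul0mx.
have [s0 nz_s0] : exists s0, v 0 s0 != 0.
  apply/existsP; apply: contraNT nz_v; rewrite negb_exists => /forallP z.
  by apply/eqP/rowP=> s; have := z s; rewrite negbK [in RHS]mxE => /eqP.
have /andP[/eqP def_j _] := Qv s0 nz_s0.
set e := cdeg (kbase s0); have {def_j} def_j : j = (e + i)%:Z by rewrite -def_j.
have le_ec : (e <= c)%N by rewrite -ltnS cdeg_lt.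
have {}Qv : ksupp (fun s : 'I_N => (cdeg s == e) && (cl s == a)) v.
  move=> s /Qv /andP[/eqP E ->]; rewrite andbT.
  by apply/eqP; move: E; rewrite def_j /=; lia.
clearbody e; clear s0 nz_s0.
have comm l l' : (l < p)%N -> (l' < p)%N -> X l *m X l' = X l' *m X l.
  by move=> _ _; apply: cX_comm.
have raise l : (l < p)%N -> raises (fun s : 'I_N => ((cdeg s).+1 == e) && (cl s == a))
    (fun s : 'I_N => (cdeg s == e) && (cl s == a)) (X l).
  by move=> _ s t /cX_entry[<- ->].
have [/andP[/eqP def_i le_me]|not_top] := boolP ((i == p) && (mm a <= e)%N).
  subst i; case/eqP: nz_v; apply: (kclosed_top_eq0 _ Qv cl_v) => y Qy yX.
  apply: (glued_socle le_mc gluingK le_me _ Qy yX).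
  rewrite ltn_neqAle le_ec andbT; apply: contraNneq ne_j => def_e.
  by rewrite def_j /pure_type eqxx def_e (gtn_eqF (ltnW p_gt1)).
have [le_em|lt_me] := leqP e (mm a); last first.
  have lt_ip : (i < p)%N by rewrite ltn_neqAle le_ip andbT; move: not_top;
    rewrite (ltnW lt_me) andbT.
  have [u _ ->] := kcoregular_exact comm raise (fun l lt_l =>
    glued_coregular le_mc gluingK lt_l lt_me) lt_ip Qv cl_v.
  by exists u.
case: i le_ip ne_j v Qv cl_v nz_v def_j not_top => [|i] le_ip ne_j v Qv cl_v nz_v def_j not_top.
  have e_gt0 : (0 < e)%N by rewrite lt0n; apply: contraNneq ne_j => e0; rewrite def_j e0.
  apply/kdiff0_im; have [|u _ ->] := monomial_division K le_mc (leqnn p) le_em Qv.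
    move=> x y ok de x0; have /and3P[le_x le_y top] := ok; move: de top e_gt0.
    by rewrite /cdeg_of mdegE big1 => [|i _]; [lia | exact: x0].
  by exists u.
have [lt_em|le_me] := ltnP e (mm a).
  have [u _ ->] := kregular_exact comm raise (fun l lt_l => glued_regular le_mc lt_l lt_em) Qv cl_v.
  by exists u.
have eq_em : e = mm a by apply/eqP; rewrite eqn_leq le_em.
move: not_top; rewrite le_me andbT => /negPf ne_ip.
by rewrite def_j /pure_type ne_ip eq_em eqxx in ne_j.
Qed.

Lemma mon_exists e : exists x : mon, mdeg x = e.
Proof. by exists (U_(Ordinal (ltnW p_gt1)) *+ e)%MM; rewrite mdegMn mdeg1 mul1n. Qed.

Lemma cell_deg_exists a e : (e <= c)%N -> exists s : 'I_N, cl s = a /\ cdeg s = e.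
Proof.
move=> le_e; have [x dx] := mon_exists (minn e (mm a)).
have [y dy] := mon_exists (c - maxn e (mm a)).
have le_m := le_mc a.
have ok : cell_ok c (mm a) x y by rewrite /cell_ok dx dy; lia.
have [s [el ex ey _]] := cell_exists le_mc (Ordinal d_gt0) ok.
by exists s; split=> //; rewrite /cdeg el ex ey /cdeg_of dx dy; lia.
Qed.

Lemma glued_betti0 a : (0 < lbetti a 0 0)%N.
Proof.
rewrite /lab_betti /= mxrank0 subn0 [kpart _ _ _ _ _](_ : _ = 0); last first.
  by apply/matrixP=> s t; rewrite /kpart mul_maskmx /kmask /kdeg mxE addn1.
rewrite mxrank0 subn0; apply/card_gt0P.
have [s [el ds]] := cell_deg_exists a (leq0n c).
by exists s; rewrite unfold_in /kmask /kdeg /= el ds !eqxx.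
Qed.

Lemma ktop_index (s : 'I_N) n : exists t : 'I_(krank N n n), kbase t = s.
Proof.
elim: n => [|n [t kt]]; first by exists s.
by exists (rshift _ t); rewrite kbase_rshift.
Qed.

Lemma glued_bettip a : (0 < lbetti a p (c + p)%:Z)%N.
Proof.
rewrite /lab_betti [kpart _ _ p _ _](_ : _ = 0); last first.
  have : krank N p p.+1 = 0%N by apply: krank_gt.
  rewrite /kpart; move: (maskmx _ _ *m _); rewrite /=.
  move=> A A0; apply/matrixP=> s; move: (ltn_ord s); by rewrite [X in (_ < X)%N]A0.
rewrite mxrank0 subn0 [kpart_in _ _ _ _ _](_ : _ = 0); last first.
  have in0 i : i = p -> @kpart_in k p D T cl i (c + p)%:Z a = 0.
    case: i => // i def_p; rewrite /= kpartE; last exact: glued_lab.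
    apply/matrixP=> s t; rewrite mul_mx_mask mxE; case: ifP => // /andP[/eqP].
    by rewrite /kdeg /= => E; have := cdeg_lt le_mc (kbase t); lia.
  exact: in0.
rewrite mxrank0 subn0; apply/card_gt0P.
have [s [el ds]] := cell_deg_exists a (leqnn c); have [t kt] := ktop_index s p.
by exists t; rewrite unfold_in /kmask /kdeg /= kt /= el ds !eqxx.
Qed.
Lemma card_cells a e : (e <= c)%N -> #|[set s : 'I_N | (cdeg s == e) && (cl s == a)]| =
  (#|[set x : bmon | mdeg x == minn e (mm a)]| * #|[set y : bmon | mdeg y == (c - maxn e
    (mm a))%N]| * d)%N.
Proof.
move=> le_e; rewrite -[in RHS](card_ord d) -[#|'I_d|]cardsT -!cardsX.
rewrite -(card_in_imset (f := fun s => (cx s, cy s, cn s))); last first.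
  move=> s t; rewrite !inE => /andP[_ /eqP es] /andP[_ /eqP et] [ex ey en].
  by apply: cell_inj; rewrite ?ex ?ey ?es ?et.
have le_m := le_mc a.
apply: eq_card => -[[x y] n]; rewrite !inE andbT;
  apply/imsetP/andP => [[s + [-> -> _]]|[/eqP dx /eqP dy]].
  rewrite inE => /andP[/eqP <- /eqP el]; have := cell_okP s; rewrite /cell_ok /cdeg /cdeg_of el.
  by case/and3P => le_x le_y top; split; apply/eqP; rewrite /=; lia.
have ok : cell_ok c (mm a) x y by rewrite /cell_ok dx dy; lia.
have [s [el ex ey en]] := cell_exists le_mc n ok.
exists s; first by rewrite inE /cdeg el ex ey eqxx andbT /cdeg_of dx dy; lia.
by rewrite -en; congr (_, _, _); apply: val_inj.
Qed.

(** In degree e the cells are pairs of monomials of degrees min(e, m) and c - max(e, m), each taken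
    d times; the product of the two counts is the value of [hat] on either piece. *)
Lemma glued_hilbert a j : (@hilbert k D T cl a j)%:~R = d%:R * hat p c (mm a) j :> rat.
Proof.
have le_m := le_mc a.
have p_gt0 := ltnW p_gt1.
case: j => [e|e]; last first.
  rewrite /hilbert eq_card0 => [|s]; last by rewrite !inE.
  by rewrite /hat /= mulr0 mulr0.
have [le_e|lt_e] := leqP e c; last first.
  rewrite /hilbert eq_card0 => [|s]; last first.
    rewrite !inE; apply/negP => /andP[/eqP E _]; have := cdeg_lt le_mc s.
    by move: E; rewrite /=; lia.
  by rewrite /hat lez_nat ifN; [rewrite [rcoef _ (_ - _)]rcoef_lt0 ?mulr0 //; lia | lia].
have -> : @hilbert k D T cl a e = (d * ('C(p.-1 + minn e (mm a),
  p.-1) * 'C(p.-1 + (c - maxn e (mm a)), p.-1)))%:Z.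
  rewrite mulnC -!(@card_bmon p c) //; try lia.
  by rewrite -card_cells // /hilbert cardsE.
rewrite -pmulrn !natrM /hat lez_nat; congr (_ * _).
have rE (x y : nat) : (y <= x)%N -> rcoef p (x%:Z - y%:Z) = 'C(p.-1 + (x - y), p.-1)%:R.
  by move=> le_yx; rewrite subzn.
case: leqP => [le_em|lt_me].
  by rewrite rE //= mulrC.
by rewrite rE.
Qed.

End GluedBetti.

(** * The characterization *)

Lemma common_denominator (lam : nat -> rat) c : (forall m, 0 <= lam m) ->
  exists2 e : nat, (0 < e)%N & exists mu : nat -> nat, forall m,
    (m < c)%N -> lam m = (mu m)%:R / e%:R.
Proof.
move=> lam_ge0; elim: c => [|c [e e_gt0 [mu muE]]]; first by exists 1%N => //; exists id.
pose D := `|denq (lam c)|%N.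
have D_gt0 : (0 < D)%N by rewrite absz_gt0 denq_neq0.
have lam_c : lam c = `|numq (lam c)|%:R / D%:R.
  by rewrite /D !natr_absz !ger0_norm ?divq_num_den // ?numq_ge0 ?denq_ge0.
exists (e * D)%N; first by rewrite muln_gt0 e_gt0.
have nzD : D%:R != 0 :> rat by rewrite pnatr_eq0 -lt0n.
have nze : e%:R != 0 :> rat by rewrite pnatr_eq0 -lt0n.
exists (fun m => if m == c then (`|numq (lam c)| * e)%N else (mu m * D)%N) => m.
rewrite ltnS leq_eqVlt; case: eqP => [-> _|_ /= lt_m].
  by rewrite [LHS]lam_c !natrM; field; rewrite nzD nze.
by rewrite muE // !natrM; field; rewrite nzD nze.
Qed.

Lemma level_of_wron (k : fieldType) (p q c : nat) (h : {poly rat})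
    (hp : (1 < p)%N) (hc : size h = c.+1) :
  (forall i : int, 0 <= wron p c (hcoef h) i) ->
  exists (M : gradedModule k (p + q)) (b : nat -> int -> nat) (g : int -> int) (z : rat),
     [/\ level M p, generated_in_degree M 0 & is_betti M b] /\
     [/\ pure_combination p (fun i j => (b i j)%:R),
         is_hvector (p + q) p b g,
         0 < z
       & forall i : int, hcoef h i = z * (g i)%:~R].
Proof.
move=> wron_ge0.
have h_lt0 j : j < 0 -> hcoef h j = 0 by case: j.
have h_gt j : c%:Z < j -> hcoef h j = 0.
  by case: j => // j lt_cj; rewrite /= nth_default // hc.
have [lam lam_ge0 hE] := hat_decomposition hp h_lt0 h_gt wron_ge0.
have [e e_gt0 [mu muE]] := common_denominator c.+1 lam_ge0.
have [d [K gluingK]] := gluing_exists k p c.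
(* One summand glued at m for each unit of [mu m], so that the hats add up to e times h. *)
pose T : finType := {m : 'I_c.+1 & 'I_(mu m)}.
pose mm (a : T) : nat := tag a.
have le_mc a : (mm a <= c)%N by rewrite -ltnS ltn_ord.
have nz_e : e%:R != 0 :> rat by rewrite pnatr_eq0 -lt0n.
have nz_d : d.+1%:R != 0 :> rat by rewrite pnatr_eq0.
have sum_hat j : \sum_(a : T) hat p c (mm a) j = e%:R * hcoef h j.
  rewrite -(sig_big_dep (fun _ => true) (fun _ _ => true) (fun (m : 'I_c.+1) (_ : 'I_(mu m)) =>
    hat p c m j)) /=.
  rewrite hE mulr_sumr; apply: eq_bigr => m _.
  by rewrite sumr_const card_ord muE // mulrA mulrC -mulr_natr; field.
(* There is a summand because the leading coefficient of h is nonzero; levelness asks for nonzero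
   Betti numbers. *)
have [a0 _] : exists a : T, true.
  apply/existsP; apply: contraTT isT; rewrite negb_exists => /forallP no_a.
  have := sum_hat c%:Z; rewrite big1 => [|a]; last by have := no_a a.
  move/esym/eqP; rewrite mulf_eq0 (negPf nz_e) /= -[c]/(c.+1.-1) -hc -lead_coefE.
  by rewrite lead_coef_eq0 -size_poly_eq0 hc.
pose D := glued_ops K le_mc.
have lab := @glued_lab _ _ _ _ T mm K le_mc.
have pure a i j := @glued_pure _ _ _ _ T mm K le_mc gluingK (ltn0Sn d) hp a i j.
have betti0 := glued_betti0 K le_mc (ltn0Sn d) hp.
have bettip := glued_bettip K le_mc (ltn0Sn d) hp.
(* The factor undoes the common denominator and the [d.+1] copies of each cell. *)
exists (ext_gmodule p q D), (tor_dim (ext_resolution p q D)),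
  (fun j => \sum_a hilbert (D := D) (@cl p c d.+1 T mm) a j), (e * d.+1)%:R^-1.
split; split.
- exact: (ext_level q lab a0 hp pure betti0 bettip).
- by apply: ext_generated0 => j; apply: (ext_betti0 q lab pure).
- by exists (ext_resolution p q D).
- exact: (ext_pure_combination q lab hp le_mc pure betti0).
- exact: ext_hvector.
- by rewrite invr_gt0 ltr0n muln_gt0 e_gt0.
move=> j; rewrite rmorph_sum /=.
under eq_bigr do rewrite glued_hilbert //.
rewrite -mulr_sumr sum_hat natrM; move: nz_d; move: (d.+1%:R) => x nz_x.
by field; rewrite nz_e nz_x.
Qed.

Theorem theorem4p7 (k : fieldType) (n p c : nat) (h : {poly rat})
    (hp : (1 < p)%N) (hpn : (p <= n)%N) (hc : size h = c.+1) :
  (exists (M : gradedModule k n) (b : nat -> int -> nat) (g : int -> int)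
          (q : rat),
     [/\ level M p, generated_in_degree M 0 & is_betti M b] /\
     [/\ pure_combination p (fun i j => (b i j)%:R),
         is_hvector n p b g,
         0 < q
       & forall i : int, hcoef h i = q * (g i)%:~R])
  <->
  (forall i : int, 0 <= \det (hmatrix p c h i)).
Proof.
split=> [[M [b [g [z [[lev gen [F bF]] [comb hvec z_gt0 hE]]]]]] i|det_ge0].
  rewrite det_hmatrix; have [_ _ [b' [F' bF'] [_ [J [_ J_uniq]]]]] := lev.
  apply: (@hvector_wron_ge0 _ _ _ _ _ _ _ hp hpn hc comb hvec z_gt0 hE _ J) => [j nz_j|j ne_j].
    by rewrite bF; apply: tor_dim0_eq0.
  (* Levelness refers to its own resolution F', with Tor_p in the single degree J; the vanishing
     elsewhere is transferred to the resolution F computing b. The transfer is for positive indices,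
     hence the case split on p. *)
  rewrite bF; case: p hp {hpn comb hvec lev} b' F' bF' J_uniq ne_j =>
    // p' hp b' F' bF' J_uniq ne_j.
  apply: (@tor_dim_eq0_transfer _ _ _ F F'); rewrite -bF'.
  have [//|/eqP/J_uniq eJ] := eqVneq (b' p'.+1 j) 0%N.
  by rewrite eJ eqxx in ne_j.
have [q ->] : exists q, n = (p + q)%N by exists (n - p)%N; rewrite subnKC.
by apply: (@level_of_wron k p q c h hp hc) => i; rewrite -det_hmatrix.
Qed.
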